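(* For every $r\ge 4$ the family $\mathcal K^{M^r_2}_{2r}$ of weak expansions of $M^r_2$ is degree-stable with respect to the class $\mathfrak S^r$ of all complete semibipartite $r$-graphs.
   Context: An $r$-graph is a finite $r$-uniform hypergraph $\mathcal H$, identified with its edge set, with vertex set $V(\mathcal H)$; $\delta(\mathcal H)$ is its minimum vertex degree (the degree of a vertex is the number of edges containing it). For a family $\mathcal F$ of $r$-graphs, $\mathcal H$ is $\mathcal F$-free if it contains no member of $\mathcal F$ as a (not necessarily induced) subgraph; $\mathrm{ex}(n,\mathcal F)$ is the maximum number of edges of an $\mathcal F$-free $r$-graph on $n$ vertices, and $\pi(\mathcal F)=\lim_{n\to\infty}\mathrm{ex}(n,\mathcal F)/\binom nr$. $M^r_2$ is the $r$-graph on $2r$ vertices consisting of two disjoint edges. The family $\mathcal K^{M^r_2}_{2r}$ of weak expansions of $M^r_2$ is the set of all $r$-graphs of the form $M^r_2\cup\{S_{uv}\}$, where $uv$ ranges over all pairs of vertices of $M^r_2$ not contained in a common edge of $M^r_2$, and $S_{uv}$ is, for each such pair, an $r$-set containing $u$ and $v$ (its other vertices may be arbitrary, inside or outside $V(M^r_2)$, and the sets $S_{uv}$ may overlap or coincide). An $r$-graph $\mathcal H$ is semibipartite if there is a partition $V(\mathcal H)=A\cup B$ into disjoint (possibly empty) sets such that $|A\cap E|=1$ for every $E\in\mathcal H$; it is complete semibipartite if moreover it contains all $|A|\binom{|B|}{r-1}$ such edges. A family $\mathcal F$ is degree-stable with respect to a class $\mathfrak H$ of $\mathcal F$-free $r$-graphs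 if there exist $\epsilon>0$ and $N_0$ such that every $\mathcal F$-free $r$-graph $\mathcal H$ on $n\ge N_0$ vertices with $\delta(\mathcal H)\ge(\pi(\mathcal F)/(r-1)!-\epsilon)n^{r-1}$ is a subgraph of some member of $\mathfrak H$. *)

(* Defs.v *)
From HB Require Import structures.
From mathcomp Require Import all_boot all_order all_algebra.
From mathcomp Require Import all_classical all_reals all_analysis.

Set Implicit Arguments.
Unset Strict Implicit.
Unset Printing Implicit Defensive.

Import Order.TTheory GRing.Theory Num.Theory.
Import numFieldNormedType.Exports.

Local Open Scope ring_scope.

(* An r-graph is an edge set [H : {set {set T}}] satisfying [is_uniform r H]; its
   vertex set is the whole finite type [T], so isolated vertices are allowed. *)
Definition is_uniform (r : nat) (T : finType) (H : {set {set T}}) : Prop :=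
  forall e, e \in H -> #|e| = r.

Definition degree (T : finType) (H : {set {set T}}) (v : T) : nat :=
  #|[set e in H | v \in e]|.

(* The default value #|H| bounds every degree, hence it only matters when there
   are no vertices at all. *)
Definition min_degree (T : finType) (H : {set {set T}}) : nat :=
  \big[minn/#|H|]_(v : T) degree H v.

(* [G] is isomorphic to a (not necessarily induced) subgraph of [H]. *)
Definition subgraph (T U : finType) (G : {set {set T}}) (H : {set {set U}})
    : Prop :=
  exists f : T -> U,
    injective f /\ forall e : {set T}, e \in G -> f @: e \in H.

(* Families and classes of hypergraphs, possibly infinite. *)
Definition hfamily : Type := forall T : finType, {set {set T}} -> Prop.

Definition is_free (F : hfamily) (T : finType) (H : {set {set T}}) : Prop :=
  forall (U : finType) (G : {set {set U}}), F U G -> ~ subgraph G H.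

Definition turan_number (r n : nat) (F : hfamily) : nat :=
  (\max_(H : {set {set 'I_n}} | `[< is_uniform r H /\ is_free F H >]) #|H|)%N.

Definition turan_density (R : realType) (r : nat) (F : hfamily) : R :=
  limn (fun n : nat => (turan_number r n F)%:R / 'C(n, r)%:R : R).

Definition degree_stable (R : realType) (r : nat) (F C : hfamily) : Prop :=
  (forall (T : finType) (G : {set {set T}}), C T G -> is_uniform r G /\ is_free F G)
  /\
  exists (eps : R) (N0 : nat), 0 < eps /\
    forall (T : finType) (H : {set {set T}}),
      is_uniform r H -> is_free F H -> (N0 <= #|T|)%N ->
      (turan_density R r F / (r.-1)`!%:R - eps) * #|T|%:R ^+ r.-1
        <= (min_degree H)%:R ->
      exists (U : finType) (G : {set {set U}}), C U G /\ subgraph H G.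

Definition uncovered_pairs (T : finType) (F : {set {set T}}) : {set {set T}} :=
  [set p : {set T} | (#|p| == 2)%N && ~~ [exists e in F, p \subset e]].

(* [f] identifies V(F) with its copy in V(G), and [S] chooses the r-set attached
   to each uncovered pair; the last condition says that V(G) is exactly the
   union of V(F) and of these r-sets. *)
Definition weak_expansions (r : nat) (T : finType) (F : {set {set T}})
    : hfamily :=
  fun (U : finType) (G : {set {set U}}) =>
    exists (f : T -> U) (S : {set T} -> {set U}),
      [/\ injective f,
          (forall p, p \in uncovered_pairs F ->
             #|S p| = r /\ f @: p \subset S p),
          G = [set f @: (e : {set T}) | e in F]
                :|: [set S p | p in uncovered_pairs F] &
          [set: U] = [set f x | x : T]
                :|: \bigcup_(p in uncovered_pairs F) S p]%SET.

Definition M2 (r : nat) : {set {set ('I_r + 'I_r)%type}} :=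
  [set [set inl i | i : 'I_r]; [set inr i | i : 'I_r]]%SET.

(* The partition is given by A and its complement. *)
Definition complete_semibipartite (r : nat) : hfamily :=
  fun (T : finType) (H : {set {set T}}) =>
    is_uniform r H /\
    exists A : {set T},
      (forall e : {set T}, e \in H -> #|A :&: e| = 1%N) /\
      (forall e : {set T}, #|e| = r -> #|A :&: e| = 1%N -> e \in H).

(* Main.v *)
(* A hypergraph H is free of the weak expansions of two disjoint edges iff any two disjoint edges
   of H contain vertices, one in each, that no edge covers together.  Replacing a vertex u by a copy
   of a vertex v not covered with u preserves this, so a dense H can be symmetrized without losing
   edges until uncovered vertices are twins.  Collapsing the twin classes then yields an intersecting
   r-graph T, and |H| is at most n^r times the Lagrangian polynomial of T at the class sizes.  If the
   edges of T have a common vertex, H is semibipartite.  Otherwise T is shifted, which does not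
   decrease its Lagrangian: either a shifted family without a common vertex is reached, for which
   induction on r and on the number of colours bounds r! times the Lagrangian by
   1/e < (1 - 1/r)^(r-1), or a family covered by two colours, for which a direct estimate leaves a
   gap below (1 - 1/r)^(r-1).  Either way H would have too few edges.
   The symmetrization is undone one step at a time: few vertices have low degree, and a vertex of
   almost maximal degree can be put back into a semibipartite induced subgraph on almost all
   vertices, keeping it semibipartite. *)
Require Import Defs.
From mathcomp Require Import all_boot all_order all_algebra.
From mathcomp Require all_classical all_reals all_analysis.
From mathcomp Require Import boolp reals sequences exp.
From mathcomp Require Import ring lra zify.

Set Implicit Arguments.
Unset Strict Implicit.
Unset Printing Implicit Defensive.

Import Order.TTheory GRing.Theory Num.Theory.

Local Open Scope ring_scope.

(** The constant 1/e is the limit of the decreasing densities (1 - 1/r)^(r-1). Because it does not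
    depend on r, it survives splitting a shifted family at its last colour m: bounds c s^r for the
    edges avoiding m and c s^(r-1) for the link of m add up to the tangent bound for c (s + x_m)^r.
    The link inherits the hypotheses with three exceptions. On a small support it need not be
    intersecting. It can be a star although the family is not. For r = 4 it is 3-uniform, where 1/e
    is false: all triples of five colours form an intersecting family with 3! times Lagrangian
    60/125. Cloning controls the number of edges but not the minimum degree. Degrees are therefore
    recovered by counting: a graph with nearly L n^r / r! edges has few vertices of low degree,
    since deleting many of them would leave a graph too dense for its order. Here L is the Turan
    density, which enters through (1 - 1/r)^(r-1) <= L <= 1 and the edge bound that defines it. *)

(** The tangent-line bound for t^(n+1) at a. With b the mean or total weight after one vertex is
    added, it drives the inductions on weights below. *)
Lemma bernoulli (R : realFieldType) (a b : R) n : 0 <= a -> 0 <= b ->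
  a ^+ n.+1 + n.+1%:R * a ^+ n * (b - a) <= b ^+ n.+1.
Proof.
move=> a0 b0; elim: n => [|n IH]; first by rewrite expr0 !expr1; lra.
have h : 0 <= n.+1%:R * a ^+ n * (b - a) ^+ 2 by apply: mulr_ge0 (sqr_ge0 _);
  rewrite mulr_ge0 ?exprn_ge0.
rewrite [b ^+ _]exprS; apply: le_trans (ler_wpM2l b0 IH).
rewrite [a ^+ n.+2]exprS [a ^+ n.+1]exprS -subr_ge0 [n.+2%:R]mulrS.
rewrite [leRHS](_ : _ = n.+1%:R * a ^+ n * (b - a) ^+ 2)//; ring.
Qed.

Lemma set_indU (C : finType) (P : {set C} -> Prop) :
  P set0 -> (forall z (A : {set C}), z \notin A -> P A -> P (z |: A)) -> forall A, P A.
Proof.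
move=> P0 PU A; have [n] := ubnP #|A|; elim: n A => // n IH A.
case: (set_0Vmem A) => [->//|[z zA]]; rewrite (cardsD1 z) zA ltnS => An.
by rewrite -(setD1K zA); apply: PU (IH _ An); rewrite !inE eqxx.
Qed.

(** * Lagrangians *)

Section Weights.
Variables (R : realFieldType) (C : finType) (x : C -> R).
Implicit Types (T : {set {set C}}) (A B : {set C}).

(* The Lagrangian polynomial of T at the weights x. *)
Definition lam T : R := \sum_(e in T) \prod_(i in e) x i.

Definition wt A : R := \sum_(i in A) x i.

Definition elsym n A : R := lam [set e : {set C} | (e \subset A) && (#|e| == n)].

Definition link (m : C) T := [set f : {set C} | (m \notin f) && (m |: f \in T)].

Lemma lam_split m T :
  lam T = lam [set e in T | m \notin e] + x m * lam (link m T).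
Proof.
rewrite /lam (bigID (fun e : {set C} => m \notin e)) /=; congr (_ + _).
  by apply: eq_bigl => e; rewrite inE.
rewrite (reindex_onto (fun f => m |: f) (fun e => e :\ m)) /=; last first.
  by move=> e /andP[_]; rewrite negbK => me; rewrite setD1K.
rewrite big_distrr /=; apply: eq_big => [f|f].
  rewrite /link [RHS]in_set setU11 /= andbT; case: (boolP (m \in f)) => mf /=.
    apply/negbTE; rewrite negb_and; apply/orP; right.
    by apply: contraTneq mf => <-; rewrite !inE eqxx.
  by rewrite setU1K ?eqxx ?andbT.
move=> /andP[_ /eqP fE]; rewrite big_setU1 //.
by rewrite -fE !inE eqxx.
Qed.

Hypothesis x0 : forall i, 0 <= x i.

Lemma prod_ge0 (e : {set C}) : 0 <= \prod_(i in e) x i.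
Proof. exact: prodr_ge0. Qed.

Lemma lam_ge0 T : 0 <= lam T.
Proof. by apply: sumr_ge0 => e _; apply: prod_ge0. Qed.

Lemma wt_ge0 A : 0 <= wt A.
Proof. exact: sumr_ge0. Qed.

Lemma lamS T T' : T \subset T' -> lam T <= lam T'.
Proof.
move=> sT; rewrite /lam [leRHS](bigID (mem T)) /= -[leLHS]addr0; apply: lerD.
  rewrite le_eqVlt; apply/orP; left; apply/eqP; apply: eq_bigl => e /=.
  by case: (boolP (e \in T)) => eT; rewrite ?andbT ?andbF// (subsetP sT).
by apply: sumr_ge0 => e _; apply: prod_ge0.
Qed.

Lemma lam_le_esym T n A :
  (forall e, e \in T -> e \subset A /\ #|e| = n) -> lam T <= elsym n A.
Proof. by move=> h; apply: lamS; apply/subsetP => e /h[eA en]; rewrite inE eA en eqxx. Qed.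

Lemma lam0 : lam set0 = 0.
Proof. by rewrite /lam big_set0. Qed.

Lemma elsym0 A : elsym 0 A = 1.
Proof.
rewrite /elsym /lam (big_pred1 set0) ?big_set0// => e.
by rewrite inE cards_eq0 /=; case: eqVneq => [->|]; rewrite ?sub0set ?andbF.
Qed.

Lemma elsym_set0 n : elsym n.+1 set0 = 0.
Proof.
rewrite /elsym (_ : [set _ | _] = set0) ?lam0//.
by apply/setP => e; rewrite !inE subset0; case: eqVneq => [->|//]; rewrite cards0.
Qed.

Lemma elsymS n z A : z \notin A ->
  elsym n.+1 (z |: A) = elsym n.+1 A + x z * elsym n A.
Proof.
move=> zA; rewrite /elsym (lam_split z); congr (lam _ + _ * lam _).
  apply/setP => e; rewrite !inE; case: (boolP (z \in e)) => ze; rewrite ?andbF ?andbT.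
    by symmetry; apply/negbTE; apply: contra zA => /andP[/subsetP/(_ _ ze)].
  by rewrite -[in RHS](setU1K zA) subsetD1 ze andbT.
apply/setP => f; rewrite !inE; case: (boolP (z \in f)) => zf /=.
  by symmetry; apply/negbTE; apply: contra zA => /andP[/subsetP/(_ _ zf)].
rewrite cardsU1 zf eqSS; congr (_ && _).
by rewrite subUset sub1set setU11 /= -[in RHS](setU1K zA) subsetD1 zf andbT.
Qed.

Lemma wtU1 z A : z \notin A -> wt (z |: A) = x z + wt A.
Proof. by move=> zA; rewrite /wt big_setU1. Qed.

Lemma elsym1 A : elsym 1 A = wt A.
Proof.
elim/set_indU: A => [|z A zA IH]; first by rewrite elsym_set0 /wt big_set0.
by rewrite elsymS// elsym0 mulr1 IH wtU1// addrC.
Qed.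

(** Maclaurin's inequality, a being the mean weight. Adding z moves the mean from a to b; by
    Pascal's rule the two inductive bounds add up to a binomial coefficient times the tangent at a,
    evaluated at b. *)
Lemma elsym_maclaurin A n (a : R) : 0 <= a -> wt A = #|A|%:R * a ->
  elsym n A <= 'C(#|A|, n)%:R * a ^+ n.
Proof.
elim/set_indU: A n a => [|z A zA IH] n b b0 wE.
  case: n => [|n]; first by rewrite elsym0 bin0 mul1r.
  by rewrite elsym_set0 mulr_ge0 ?exprn_ge0.
case: n => [|n]; first by rewrite elsym0 bin0 mul1r.
have [a [a0 aE]] : exists a, 0 <= a /\ wt A = #|A|%:R * a.
  case: (posnP #|A|) => [A0|A0].
    by exists b; split=> //; rewrite A0 mul0r (cards0_eq A0) /wt big_set0.
  exists (wt A / #|A|%:R); rewrite divr_ge0 ?wt_ge0//; split=> //.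
  by rewrite mulrC divfK // pnatr_eq0 -lt0n.
rewrite elsymS//; apply: le_trans (lerD (IH n.+1 a a0 aE) (ler_wpM2l (x0 z) (IH n a a0 aE))) _.
move: wE; rewrite wtU1// aE cardsU1 zA add1n => wE.
apply: le_trans (ler_wpM2l (ler0n R _) (bernoulli n a0 b0)).
rewrite mulrDr (mulrA _ (n.+1%:R * _)) mulrA -natrM [in X in _ <= _ + X]mulnC.
rewrite -mul_bin_diag natrM -/(#|A|.+1) /= binS natrD.
have -> : x z = #|A|.+1%:R * b - #|A|%:R * a by rewrite -wE; ring.
rewrite mulrS [a ^+ n.+1]exprS -subr_ge0 [leRHS](_ : _ = 0)//; ring.
Qed.

Lemma elsym_le n A : n`!%:R * elsym n A <= wt A ^+ n.
Proof.
elim/set_indU: A n => [|z A zA IH] n; case: n => [|n]; rewrite ?elsym0 ?mulr1//.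
  by rewrite elsym_set0 mulr0 exprn_ge0 ?wt_ge0.
rewrite elsymS// wtU1// mulrDr.
have h := bernoulli n (wt_ge0 A) (addr_ge0 (x0 z) (wt_ge0 A)).
apply: le_trans h; apply: lerD => //.
rewrite factS natrM addrK.
have -> : n.+1%:R * n`!%:R * (x z * elsym n A) = n.+1%:R * x z * (n`!%:R * elsym n A) by ring.
have -> : n.+1%:R * wt A ^+ n * x z = n.+1%:R * x z * wt A ^+ n by ring.
by rewrite ler_wpM2l // mulr_ge0.
Qed.

Lemma elsymM n p A B : [disjoint A & B] -> elsym n A * elsym p B =
  lam [set e : {set C} | [&& e \subset A :|: B, #|e :&: A| == n & #|e :&: B| == p]].
Proof.
move=> dAB; rewrite /elsym /lam big_distrlr pair_big /=.
rewrite [RHS](reindex_onto (fun u => u.1 :|: u.2) (fun e => (e :&: A, e :&: B))) /=; last first.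
  by move=> e; rewrite inE => /and3P[/setIidPl eAB _ _]; rewrite -setIUr.
have AB0 : A :&: B = set0 by apply/eqP; rewrite setI_eq0.
have key (u v : {set C}) : u \subset A -> v \subset B ->
    (u :|: v) :&: A = u /\ (u :|: v) :&: B = v.
  move=> /setIidPl uA /setIidPl vB; split; rewrite setIUl.
    by rewrite uA -vB -setIA (setIC B) AB0 setI0 setU0.
  by rewrite vB -uA -setIA AB0 setI0 set0U.
apply: eq_big => [[u v]|[u v]] /=.
  rewrite !inE; apply/idP/idP.
    move=> /andP[/andP[uA /eqP un] /andP[vB /eqP vp]].
    by have [-> ->] := key u v uA vB; rewrite setUSS// un vp !eqxx.
  move=> /andP[/and3P[sub uA vB] /eqP[uE vE]].
  move: uA vB; rewrite uE vE => -> ->; rewrite !andbT.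
  by rewrite -uE -vE !subsetIr.
rewrite !inE => /andP[/andP[uA _] /andP[vB _]].
rewrite -bigU /=; first by apply: eq_bigl => i; rewrite !inE.
exact: (disjointW uA vB dAB).
Qed.

Lemma lam_partition A m T : (forall e, e \in T -> #|e :&: A| <= m)%N ->
  lam T = \sum_(a < m.+1) lam [set e in T | #|e :&: A| == a].
Proof.
move=> Tm; rewrite /lam (partition_big (fun e : {set C} => inord #|e :&: A| : 'I_m.+1) xpredT)//=.
apply: eq_bigr => a _; apply: eq_bigl => e; rewrite inE; case: (boolP (e \in T)) => //= eT.
by rewrite -val_eqE /= inordK ?ltnS ?Tm.
Qed.

Lemma ffact_le_expn m k : (m ^_ k <= m ^ k)%N.
Proof.
elim: k m => [//|k IH] m; rewrite ffactnS expnS leq_mul//.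
by apply: leq_trans (IH _) _; case: k {IH} => // k; rewrite leq_exp2r // leq_pred.
Qed.

(** A gain of m/(m+1) over [elsym_le] in degree at least 2: it is the second factor of the falling
    factorial that Maclaurin's inequality produces. *)
Lemma elsym_ge2 A m a : #|A| = m.+1 ->
  m.+1%:R * a.+2`!%:R * elsym a.+2 A <= m%:R * wt A ^+ a.+2.
Proof.
move=> Am; have Mpos : 0 < m.+1%:R :> R by rewrite ltr0n.
have c0 : 0 <= wt A / m.+1%:R by rewrite divr_ge0 ?wt_ge0.
have wE : wt A = #|A|%:R * (wt A / m.+1%:R) by rewrite Am mulrC divfK// gt_eqF.
have := elsym_maclaurin a.+2 c0 wE; rewrite Am => h.
have h1 : 0 <= m.+1%:R * a.+2`!%:R :> R by rewrite mulr_ge0.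
apply: le_trans (ler_wpM2l h1 h) _.
rewrite mulrA -mulrA -mulrA (mulrA a.+2`!%:R) -natrM mulnC bin_ffact mulrA -natrM.
have hn : (m.+1 * m.+1 ^_ a.+2 <= m * m.+1 ^ a.+2)%N.
  rewrite !ffactnS /= !expnS; have := ffact_le_expn m.-1 a.
  have : (m.-1 ^ a <= m.+1 ^ a)%N by case: a {h h1} => // a; rewrite leq_exp2r//; lia.
  by move=> h2 h3; have := leq_trans h3 h2; nia.
apply: le_trans (_ : (m * m.+1 ^ a.+2)%:R * (wt A / m.+1%:R) ^+ a.+2 <= _).
  by rewrite ler_wpM2r ?exprn_ge0// ler_nat.
by rewrite natrM natrX -mulrA -exprMn (mulrC m.+1%:R) divfK // gt_eqF.
Qed.

(** Sort the edges by their number of vertices in A. This gives the terms of the binomial expansion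
    of (wt A + wt B)^(n+1) without the one free of A. Terms with at least two vertices in A gain
    m/(m+1) by [elsym_ge2]; the linear term gains nothing, hence the last summand. *)
Lemma hit_bound A B T n m : [disjoint A & B] -> #|A| = m.+1 ->
  (forall e, e \in T -> [/\ e \subset A :|: B, #|e| = n.+1 & e :&: A != set0]) ->
  m.+1%:R * n.+1`!%:R * lam T <=
    m%:R * ((wt A + wt B) ^+ n.+1 - wt B ^+ n.+1) + n.+1%:R * wt A * wt B ^+ n.
Proof.
move=> dAB Am hT; have w0 := wt_ge0 A; have v0 := wt_ge0 B.
rewrite (@lam_partition A n.+1); last first.
  by move=> e /hT[_ en _]; rewrite -en subset_leq_card// subsetIl.
rewrite big_ord_recl /= (_ : [set _ | _] = set0) ?lam0 ?add0r; last first.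
  apply/setP => e; rewrite !inE; apply/negbTE/negP => /andP[/hT[_ _ eA]].
  by rewrite cards_eq0 (negbTE eA).
have t (a : 'I_n.+1) : m.+1%:R * n.+1`!%:R * lam [set e in T | #|e :&: A| == bump 0 a] <=
    m%:R * (wt B ^+ (n - a) * wt A ^+ a.+1 *+ 'C(n.+1, a.+1)) +
    (a == ord0)%:R * (n.+1%:R * wt A * wt B ^+ n).
  rewrite /bump leq0n add1n.
  have an : (a <= n)%N by rewrite -ltnS.
  apply: le_trans (_ : m.+1%:R * n.+1`!%:R * (elsym a.+1 A * elsym (n - a)%N B) <= _).
    rewrite ler_wpM2l ?mulr_ge0// elsymM//; apply: lamS; apply/subsetP => e.
    rewrite !inE => /andP[eT /eqP ea]; have [eAB en _] := hT e eT.
    have : (#|e :&: A| + #|e :&: B| = n.+1)%N.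
      rewrite -en -cardsUI -setIUr -setIIr (_ : A :&: B = set0) ?setI0 ?cards0 ?addn0 ?(setIidPl
        eAB)//.
      by apply/eqP; rewrite setI_eq0.
    by rewrite eAB ea eqxx /= => cE; apply/eqP; lia.
  have Bb := elsym_le (n - a)%N B.
  have Aa0 : 0 <= elsym a.+1 A by apply: lam_ge0.
  have fE : n.+1`!%:R = 'C(n.+1, a.+1)%:R * a.+1`!%:R * (n - a)`!%:R :> R.
    by rewrite -!natrM -mulnA -(subSS a n) bin_fact.
  have rE : m.+1%:R * ('C(n.+1, a.+1)%:R * a.+1`!%:R * (n - a)`!%:R) * (elsym a.+1 A * elsym (n -
    a)%N B) =
    'C(n.+1, a.+1)%:R * (m.+1%:R * a.+1`!%:R * elsym a.+1 A) * ((n - a)`!%:R * elsym (n - a)%N B)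
      by ring.
  rewrite fE rE; apply: le_trans (ler_wpM2l _ Bb) _; first by rewrite !mulr_ge0.
  case: (nat_of_ord a =P 0%N) => a0.
    have -> : (a == ord0) by apply/eqP/val_inj.
    rewrite a0 elsym1 subn0 bin1 factS fact0 muln1 expr1 mulr1 mul1r le_eqVlt; apply/orP; left.
    by apply/eqP; rewrite -(mulr_natr _ n.+1) (mulrS 1 m) (mulrS 1 n) /=; ring.
  have -> : (a == ord0) = false by apply/eqP => aE; apply: a0; rewrite aE.
  have -> : nat_of_ord a = a.-1.+1 by case: (nat_of_ord a) a0.
  rewrite mul0r addr0 -[X in m%:R * X]mulr_natr; have := elsym_ge2 a.-1 Am => h.
  have -> : m%:R * (wt B ^+ (n - a.-1.+1) * wt A ^+ a.-1.+2 * 'C(n.+1, a.-1.+2)%:R) =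
    'C(n.+1, a.-1.+2)%:R * (m%:R * wt A ^+ a.-1.+2) * wt B ^+ (n - a.-1.+1) by ring.
  by rewrite ler_wpM2r ?exprn_ge0// ler_wpM2l.
rewrite big_distrr /=; apply: le_trans (ler_sum _ (fun a _ => t a)) _.
rewrite big_split /= -mulr_sumr; apply: lerD.
  rewrite (addrC (wt A)) exprDn [in leRHS]big_ord_recl /= subn0 mulr1 bin0 mulr1n addrAC subrr
    add0r.
  by rewrite le_eqVlt; apply/orP; left.
rewrite big_ord_recl eqxx mul1r big1 ?addr0// => i _.
by rewrite mul0r.
Qed.
End Weights.

(** * Numerical estimates *)

Lemma expR_lower (R : realType) (K : nat) : (0 < K)%N -> (1 - K%:R^-1) ^+ K <= expR (-1) :> R.
Proof.
move=> K0; have K0' : 0 < K%:R :> R by rewrite ltr0n.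
have -> : -1 = K%:R * (- K%:R^-1) :> R by rewrite mulrN divff ?gt_eqF.
rewrite expRM_natl lerXn2r ?nnegrE ?expR_ge0 ?expR_ge1Dx//.
by rewrite subr_ge0 invf_le1 // ler1n.
Qed.

Lemma sqr_le (R : realFieldType) (a b : R) : 0 <= a -> a <= b -> a ^+ 2 <= b ^+ 2.
Proof. by move=> a0 ab; rewrite lerXn2r ?nnegrE // (le_trans a0). Qed.

(** 1/e is at least (31/32)^32, evaluated by five squarings, each rounded down to four decimals. *)
Lemma expRN1_ge (R : realType) : 36 / 100 <= expR (-1) :> R.
Proof.
apply: le_trans (expR_lower R (isT : (0 < 32)%N)).
have -> : (1 - 32%:R^-1) ^+ 32 = ((((((1 - 32%:R^-1) ^+ 2) ^+ 2) ^+ 2) ^+ 2) ^+ 2) :> R by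
  rewrite -!exprM.
apply: le_trans (_ : (6009 / 10000) ^+ 2 <= _); first by lra.
apply: sqr_le; first by lra.
apply: le_trans (_ : (7752 / 10000) ^+ 2 <= _); first by lra.
apply: sqr_le; first by lra.
apply: le_trans (_ : (8805 / 10000) ^+ 2 <= _); first by lra.
apply: sqr_le; first by lra.
apply: le_trans (_ : (9384 / 10000) ^+ 2 <= _); first by lra.
apply: sqr_le; first by lra.
lra.
Qed.

Lemma star_density_gt (R : realType) r : (2 <= r)%N -> expR (-1) < (1 - r%:R^-1) ^+ r.-1 :> R.
Proof.
case: r => [|[|k]]// _; rewrite /=.
have k0 : 0 < k.+1%:R :> R by rewrite ltr0n.
have -> : 1 - k.+2%:R^-1 = (1 + k.+1%:R^-1)^-1 :> R.
  rewrite (mulrS 1 k.+1); move: k0; move: (k.+1%:R) => a a0; field.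
  by rewrite !gt_eqF //; lra.
rewrite exprVn expRN ltf_pV2 ?posrE ?exprn_gt0 ?expR_gt0 ?addr_gt0 ?invr_gt0//.
have -> : expR 1 = expR (k.+1%:R^-1) ^+ k.+1 :> R by rewrite -expRM_natl divff ?gt_eqF.
rewrite ltrXn2r ?nnegrE ?expR_ge0 ?addr_ge0 ?invr_ge0//.
by rewrite expR_gt1Dx // invr_eq0 gt_eqF.
Qed.

(** The left-hand side is the third-order truncation of the right. Together with 1 - i/6 <= e^(-i/6)
    it supplies the lower bound on e^(-i) used in [star_link_bound]. *)
Lemma pow6_lower (R : realFieldType) (i : R) : 0 <= i -> i <= 1 / 4 ->
  1 - i + (5 / 12 * i ^+ 2 - 5 / 54 * i ^+ 3) <= (1 - i / 6) ^+ 6.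
Proof.
move=> i0 i4; have -> : 1 - i + (5 / 12 * i ^+ 2 - 5 / 54 * i ^+ 3) =
    1 - 6 * (i / 6) + (15 * (i / 6) ^+ 2 - 20 * (i / 6) ^+ 3) by field.
have : 0 <= i / 6 <= 1 by lra.
move: (i / 6) => u /andP[u0 u1]; rewrite -subr_ge0.
have -> : (1 - u) ^+ 6 - (1 - 6 * u + (15 * u ^+ 2 - 20 * u ^+ 3)) =
     u ^+ 4 * (15 - 6 * u + u ^+ 2) by ring.
rewrite mulr_ge0 ?exprn_ge0//; have := sqr_ge0 u; lra.
Qed.

Lemma link_bound_aux (R : realFieldType) (a : R) : 4 <= a ->
  1 - 8 / 10 / (1 + a) <= 1 - a^-1 + a * (5 / 12 * (a^-1) ^+ 2 - 5 / 54 * (a^-1) ^+ 3).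
Proof.
move=> a4; rewrite -subr_ge0.
have -> : 1 - a^-1 + a * (5 / 12 * (a^-1) ^+ 2 - 5 / 54 * (a^-1) ^+ 3) - (1 - 8 / 10 / (1 + a)) =
   (8 / 10 * a ^+ 2 - (7 / 12 * a + 5 / 54) * (1 + a)) / (a ^+ 2 * (1 + a)).
  by field; rewrite !gt_eqF //; lra.
apply: divr_ge0; first nra.
by apply: mulr_ge0; [exact: sqr_ge0|lra].
Qed.

(** For j >= 4, 1/e is the j-th power of e^(-1/j), which is at least 1 - 1/j + d with d of order
    1/j^2. The tangent bound at 1 - 1/j leaves (1 - 1/j)^(j-1) times 1 - 1/j + j d, and
    [link_bound_aux] compares the last factor. For j = 3 the product is 16/45 < 36/100. *)
Lemma star_link_bound (R : realType) j : (3 <= j)%N ->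
  (1 - j%:R^-1) ^+ j.-1 * (1 - 8 / 10 / j.+1%:R) <= expR (-1) :> R.
Proof.
case: j => [|[|[|[|j]]]]// _; rewrite [_.-1]/=.
  by apply: le_trans (expRN1_ge R); rewrite -subr_ge0; lra.
have := @link_bound_aux R j.+4%:R; rewrite ler_nat => /(_ isT).
have a0 : 0 < j.+4%:R :> R by rewrite ltr0n.
have i4 : j.+4%:R^-1 <= 1 / 4 :> R by rewrite div1r lef_pV2 ?posrE ?ler_nat.
have Epow : expR (-1) = expR (- (j.+4%:R)^-1) ^+ j.+4 :> R.
  by rewrite -expRM_natl mulrN divff ?gt_eqF.
have low : (1 - j.+4%:R^-1 / 6) ^+ 6 <= expR (- (j.+4%:R)^-1) :> R.
  have -> : - (j.+4%:R)^-1 = 6%:R * - (j.+4%:R^-1 / 6) :> R.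
    by rewrite mulrN [6 * _]mulrC divfK // pnatr_eq0.
  rewrite expRM_natl lerXn2r ?nnegrE ?expR_ge0 ?expR_ge1Dx//.
  by move: i4; move: (j.+4%:R^-1) => i i4; lra.
rewrite Epow (mulrS 1 j.+4).
move: a0 i4 low; move Ea : (j.+4%:R) => a; move: (expR (- a^-1)) (expR_ge0 (- a^-1)) => e e0 a0
  i4 low h.
have i0 : 0 < a^-1 by rewrite invr_gt0.
have low2 := le_trans (pow6_lower (ltW i0) i4) low.
have D0 : 0 <= 1 - a^-1 by lra.
have d0 : 0 <= 5 / 12 * (a^-1) ^+ 2 - 5 / 54 * (a^-1) ^+ 3.
  have -> : 5 / 12 * (a^-1) ^+ 2 - 5 / 54 * (a^-1) ^+ 3 = (a^-1) ^+ 2 * (5 / 12 - 5 / 54 * a^-1)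
    by ring.
  by rewrite mulr_ge0 ?sqr_ge0//; lra.
apply: le_trans (_ : (1 - a^-1 + (5 / 12 * (a^-1) ^+ 2 - 5 / 54 * (a^-1) ^+ 3)) ^+ j.+4 <= _);
  last first.
  by rewrite lerXn2r ?nnegrE ?(addr_ge0 D0 d0).
have := bernoulli j.+3 D0 (addr_ge0 D0 d0); apply: le_trans.
rewrite [_ ^+ j.+4]exprS Ea.
apply: le_trans (ler_wpM2l (exprn_ge0 j.+3 D0) h) _.
by rewrite le_eqVlt; apply/orP; left; apply/eqP; ring.
Qed.

(** Each factor 1 - i/k of the falling factorial is at most e^(-i/k). *)
Lemma ffact_le_exp (R : realType) k n : (0 < k)%N ->
  (k ^_ n)%:R <= k%:R ^+ n * expR (- ('C(n, 2)%:R / k%:R)) :> R.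
Proof.
move=> k0; have k0' : 0 < k%:R :> R by rewrite ltr0n.
elim: n => [|n IH]; first by rewrite mul0r oppr0 expR0 ffactn0 mulr1.
have [nk|nk] := leqP k n; first by rewrite ffact_small ?mulr_ge0 ?exprn_ge0 ?expR_ge0.
rewrite ffactnSr natrM binS bin1 natrD mulrDl opprD expRD exprSr natrB 1?ltnW//.
have -> : k%:R ^+ n * k%:R * (expR (- ('C(n, 2)%:R / k%:R)) * expR (- (n%:R / k%:R))) =
  (k%:R ^+ n * expR (- ('C(n, 2)%:R / k%:R))) * (k%:R * expR (- (n%:R / k%:R))) :> R by ring.
apply: ler_pM => //; first by rewrite subr_ge0 ler_nat ltnW.
have := expR_ge1Dx (- (n%:R / k%:R) : R); move/(ler_wpM2l (ltW k0')); apply: le_trans.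
by rewrite mulrDr mulr1 mulrN mulrC divfK// gt_eqF.
Qed.

(** Base of the induction on colours: the supports of size at most 2r - 1 are those to which
    [link_intersecting] does not apply. *)
Lemma elsym_small_support (R : realType) (C : finType) (x : C -> R) (A : {set C}) r :
  (forall i, 0 <= x i) -> (4 <= r)%N -> (#|A| <= (2 * r).-1)%N ->
  r`!%:R * elsym x r A <= expR (-1) * wt x A ^+ r.
Proof.
move=> x0 r4 Ar; have w0 := wt_ge0 x0 A.
have [A0|A0] := posnP #|A|.
  rewrite (cards0_eq A0); case: r r4 {Ar} => // r _.
  by rewrite elsym_set0 mulr0 mulr_ge0 ?expR_ge0 ?exprn_ge0 ?wt_ge0.
have A0' : 0 < #|A|%:R :> R by rewrite ltr0n.
have wE : wt x A = #|A|%:R * (wt x A / #|A|%:R) by rewrite mulrC divfK// gt_eqF.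
have a0 : 0 <= wt x A / #|A|%:R by rewrite divr_ge0 // ltW.
have := elsym_maclaurin x0 r a0 wE => /(ler_wpM2l (ler0n R r`!)) h; apply: le_trans h _.
rewrite mulrA -natrM mulnC bin_ffact expr_div_n mulrCA [leRHS]mulrC ler_wpM2l ?exprn_ge0//.
rewrite ler_pdivrMr ?exprn_gt0//.
(* For r >= 5 the exponent suffices because binomial(r, 2) >= 2r - 1. For r = 4 this fails, as 6 <
   7, so the supports of size at most 7 are checked one by one. *)
have [r5|r5] := leqP 5 r; last first.
  have rE : r = 4%N by apply/eqP; rewrite eqn_leq r4 -ltnS r5.
  rewrite rE in Ar *; apply: le_trans (ler_wpM2r (exprn_ge0 4 (ltW A0')) (expRN1_ge R)).
  rewrite -natrX; move: Ar {A0 A0' wE a0 w0}; move: #|A| => k Ar.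
  rewrite mulrAC ler_pdivlMr ?ltr0n// -!natrM ler_nat.
  by move: k Ar; do 8?case=> //.
apply: le_trans (ffact_le_exp R r A0) _; rewrite mulrC ler_wpM2r ?exprn_ge0//.
rewrite ler_expR lerN2 ler_pdivlMr// mul1r ler_nat.
have : (2 * 'C(r, 2) = r * r.-1)%N by rewrite bin2 mul2n -[RHS]odd_double_half oddM;
  case: (r) => //= n; rewrite andNb.
by move: Ar; nia.
Qed.

(** * Quartic inequalities for the 4-uniform case *)

Section S.
Variable R : realFieldType.
Implicit Types s y a b c d : R.
(** In [star_case], s is the weight of the four-set and y the weight outside; the coefficients are
    24 times the constants 15/100, 1/16 and 1/256 obtained there. The proof is a sum-of-squares
    certificate. *)
Lemma star_quartic s y : 0 <= s -> 0 <= y ->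
 (36/10) * s^+2*y^+2 + (3/2)*s^+3*y + (24/256)*s^+4 <= (36/100)*(s+y)^+4.
Proof.
move=> s0 y0.
have sy : 0 <= s * y by rewrite mulr_ge0.
rewrite -subr_ge0 [leRHS](_ : _ = (6 / 10 * y ^+ 2 + 6 / 10 * s * y - s ^+ 2 / 2) ^+ 2 +
  s * y * (72 / 100 * (y - 5 / 6 * s) ^+ 2 + s ^+ 2 / 25) + 13 / 800 * (s ^+ 2) ^+ 2);
    last by field.
have h1 := sqr_ge0 (y - 5 / 6 * s); have h2 := sqr_ge0 s; have h3 := sqr_ge0 (s ^+ 2).
have h4 := sqr_ge0 (6 / 10 * y ^+ 2 + 6 / 10 * s * y - s ^+ 2 / 2).
have h5 : 0 <= s * y * (72 / 100 * (y - 5 / 6 * s) ^+ 2 + s ^+ 2 / 25) by rewrite mulr_ge0 //; lra.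
lra.
Qed.

(** In [triangle_case] this is applied to s = b + c + d and to a plus the outside weight. The
    coefficients are 24 times 1/6, 1/27 and 4/162. *)
Lemma triangle_quartic s y : 0 <= s -> 0 <= y ->
 4 * s^+2*y^+2 + (8/9)*s^+3*y + (16/27)*s*y^+3 <= (36/100)*(s+y)^+4.
Proof.
move=> s0 y0.
have sy : 0 <= s * y by rewrite mulr_ge0.
rewrite -subr_ge0 [leRHS](_ : _ = (6 / 10 * y ^+ 2 + s * y / 10 - 6 / 10 * s ^+ 2) ^+ 2 +
  s * y * ((572 / 675 - 12 / 100) * y ^+ 2 - (113 / 100) * s * y + (124 / 225 + 12 / 100) * s ^+
    2)); last by field.
apply: addr_ge0; rewrite ?sqr_ge0 // mulr_ge0 //.
have h1 := sqr_ge0 (y - 8 / 10 * s); have h2 := sqr_ge0 s; have h3 := sqr_ge0 y; nra.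
Qed.

(** A linear function on the polygon of admissible (l, l'): when al' <= al, its maximum is at the
    corner (y/2, y/6). *)
Lemma pair_bound al al' l l' y : 0 <= al -> 0 <= al' -> 0 <= y -> 0 <= l -> 0 <= l' ->
  l <= y / 2 -> l' <= y / 2 -> l + l' <= 2 / 3 * y -> al' <= al ->
  al * l + al' * l' <= (al / 2 + al' / 6) * y.
Proof. move=> *. nra. Qed.

Lemma sum3_le a b c d : 0 <= a -> 0 <= b -> 0 <= c -> 0 <= d ->
  a*b*c + a*b*d + a*c*d + b*c*d <= (a+b+c+d)^+3 / 16.
Proof.
move=> a0 b0 c0 d0.
have h1 : 0 <= (a-b)^+2*(c+d) by rewrite mulr_ge0 ?sqr_ge0 ?addr_ge0.
have h2 : 0 <= (c-d)^+2*(a+b) by rewrite mulr_ge0 ?sqr_ge0 ?addr_ge0.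
have h3 : 0 <= (a+b-c-d)^+2*(a+b+c+d) by rewrite mulr_ge0 ?sqr_ge0 ?addr_ge0.
nra. Qed.

Lemma star_case a b c d y : 0 <= a -> 0 <= b -> 0 <= c -> 0 <= d -> 0 <= y ->
  24 * (a*b*c*d + (a*b*c + a*b*d + a*c*d + b*c*d) * y +
    (a * (b + c + d) / 2 + (b*c + b*d + c*d) / 6) * y ^+ 2) <=
  36 / 100 * (a + b + c + d + y) ^+ 4.
Proof.
move=> a0 b0 c0 d0 y0; have s0 : 0 <= a + b + c + d by rewrite !addr_ge0.
apply: le_trans (star_quartic s0 y0).
have e3 := sum3_le a0 b0 c0 d0.
have e4 : a*b*c*d <= (a+b+c+d)^+4 / 256.
  have h1 : a * b <= (a + b) ^+ 2 / 4 by have := sqr_ge0 (a - b); lra.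
  have h2 : c * d <= (c + d) ^+ 2 / 4 by have := sqr_ge0 (c - d); lra.
  have h3 : (a + b) * (c + d) <= (a + b + c + d) ^+ 2 / 4 by have := sqr_ge0 (a + b - c - d); lra.
  have h4 : (a * b) * (c * d) <= (a + b) ^+ 2 / 4 * ((c + d) ^+ 2 / 4) by apply: ler_pM => //;
    rewrite mulr_ge0.
  have h5 : ((a + b) * (c + d)) ^+ 2 <= ((a + b + c + d) ^+ 2 / 4) ^+ 2.
    by rewrite lerXn2r ?nnegrE ?divr_ge0 ?sqr_ge0// mulr_ge0 ?addr_ge0.
  by move: h4 h5; rewrite !mulrA; lra.
have G : a * (b + c + d) / 2 + (b*c + b*d + c*d) / 6 <= 15 / 100 * (a+b+c+d)^+2.
  have := sqr_ge0 (b - c); have := sqr_ge0 (b - d); have := sqr_ge0 (c - d).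
  have := sqr_ge0 (a - 7 / 10 * (b + c + d)); nra.
have h1 := ler_wpM2r y0 e3; have h2 := ler_wpM2r (sqr_ge0 y) G.
move: h1 h2 e4; move: (_ * y) (_ * y ^+ 2) => *; lra.
Qed.

Lemma triangle_case a b c d y : 0 <= a -> 0 <= b -> 0 <= c -> 0 <= d -> 0 <= y ->
  24 * (a*b*c*d + (a*b*c + a*b*d + a*c*d + b*c*d) * y +
    ((b*c + b*d + c*d) / 2 + a * (b + c + d) / 6) * y ^+ 2) <=
  36 / 100 * (a + b + c + d + y) ^+ 4.
Proof.
move=> a0 b0 c0 d0 y0; have s0 : 0 <= b + c + d by rewrite !addr_ge0.
have Y0 : 0 <= a + y by rewrite addr_ge0.
have := triangle_quartic s0 Y0; rewrite (_ : b + c + d + (a + y) = a + b + c + d + y); last by ring.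
apply: le_trans; set Y := a + y; set t := b + c + d.
have e2 : b*c + b*d + c*d <= t ^+ 2 / 3.
  by rewrite /t; have := sqr_ge0 (b - c); have := sqr_ge0 (b - d); have := sqr_ge0 (c - d); nra.
have e3 : b*c*d <= t ^+ 3 / 27.
  have h1 : 0 <= (b - c) ^+ 2 * (b + c + 7 * d) by rewrite mulr_ge0 ?sqr_ge0 ?addr_ge0 ?mulr_ge0.
  have h2 : 0 <= (b - d) ^+ 2 * (b + d + 7 * c) by rewrite mulr_ge0 ?sqr_ge0 ?addr_ge0 ?mulr_ge0.
  have h3 : 0 <= (c - d) ^+ 2 * (c + d + 7 * b) by rewrite mulr_ge0 ?sqr_ge0 ?addr_ge0 ?mulr_ge0.
  by rewrite /t; lra.
have ay : a * y ^+ 2 <= 4 / 27 * Y ^+ 3.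
  have h1 : 0 <= (2 * a - y) ^+ 2 * (a + 4 * y) by rewrite mulr_ge0 ?sqr_ge0 ?addr_ge0 ?mulr_ge0.
  by rewrite /Y; lra.
have h1 := ler_wpM2r (sqr_ge0 Y) e2.
have h2 := ler_wpM2r Y0 e3; rewrite -/Y in h2.
have h3 := ler_wpM2l s0 ay; rewrite -/t in h3.
have h4 : 0 <= (b*c + b*d + c*d) * a ^+ 2 by rewrite !mulr_ge0 ?sqr_ge0 ?addr_ge0 ?mulr_ge0.
have -> : a*b*c*d + (a*b*c + a*b*d + a*c*d + b*c*d) * y +
    ((b*c + b*d + c*d) / 2 + a * t / 6) * y ^+ 2 =
  (b*c + b*d + c*d) * Y ^+ 2 / 2 - (b*c + b*d + c*d) * a ^+ 2 / 2 + b*c*d * Y + t * (a * y ^+ 2)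
    / 6.
  by rewrite /Y /t; field.
move: h1 h2 h3 h4; rewrite (_ : t * (4 / 27 * Y ^+ 3) = 4 / 27 * (t * Y ^+ 3)); last by ring.
rewrite (_ : t ^+ 2 / 3 * Y ^+ 2 = t ^+ 2 * Y ^+ 2 / 3); last by ring.
rewrite (_ : t ^+ 3 / 27 * Y = t ^+ 3 * Y / 27); last by ring.
rewrite (_ : 4 * t ^+ 2 * Y ^+ 2 = 4 * (t ^+ 2 * Y ^+ 2)); last by ring.
rewrite (_ : 8 / 9 * t ^+ 3 * Y = 8 / 9 * (t ^+ 3 * Y)); last by ring.
rewrite (_ : 16 / 27 * t * Y ^+ 3 = 16 / 27 * (t * Y ^+ 3)); last by ring.
lra.
Qed.

(** In each of the three splittings of {a, b, c, d} into two pairs, [pair_bound] gives coefficient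
    1/2 to the heavier pair and 1/6 to the other. One pair from each splitting makes either a star
    through a common point or a triangle, four of each kind: hence eight cases and two
    inequalities. *)
Lemma cover4_real a b c d y (ab cd ac bd ad bc : R) :
  0 <= a -> 0 <= b -> 0 <= c -> 0 <= d -> 0 <= y ->
  [/\ 0 <= ab, 0 <= cd, ab <= y ^+ 2 / 2, cd <= y ^+ 2 / 2 & ab + cd <= 2 / 3 * y ^+ 2] ->
  [/\ 0 <= ac, 0 <= bd, ac <= y ^+ 2 / 2, bd <= y ^+ 2 / 2 & ac + bd <= 2 / 3 * y ^+ 2] ->
  [/\ 0 <= ad, 0 <= bc, ad <= y ^+ 2 / 2, bc <= y ^+ 2 / 2 & ad + bc <= 2 / 3 * y ^+ 2] ->
  24 * (a*b*c*d + (a*b*c + a*b*d + a*c*d + b*c*d) * y +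
    (a*b*ab + c*d*cd + a*c*ac + b*d*bd + a*d*ad + b*c*bc)) <=
  36 / 100 * (a + b + c + d + y) ^+ 4.
Proof.
move=> a0 b0 c0 d0 y0.
have pb p q l m : 0 <= p -> 0 <= q ->
    [/\ 0 <= l, 0 <= m, l <= y ^+ 2 / 2, m <= y ^+ 2 / 2 & l + m <= 2 / 3 * y ^+ 2] ->
    p * l + q * m <= (p / 2 + q / 6) * y ^+ 2 \/ p * l + q * m <= (q / 2 + p / 6) * y ^+ 2.
  move=> p0 q0 [l0 m0 lh mh lm]; have [pq|/ltW pq] := leP q p; [left|right].
    by apply: pair_bound; rewrite ?sqr_ge0.
  by rewrite addrC; apply: pair_bound; rewrite ?sqr_ge0 // addrC.
have star := star_case; have tri := triangle_case.
move=> /(pb (a*b) (c*d)) []; rewrite ?mulr_ge0// => h1;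
move=> /(pb (a*c) (b*d)) []; rewrite ?mulr_ge0// => h2;
move=> /(pb (a*d) (b*c)) []; rewrite ?mulr_ge0// => h3.
- have := star a b c d y a0 b0 c0 d0 y0; lra.
- have := tri d a b c y d0 a0 b0 c0 y0; lra.
- have := tri c a b d y c0 a0 b0 d0 y0; lra.
- have := star b a c d y b0 a0 c0 d0 y0; lra.
- have := tri b a c d y b0 a0 c0 d0 y0; lra.
- have := star c a b d y c0 a0 b0 d0 y0; lra.
- have := star d a b c y d0 a0 b0 c0 y0; lra.
- have := tri a b c d y a0 b0 c0 d0 y0; lra.
Qed.
End S.

(** * Shifted intersecting families *)

Definition intersecting (C : finType) (T : {set {set C}}) : Prop :=
  forall e f, e \in T -> f \in T -> e :&: f != set0.

Lemma is_uniform_link (C : finType) r (T : {set {set C}}) (m : C) :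
  is_uniform r T -> is_uniform r.-1 (link m T).
Proof. by move=> Tr f; rewrite inE => /andP[mf /Tr]; rewrite cardsU1 mf => <-. Qed.

Lemma ex_notin (C : finType) (A B : {set C}) : (#|B| < #|A|)%N ->
  exists2 l, l \in A & l \notin B.
Proof.
move=> h; have /subsetPn[l lA lB] : ~~ (A \subset B).
  by apply: contraL h => /subset_leq_card; rewrite -leqNgt.
by exists l.
Qed.

Section GraphPair.
Variables (R : realFieldType) (C : finType) (x : C -> R).
Hypothesis x0 : forall i, 0 <= x i.

(** If G and G' share no edge, their union is a single graph, of weight at most half the square. If
    they share an edge p, every edge of both meets p, and [hit_bound] at p gives at most a third of
    the square for each. *)
Lemma cross_pairs (Y : {set C}) (G G' : {set {set C}}) :
  (forall e, e \in G -> e \subset Y /\ #|e| = 2%N) ->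
  (forall e, e \in G' -> e \subset Y /\ #|e| = 2%N) ->
  (forall e f, e \in G -> f \in G' -> e :&: f != set0) ->
  [/\ 0 <= lam x G, 0 <= lam x G', lam x G <= wt x Y ^+ 2 / 2, lam x G' <= wt x Y ^+ 2 / 2 &
   lam x G + lam x G' <= 2 / 3 * wt x Y ^+ 2].
Proof.
move=> GY GY' cr.
have half (F : {set {set C}}) : (forall e, e \in F -> e \subset Y /\ #|e| = 2%N) ->
  lam x F <= wt x Y ^+ 2 / 2.
  move=> /(lam_le_esym x0) h; have := elsym_le x0 2 Y; rewrite !factS fact0; lra.
split; rewrite ?lam_ge0 ?half//.
have [E|[p]] := set_0Vmem (G :&: G').
  have : lam x G + lam x G' = lam x (G :|: G').
    rewrite /lam -bigU /=; first by apply: eq_bigl => e; rewrite !inE.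
    by rewrite -setI_eq0 E.
  have s := sqr_ge0 (wt x Y); move=> E'; suff : lam x (G :|: G') <= wt x Y ^+ 2 / 2 by lra.
  by apply: half => e; rewrite inE => /orP[/GY|/GY'].
rewrite inE => /andP[pG pG']; have [pY p2] := GY p pG.
have third (F : {set {set C}}) : (forall e, e \in F -> e \subset Y /\ #|e| = 2%N) ->
    (forall e, e \in F -> e :&: p != set0) -> lam x F <= wt x Y ^+ 2 / 3.
  move=> FY Fp; have dpY : [disjoint p & Y :\: p].
    by rewrite disjoint_sym -setI_eq0 setDE -setIA (setIC (~: p)) setICr setI0.
  have YE : p :|: (Y :\: p) = Y by rewrite -{1}(setIidPr pY) setID.
  have := @hit_bound R C x x0 p (Y :\: p) F 1 1 dpY p2.
  rewrite YE => h; have {}h := h (fun e eF => And3 (proj1 (FY e eF)) (proj2 (FY e eF)) (Fp e eF)).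
  have wE : wt x Y = wt x p + wt x (Y :\: p).
    rewrite -{1}YE /wt -bigU //=; by apply: eq_bigl => e; rewrite inE.
  move: h; rewrite wE !factS fact0 expr1.
  move: (wt x p) (wt x (Y :\: p)) => w v; have := sqr_ge0 (w - 2 * v); lra.
have h1 := third G GY (fun e eG => cr e p eG pG').
suff : lam x G' <= wt x Y ^+ 2 / 3 by lra.
by apply: third => // e eG; rewrite setIC cr.
Qed.
End GraphPair.

(** * Splitting a shifted family at its last colour *)

Section Chain.
Variables (R : realType) (N : nat) (x : 'I_N -> R).
Hypothesis x0 : forall i, 0 <= x i.
Implicit Types (T : {set {set 'I_N}}) (e f g X : {set 'I_N}) (i j l m z : 'I_N).

Definition seg (k : nat) : {set 'I_N} := [set i : 'I_N | (i < k)%N].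

Definition shifted T : Prop := forall e i j,
  e \in T -> (i < j)%N -> j \in e -> i \notin e -> i |: (e :\ j) \in T.

Lemma card_seg k : (k <= N)%N -> #|seg k| = k.
Proof.
move=> kN; rewrite -sum1_card (eq_bigl (fun i : 'I_N => (i < k)%N)); last by move=> i; rewrite inE.
by rewrite -(big_ord_widen _ (fun=> 1%N)) // sum1_card card_ord.
Qed.

Lemma segS k m : val m = k -> seg k.+1 = m |: seg k.
Proof. by move=> mk; apply/setP => i; rewrite !inE -val_eqE /= mk ltnS leq_eqVlt. Qed.

Lemma wt_segS k m : val m = k -> wt x (seg k.+1) = x m + wt x (seg k).
Proof. by move=> mk; rewrite (segS mk) wtU1 // inE mk ltnn. Qed.

Lemma card_swap e i j : j \in e -> i \notin e -> #|i |: (e :\ j)| = #|e|.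
Proof. by move=> je ie; rewrite cardsU1 (cardsD1 j e) je !inE (negbTE ie) andbF. Qed.

Section Step.
Variables (k : nat) (m : 'I_N) (r : nat) (T : {set {set 'I_N}}).
Hypotheses (mk : val m = k) (Tk : forall e, e \in T -> e \subset seg k.+1).
Hypotheses (Tr : is_uniform r.+1 T) (Ti : intersecting T) (Ts : shifted T).

Let T0 := [set e in T | m \notin e].

Lemma T0_seg e : e \in T0 -> e \subset seg k.
Proof.
rewrite inE => /andP[eT me]; have := Tk eT; rewrite (segS mk).
by rewrite -[in X in _ -> X](@setU1K _ m (seg k)) ?inE ?mk ?ltnn// subsetD1 me andbT.
Qed.

Lemma T0_shifted : shifted T0.
Proof.
move=> e i j eT ij je ie; have eS := T0_seg eT.
have jk : (j < k)%N by move/subsetP: eS => /(_ j je); rewrite inE.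
move: eT; rewrite !inE => /andP[eT me]; rewrite Ts//= negb_or negb_and me orbT andbT.
by apply/eqP => mi; move: (ltn_trans ij jk); rewrite -mi mk ltnn.
Qed.

Lemma link_seg f : f \in link m T -> f \subset seg k.
Proof.
rewrite inE => /andP[mf mfT]; have := Tk mfT; rewrite subUset (segS mk) => /andP[_].
by rewrite -[in X in _ -> X](@setU1K _ m (seg k)) ?inE ?mk ?ltnn// subsetD1 mf andbT.
Qed.

Lemma link_shifted : shifted (link m T).
Proof.
move=> f i j fL ij jf ie; have fS := link_seg fL.
have jk : (j < k)%N by move/subsetP: fS => /(_ j jf); rewrite inE.
have mi : (m == i) = false by apply/eqP => mi; move: (ltn_trans ij jk); rewrite -mi mk ltnn.
have mj : (m == j) = false by apply/eqP => mj; move: jk; rewrite -mj mk ltnn.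
move: fL; rewrite !inE => /andP[mf mfT]; rewrite mi (negbTE mf) andbF /=.
have := Ts mfT ij; rewrite !inE jf orbT (negbTE ie) eq_sym mi => /(_ isT isT).
congr (_ \in T); apply/setP => l; rewrite !inE.
by case: (eqVneq l m) => [->|_] /=; rewrite ?mj ?orbT.
Qed.

(** Two disjoint members f, g of the link leave room for a colour l < m outside both, since 2r < k.
    Shifting m to l turns m |: f into an edge disjoint from m |: g. *)
Lemma link_intersecting : (2 * r < k)%N -> (k <= N)%N -> intersecting (link m T).
Proof.
move=> rk kN f g fL gL; apply/negP => /eqP fg0.
have fS := link_seg fL; have gS := link_seg gL.
have [l] : exists2 l, l \in seg k & l \notin f :|: g.
  apply: ex_notin; rewrite (card_seg kN); apply: leq_ltn_trans rk.
  have fr : #|f| = r := is_uniform_link Tr fL; have gr : #|g| = r := is_uniform_link Tr gL.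
  by rewrite mul2n -addnn -{1}fr -gr cardsU leq_subr.
rewrite !inE negb_or => lk /andP[lf lg].
move: fL gL; rewrite !inE => /andP[mf fT] /andP[mg gT].
have lm : (l < m)%N by rewrite mk.
have nlm : l == m = false by apply/eqP => E; rewrite E ltnn in lm.
have := Ts fT lm; rewrite !inE eqxx nlm (negbTE lf) => /(_ isT isT).
rewrite setU1K// => lfT; have := Ti lfT gT => /set0Pn[i].
rewrite !inE => /andP[/orP[/eqP->|iF] /orP[/eqP E|iG]].
- by rewrite E eqxx in nlm.
- by rewrite iG in lg.
- by rewrite -E iF in mf.
by have : i \in f :&: g; [rewrite inE iF iG|rewrite fg0 inE].
Qed.

(** An edge that shows T is not a star at 0 can be chosen without m: if it contains m, shift m to a
    free colour other than 0. *)
Lemma T0_avoid0 : (r.+1 < k)%N -> (k < N)%N ->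
  (exists2 e, e \in T & forall i, i \in e -> (0 < i)%N) ->
  exists2 e, e \in T0 & forall i, i \in e -> (0 < i)%N.
Proof.
move=> rk kN [e eT e0]; have [me|me] := boolP (m \in e); last by exists e; rewrite // inE eT.
have z0 : (0 < N)%N by apply: leq_ltn_trans kN.
have [l] : exists2 l, l \in seg k :\ (Ordinal z0) & l \notin e :\ m.
  apply: ex_notin; have := cardsD1 m e; rewrite (Tr eT) me add1n => -[eE];
    have := cardsD1 (Ordinal z0) (seg k).
  have k0 : (0 < k)%N by apply: leq_ltn_trans rk.
  by rewrite (card_seg (ltnW kN)) inE /= k0 add1n -eE => kE; move: rk; rewrite {1}kE ltnS.
rewrite !inE -val_eqE /= => /andP[l0 lk]; rewrite negb_and negbK => /orP[/eqP lm|le].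
  by rewrite lm mk ltnn in lk.
exists (l |: (e :\ m)).
  rewrite inE Ts ?mk// !inE eqxx orbF.
  by apply/eqP => ml; rewrite -ml me in le.
by move=> i; rewrite !inE => /orP[/eqP->|/andP[_ /e0]//]; rewrite lt0n.
Qed.
End Step.
End Chain.

(** The left-hand side collects the lower-order terms of [hit_bound] when #|A| = n + 2, with the
    weight of A rewritten as the total minus v. The 1/5 is the origin of 8/10 in [star_link_bound]:
    n + 1 + 1/5 = n + 2 - 8/10. *)
Lemma hit_loss (R : realFieldType) (n : nat) (w v : R) : (2 <= n)%N -> 0 <= w -> 0 <= v ->
  n%:R * (w + v) * v ^+ n.-1 - (2 * n + 1)%:R * v ^+ n <= (w + v) ^+ n / 5.
Proof.
move=> n2 w0 v0; have z0 : 0 <= w + v by rewrite addr_ge0.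
case: n n2 => [|[|[|[|n]]]]// _; rewrite [_.-1]/=.
- by rewrite expr1; have := sqr_ge0 (w - 4 * v); lra.
- rewrite -subr_ge0 [leRHS](_ : _ = v * (21 / 5 * v ^+ 2 - 12 / 5 * w * v + 3 / 5 * w ^+ 2) + w
  ^+ 3 / 5); last by field.
  by rewrite addr_ge0 ?divr_ge0 ?exprn_ge0// mulr_ge0//; have := sqr_ge0 (w - 2 * v);
    have := sqr_ge0 v; lra.
have vn : 0 <= v ^+ n.+3 by rewrite exprn_ge0.
have nE : (2 * n.+4 + 1)%:R = 2 * n.+4%:R + 1 :> R by rewrite natrD natrM.
have n4 : 0 <= n.+4%:R :> R by [].
(* Below 2v the left-hand side is at most 0; above it, the tangent at 2v is steep enough. *)
have [zv|zv] := leP (2 * v) (w + v); last first.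
  apply: le_trans (_ : 0 <= _); last by rewrite divr_ge0 ?exprn_ge0.
  rewrite nE [v ^+ n.+4]exprS.
  have -> : n.+4%:R * (w + v) * v ^+ n.+3 - (2 * n.+4%:R + 1) * (v * v ^+ n.+3) =
    - ((n.+4%:R * (2 * v - (w + v)) + v) * v ^+ n.+3) by ring.
  by rewrite oppr_le0 mulr_ge0// addr_ge0// mulr_ge0// subr_ge0 ltW.
have v20 : 0 <= 2 * v by rewrite mulr_ge0.
have := bernoulli n.+3 v20 z0; rewrite !exprMn => h.
rewrite ler_pdivlMr//; apply: le_trans h.
have h8 : 5 <= 2 ^+ n.+3 :> R by rewrite -natrX ler_nat (leq_trans (_ : 5 <= 2 ^ 3)%N)// leq_exp2l.
rewrite nE [v ^+ n.+4]exprS [2 ^+ n.+4]exprS -subr_ge0.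
have -> : 2 * 2 ^+ n.+3 * (v * v ^+ n.+3) + n.+4%:R * (2 ^+ n.+3 * v ^+ n.+3) * (w + v - 2 * v) -
   (n.+4%:R * (w + v) * v ^+ n.+3 - (2 * n.+4%:R + 1) * (v * v ^+ n.+3)) * 5 =
   (n.+4%:R * (2 ^+ n.+3 - 5) * (w + v - 2 * v) + (2 * 2 ^+ n.+3 + 5) * v) * v ^+ n.+3 by ring.
apply: mulr_ge0 => //; apply: addr_ge0; last by apply: mulr_ge0 => //; lra.
by apply: mulr_ge0; [apply: mulr_ge0; rewrite ?subr_ge0|rewrite subr_ge0].
Qed.

(* The left-hand side is the density of the full star whose centre has weight u and whose
   other colours have total weight s. *)
Lemma star_amgm (R : realFieldType) (r : nat) (u s : R) : (0 < r)%N -> 0 <= u -> 0 <= s ->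
  r.+1%:R * u * s ^+ r <= (1 - r.+1%:R^-1) ^+ r * (u + s) ^+ r.+1.
Proof.
move=> r0 u0 s0; have r1 : 0 < r.+1%:R :> R by rewrite ltr0n.
have q0 : 0 < 1 - r.+1%:R^-1 :> R by rewrite subr_gt0 invf_lt1// ltr1n ltnS.
have b0 : 0 <= (1 - r.+1%:R^-1) * (u + s) by apply: mulr_ge0; [exact: ltW|rewrite addr_ge0].
have := bernoulli r s0 b0; rewrite exprMn [_ ^+ r.+1 in leRHS]exprS => h.
rewrite -(ler_pM2l q0) [leRHS]mulrA; apply: le_trans h.
rewrite exprS le_eqVlt; apply/orP; left; apply/eqP.
move: r1; move: (r.+1%:R) => a a0; field; by rewrite gt_eqF.
Qed.

Section Chain.
Variables (R : realType) (N : nat) (x : 'I_N -> R).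
Hypothesis x0 : forall i, 0 <= x i.
Implicit Types (T L : {set {set 'I_N}}) (e f g X : {set 'I_N}) (i j l m z : 'I_N).
Let c : R := expR (-1).

(** The exception where the link L of the last colour is a star at 0. An edge e avoiding 0 is met by
    every member of L, so the link of 0 in L loses the factor 1 - (8/10)/(r+1). [star_amgm] accounts
    for the centre, and [star_link_bound] puts the product below 1/e. *)
Lemma star_link_lam (k r : nat) L z e : (3 <= r)%N -> val z = 0%N -> (0 < k)%N ->
  is_uniform r L -> (forall f, f \in L -> f \subset seg N k) -> (forall f, f \in L -> z \in f) ->
  e \subset seg N k -> #|e| = r.+1 -> z \notin e -> (forall f, f \in L -> f :&: e != set0) ->
  r`!%:R * lam x L <= c * wt x (seg N k) ^+ r.
Proof.
move=> r3 z0 k0 Lr Lk Lz ek er ze Le.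
have zk : z \in seg N k by rewrite inE z0.
rewrite (lam_split x z) (_ : [set _ in L | _] = set0) ?lam0 ?add0r; last first.
  by apply/setP => f; rewrite !inE; apply/negbTE/negP => /andP[/Lz ->].
case: r r3 Lr er => // -[//|n] r3 Lr er.
set O := (seg N k :\ z) :\: e.
have eO : [disjoint e & O] by rewrite disjoint_sym -setI_eq0 /O setDE -setIA (setIC (~: e))
  setICr setI0.
have eOE : e :|: O = seg N k :\ z by rewrite /O -{1}(setIidPr (_ : e \subset seg N k :\ z))
  ?setID// subsetD1 ek.
have hit f : f \in link z L -> [/\ f \subset e :|: O, #|f| = n.+1 & f :&: e != set0].
  rewrite inE => /andP[zf zfL]; split.
  - by rewrite eOE subsetD1 zf andbT (subset_trans _ (Lk _ zfL))// subsetU1.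
  - by have := Lr _ zfL; rewrite cardsU1 zf => -[].
  by have := Le _ zfL; rewrite setIUl (_ : [set z] :&: e = set0) ?set0U//; apply/eqP;
    rewrite setI_eq0 disjoints1.
have := hit_bound x0 eO er hit.
have w0 := wt_ge0 x0 e; have v0 := wt_ge0 x0 O.
have n2 : (2 <= n.+1)%N by rewrite -ltnS.
have := hit_loss n2 w0 v0; rewrite [_.-1]/=.
have sE : wt x (seg N k) = x z + (wt x e + wt x O).
  rewrite -(setD1K zk) wtU1 ?inE ?eqxx// -eOE; congr (_ + _).
  rewrite /wt -bigU //=; by apply: eq_bigl => i; rewrite !inE.
rewrite sE; set w := wt x e in w0 *; set v := wt x O in v0 *.
have zz := x0 z; set l := lam x (link z L); set a := x z in zz *.
have s0 : 0 <= w + v by rewrite addr_ge0.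
move=> h1 h2.
have r0 : 0 < n.+3%:R :> R by rewrite ltr0n.
have h3 : n.+1`!%:R * l <= (1 - 8 / 10 / n.+3%:R) * (w + v) ^+ n.+1.
  have h4 : n.+3%:R * (n.+1`!%:R * l) <= n.+3%:R * ((1 - 8 / 10 / n.+3%:R) * (w + v) ^+ n.+1).
    rewrite mulrA; apply: le_trans h2 _.
    have E (a0 Z : R) : 0 < a0 -> a0 * ((1 - 8 / 10 / a0) * Z) = (a0 - 8 / 10) * Z.
      by move=> a00; field; rewrite gt_eqF.
    rewrite (E _ _ r0); move: h1; rewrite [v ^+ n.+1]exprS.
    have -> : (2 * n.+1 + 1)%:R = 2 * n.+1%:R + 1 :> R by rewrite natrD natrM.
    rewrite -[n.+3]addn2 -[n.+2]addn1 -[n.+1]addn1 !natrD -!addrA.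
    move: (_ ^+ n) ((w + v) ^+ (n + 1)) (n%:R) => V Z nn; lra.
  by rewrite -(ler_pM2l r0).
rewrite factS natrM.
have h5 := star_amgm (isT : (0 < n.+1)%N) zz s0.
have h6 := star_link_bound R r3; rewrite [_.-1]/= -/c in h6.
have q0 : 0 <= 1 - 8 / 10 / n.+3%:R :> R.
  by rewrite subr_ge0 ler_pdivrMr// mul1r (@le_trans _ _ 1) ?ler1n//; lra.
have -> : n.+2%:R * n.+1`!%:R * (a * l) = n.+2%:R * a * (n.+1`!%:R * l) by ring.
apply: le_trans (ler_wpM2l _ h3) _; first by rewrite mulr_ge0.
rewrite mulrCA; apply: le_trans (ler_wpM2l q0 h5) _.
by rewrite mulrA ler_wpM2r ?exprn_ge0 ?addr_ge0// mulrC.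
Qed.
End Chain.

Lemma disjoint_setU1 (C : finType) (q : C) (A B : {set C}) :
  [disjoint q |: A & B] = (q \notin B) && [disjoint A & B].
Proof. by rewrite -setI_eq0 setIUl setU_eq0 !setI_eq0 disjoints1. Qed.

Lemma disjoint_setU1r (C : finType) (q : C) (A B : {set C}) :
  [disjoint A & q |: B] = (q \notin A) && [disjoint A & B].
Proof. by rewrite disjoint_sym disjoint_setU1 disjoint_sym. Qed.

(** * Four-graphs whose edges meet a fixed four-set twice *)

Section Fiber.
Variables (R : realFieldType) (C : finType) (x : C -> R).
Hypothesis x0 : forall i, 0 <= x i.
Implicit Types (T : {set {set C}}) (Q S : {set C}).

(** For S inside Q, this is the link of the trace S: the outside parts of the edges whose trace on Q
    is exactly S. *)
Definition fiber Q S T := [set g : {set C} | [disjoint g & Q] && (S :|: g \in T)].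

Lemma fiber0 T : fiber set0 set0 T = T.
Proof. by apply/setP => g; rewrite inE set0U -setI_eq0 setI0 eqxx. Qed.

Lemma lam_fiber q Q S T : q \notin Q ->
  lam x (fiber Q S T) = lam x (fiber (q |: Q) S T) + x q * lam x (fiber (q |: Q) (q |: S) T).
Proof.
move=> qQ; rewrite (lam_split x q); congr (_ + _ * _); congr (lam x _); apply/setP => g;
  rewrite !inE.
  by rewrite disjoint_setU1r; case: (q \in g); rewrite /= ?andbT ?andbF.
by rewrite disjoint_setU1 disjoint_setU1r qQ setUA (setUC S) andbA.
Qed.

Section Cover4.
Variables (A : {set C}) (T : {set {set C}}) (Q : {set C}).
Hypotheses (QA : Q \subset A) (T4 : is_uniform 4 T) (TA : forall e, e \in T -> e \subset A).
Hypotheses (Ti : intersecting T) (T2 : forall e, e \in T -> (2 <= #|e :&: Q|)%N).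

Lemma fiber_in S g : S \subset Q -> g \in fiber Q S T ->
  [/\ g \subset A :\: Q, (#|S| + #|g| = 4)%N & (2 <= #|S|)%N].
Proof.
move=> SQ; rewrite inE => /andP[gQ gT].
have dSg : [disjoint S & g] by apply: disjointWl SQ _; rewrite disjoint_sym.
split.
- rewrite setDE subsetI -disjoints_subset gQ andbT.
  by apply: subset_trans (TA gT); apply: subsetUr.
- by rewrite -(T4 gT) cardsU (_ : S :&: g = set0) ?cards0 ?subn0//; apply/eqP; rewrite setI_eq0.
have := T2 gT; rewrite setIUl (setIidPl SQ) (_ : g :&: Q = set0) ?setU0//.
by apply/eqP; rewrite setI_eq0.
Qed.

Lemma fiber_small S : S \subset Q -> (#|S| < 2)%N -> lam x (fiber Q S T) = 0.
Proof.
move=> SQ S2; rewrite (_ : fiber Q S T = set0) ?lam0//; apply/setP => g; rewrite [RHS]inE.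
by apply/negbTE/negP => /(fiber_in SQ)[_ _]; rewrite leqNgt S2.
Qed.

Lemma fiber_le S : S \subset Q -> lam x (fiber Q S T) <= elsym x (4 - #|S|)%N (A :\: Q).
Proof.
move=> SQ; apply: lam_le_esym => // g /(fiber_in SQ)[gA <- _]; split=> //.
by rewrite addKn.
Qed.

(** Edges with disjoint traces S and S' can meet only outside Q, so the two fibers are
    cross-intersecting graphs. *)
Lemma fiber_pair S S' : S \subset Q -> S' \subset Q -> #|S| = 2%N -> #|S'| = 2%N ->
  [disjoint S & S'] -> let y := wt x (A :\: Q) in
  [/\ 0 <= lam x (fiber Q S T), 0 <= lam x (fiber Q S' T), lam x (fiber Q S T) <= y ^+ 2 / 2,
      lam x (fiber Q S' T) <= y ^+ 2 / 2 & lam x (fiber Q S T) + lam x (fiber Q S' T) <= 2 / 3 *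
        y ^+ 2].
Proof.
move=> SQ SQ' S2 S2' dS y; apply: cross_pairs => //.
- by move=> g /(fiber_in SQ)[gA]; rewrite S2 => -[? _].
- by move=> g /(fiber_in SQ')[gA]; rewrite S2' => -[? _].
move=> g g'; rewrite !inE => /andP[gQ gT] /andP[gQ' gT'].
have := Ti gT gT'; apply: contra => /eqP E.
rewrite setIUl !setIUr E setU0 (_ : S :&: S' = set0) ?set0U; last by apply/eqP; rewrite setI_eq0.
rewrite setU_eq0 !setI_eq0; apply/andP; split.
  by apply: disjointWl SQ _; rewrite disjoint_sym.
exact: disjointWr SQ' gQ.
Qed.
End Cover4.

Lemma cover4_lam (A : {set C}) T (a b c d : C) : uniq [:: a; b; c; d] ->
  [set a; b; c; d] \subset A -> is_uniform 4 T -> (forall e, e \in T -> e \subset A) ->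
  intersecting T -> (forall e, e \in T -> (2 <= #|e :&: [set a; b; c; d]|)%N) ->
  24 * lam x T <= 36 / 100 * wt x A ^+ 4.
Proof.
set Q0 := [set a; b; c; d]; move=> uq.
set Q := d |: (c |: (b |: (a |: set0))).
have QE : Q0 = Q by apply/setP => i; rewrite !inE orbF -!orbA orbC -!orbA; do !bool_congr.
rewrite QE => QA T4 TA Ti T2.
have := uq; rewrite /= !inE !negb_or => /and4P[/and3P[ab ac ad] /andP[bc bd] cd _].
have qa : a \notin (set0 : {set C}) by rewrite inE.
have qb : b \notin a |: set0 by rewrite !inE orbF eq_sym.
have qc : c \notin b |: (a |: set0) by rewrite !inE orbF negb_or eq_sym bc eq_sym.
have qd : d \notin c |: (b |: (a |: set0)) by rewrite !inE orbF !negb_or eq_sym cd eq_sym bd eq_sym.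
(* Expand over the sixteen traces on the four-set. The empty trace and the four singletons
   contribute nothing, which leaves eleven terms. *)
rewrite -[in X in X <= _](fiber0 T) (lam_fiber _ _ qa) !(lam_fiber _ _ qb) !(lam_fiber _ _ qc)
  !(lam_fiber _ _ qd) -/Q.
have wE : wt x A = x a + x b + x c + x d + wt x (A :\: Q).
  have -> : wt x A = wt x Q + wt x (A :\: Q).
    rewrite -{1}(setID A Q) (setIidPr QA) /wt -bigU /=; first by apply: eq_bigl => i; rewrite !inE.
    by rewrite disjoint_sym -setI_eq0 setDE -setIA (setIC (~: Q)) setICr setI0.
  rewrite /Q !wtU1// /wt big_set0; ring.
have ba : b != a by rewrite eq_sym.
have ca : c != a by rewrite eq_sym.
have da : d != a by rewrite eq_sym.
have cb : c != b by rewrite eq_sym.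
have db : d != b by rewrite eq_sym.
have dc : d != c by rewrite eq_sym.
have ne := (ba, ca, da, cb, db, dc, ab, ac, ad, bc, bd, cd).
have y0 := wt_ge0 x0 (A :\: Q).
have z1 (S : {set C}) : S \subset Q -> (#|S| < 2)%N -> lam x (fiber Q S T) = 0.
  exact: fiber_small T4 TA T2 S.
have z3 (S : {set C}) : S \subset Q -> #|S| = 3%N -> lam x (fiber Q S T) <= wt x (A :\: Q).
  by move=> SQ S3; rewrite -elsym1; have := fiber_le T4 TA T2 SQ; rewrite S3.
have z4 : lam x (fiber Q Q T) <= 1.
  have := fiber_le T4 TA T2 (subxx Q); rewrite (_ : #|Q| = 4%N) ?elsym0//.
  by rewrite /Q !(cardsU1, cards0) !inE !orbF ?negb_or !ne.
have pr (i j k l : C) : i |: (j |: set0) \subset Q -> k |: (l |: set0) \subset Q ->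
  [&& i != j, k != l, i != k, i != l, j != k & j != l] ->
  let y := wt x (A :\: Q) in let S := i |: (j |: set0) in let S' := k |: (l |: set0) in
  [/\ 0 <= lam x (fiber Q S T), 0 <= lam x (fiber Q S' T), lam x (fiber Q S T) <= y ^+ 2 / 2,
      lam x (fiber Q S' T) <= y ^+ 2 / 2 & lam x (fiber Q S T) + lam x (fiber Q S' T) <= 2 / 3 *
        y ^+ 2].
  move=> h1 h2 /and5P[ij kl ik il /andP[jk jl]]; apply: (fiber_pair T4 TA Ti T2 h1 h2).
  - by rewrite !(cardsU1, cards0) !inE !orbF ?negb_or ij.
  - by rewrite !(cardsU1, cards0) !inE !orbF ?negb_or kl.
  by rewrite !disjoint_setU1 !inE !orbF !negb_or ik il jk jl -setI_eq0 set0I eqxx.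
have p1 : _ := pr b a d c; rewrite /Q !(subUset, sub1set, sub0set) !inE !eqxx ?orbT !ne in p1;
  have {}p1 := p1 isT isT isT.
have p2 : _ := pr c a d b; rewrite /Q !(subUset, sub1set, sub0set) !inE !eqxx ?orbT !ne in p2;
  have {}p2 := p2 isT isT isT.
have p3 : _ := pr d a c b; rewrite /Q !(subUset, sub1set, sub0set) !inE !eqxx ?orbT !ne in p3;
  have {}p3 := p3 isT isT isT.
have := cover4_real (x0 a) (x0 b) (x0 c) (x0 d) y0 p1 p2 p3.
rewrite wE; apply: le_trans; apply: ler_wpM2l => //.
rewrite !(z1 (_ |: set0)) ?(z1 set0) ?cards0 ?sub0set ?cardsU1 ?cards0 ?inE// /Q ?sub1set
  ?subUset ?sub1set ?sub0set ?inE ?eqxx ?orbT//.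
rewrite -/Q.
have t1 := z3 (d |: (c |: (b |: set0))); rewrite /Q !(subUset, sub1set,
  sub0set) !inE !eqxx ?orbT !(cardsU1, cards0) !inE !orbF ?negb_or !ne in t1;
  have {}t1 := t1 isT erefl.
have t2 := z3 (d |: (c |: (a |: set0))); rewrite /Q !(subUset, sub1set,
  sub0set) !inE !eqxx ?orbT !(cardsU1, cards0) !inE !orbF ?negb_or !ne in t2;
  have {}t2 := t2 isT erefl.
have t3 := z3 (d |: (b |: (a |: set0))); rewrite /Q !(subUset, sub1set,
  sub0set) !inE !eqxx ?orbT !(cardsU1, cards0) !inE !orbF ?negb_or !ne in t3;
  have {}t3 := t3 isT erefl.
have t4 := z3 (c |: (b |: (a |: set0))); rewrite /Q !(subUset, sub1set,
  sub0set) !inE !eqxx ?orbT !(cardsU1, cards0) !inE !orbF ?negb_or !ne in t4;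
  have {}t4 := t4 isT erefl.
move: t1 t2 t3 t4; rewrite -/Q => t1 t2 t3 t4.
have m3 (i j k : C) l : l <= wt x (A :\: Q) -> x i * x j * x k * l <= x i * x j * x k * wt x (A
  :\: Q).
  by apply: ler_wpM2l; rewrite !mulr_ge0.
have m4 : x a * x b * x c * x d * lam x (fiber Q Q T) <= x a * x b * x c * x d * 1.
  by apply: ler_wpM2l; rewrite ?mulr_ge0.
move: (m3 b c d _ t1) (m3 a c d _ t2) (m3 a b d _ t3) (m3 a b c _ t4) m4.
do 11! move: (lam x _) => ?.
move: (x a) (x b) (x c) (x d) (wt x _) => ? ? ? ? ?; lra.
Qed.
End Fiber.

Section Chain.
Variables (R : realType) (N : nat) (x : 'I_N -> R).
Hypothesis x0 : forall i, 0 <= x i.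
Implicit Types (T L : {set {set 'I_N}}) (e f g X : {set 'I_N}) (i j l m z q : 'I_N).
Let c : R := expR (-1).

Section Four.
Variables (k : nat) (m z : 'I_N) (T : {set {set 'I_N}}).
Hypotheses (mk : val m = k) (z0 : val z = 0%N) (k8 : (8 <= k.+1)%N).
Hypotheses (Tk : forall e, e \in T -> e \subset seg N k.+1).
Hypotheses (Tr : is_uniform 4 T) (Ti : intersecting T) (Ts : shifted T).

(* The index sum is minimized by the first colours other than z = 0, together with m. *)
Lemma shifted_min e : e \in T -> m \in e -> z \notin e -> m |: (seg N 4 :\ z) \in T.
Proof.
move=> eT me ze.
pose P := [pred f | [&& f \in T, m \in f & z \notin f]].
have Pe : P e by rewrite /= eT me ze.
pose F := (fun f : {set 'I_N} => \sum_(i in f) val i)%N.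
case: (@arg_minnP _ e P F Pe) => f /and3P[fT mf zf] fmin.
have kN : (k < N)%N by rewrite -mk ltn_ord.
have N4 : (4 <= N)%N by lia.
have m4 : m \notin seg N 4 :\ z by rewrite !inE mk; lia.
have sub : seg N 4 :\ z \subset f.
  apply/subsetP => i i4; apply/negPn/negP => ni.
  have [j jf jn] : exists2 j, j \in f :\ m & j \notin (seg N 4 :\ z) :\ i.
    apply: ex_notin; have := cardsD1 m f; rewrite mf (Tr fT) add1n => -[<-].
    have := cardsD1 z (seg N 4); rewrite inE z0 card_seg//= add1n => -[].
    by rewrite (cardsD1 i (_ :\ z)) i4 add1n => <-.
  move: jf jn i4 => /setD1P[jm jf]; rewrite !inE !negb_and !negbK => jn /andP[iz i4].
  have jz : j != z by apply: contraNneq zf => <-.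
  have ji : j != i by apply: contraNneq ni => <-.
  move: jn; rewrite (negbTE jz) (negbTE ji) /= -leqNgt => j4.
  have ij : (i < j)%N by apply: leq_trans j4.
  have := fmin (i |: (f :\ j)); rewrite /= Ts// !inE (eq_sym _ j) jm mf orbT negb_or (eq_sym z)
    iz (negbTE zf) andbF.
  move=> /(_ isT); rewrite /F (big_setD1 j jf) /= big_setU1 ?leq_add2r /=;
    first by rewrite leqNgt ij.
  by rewrite !inE (negbTE ni) andbF.
have -> : m |: (seg N 4 :\ z) = f => //.
apply/eqP; rewrite eqEcard subUset sub1set mf sub (Tr fT) cardsU1 m4.
by have := cardsD1 z (seg N 4); rewrite inE z0 card_seg//= add1n => -[<-].
Qed.

(** Shifting {1, 2, 3, m} down puts in T every set made of three of 0, 1, 2, 3 and one colour l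
    between 4 and k. If X met {0, 1, 2, 3} only in q, omitting q and choosing l outside X would give
    an edge disjoint from X. Such an l exists because the union of X and {0, 1, 2, 3} has 7 elements
    and there are at least 8 colours. *)
Lemma shifted_two e X : e \in T -> m \in e -> z \notin e -> X \in T -> (2 <= #|X :&: seg N 4|)%N.
Proof.
move=> eT me ze XT; have e1 := shifted_min eT me ze.
have kN : (k < N)%N by rewrite -mk ltn_ord.
have N4 : (4 <= N)%N by lia.
have z4 : z \in seg N 4 by rewrite inE z0.
have m4 : m \notin seg N 4 by rewrite inE mk; lia.
have nm4 : m \notin seg N 4 :\ z by rewrite inE (negbTE m4) andbF.
have mz : m != z by apply: contraNneq m4 => ->.
have zm : (z < m)%N by rewrite z0 mk (leq_trans _ (k8 : 7 <= k)%N).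
have QT : seg N 4 \in T.
  have := Ts e1 zm; rewrite !inE eqxx /= eq_sym (negbTE mz) eqxx /= => /(_ isT isT).
  by rewrite setU1K// setD1K.
have e2 l : l \in seg N k.+1 -> l \notin seg N 4 -> l |: (seg N 4 :\ z) \in T.
  rewrite !inE ltnS leq_eqVlt => /orP[lm _|lm l4]; first by rewrite (_ : l = m)//;
    apply/val_inj/eqP; rewrite /= mk.
  have lm' : (l < m)%N by rewrite mk.
  have := Ts e1 lm'; rewrite !inE eqxx (negbTE l4) andbF orbF /= setU1K//; apply => //.
  by apply/eqP => E; rewrite E ltnn in lm'.
have e3 l q : l \in seg N k.+1 -> l \notin seg N 4 -> q \in seg N 4 -> l |: (seg N 4 :\ q) \in T.
  move=> lk l4 q4; have [->|qz] := eqVneq q z; first exact: e2.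
  have lz : l != z by apply: contraNneq l4 => ->.
  have lq : l != q by apply: contraNneq l4 => ->.
  have zq : (z < q)%N by rewrite z0 lt0n; apply: contraNneq qz => q0; apply/eqP/val_inj; rewrite z0.
  have := Ts (e2 l lk l4) zq; rewrite !in_setU1 !in_setD1 eqxx qz q4 orbT eq_sym (negbTE lz) =>
    /(_ isT isT).
  congr (_ \in T); apply/setP => i; rewrite !in_setU1 !in_setD1.
  have [->|iz] /= := eqVneq i z; first by rewrite eq_sym (negbTE lz) /= eq_sym qz z4.
  rewrite !inE; have [->|il] /= := eqVneq i l; first by rewrite lq.
  by rewrite iz.
rewrite ltnNge; apply/negP; rewrite leq_eqVlt ltnS leqn0 cards_eq0 => /orP[|/eqP X0]; last first.
  by have := Ti XT QT; rewrite X0 eqxx.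
move=> /cards1P[q Xq]; have : q \in X :&: seg N 4 by rewrite Xq set11.
rewrite inE => /andP[qX q4].
have [l lk lX] : exists2 l, l \in seg N k.+1 & l \notin X :|: seg N 4.
  by apply: ex_notin; rewrite cardsU Xq (Tr XT) !card_seg// cards1.
move: lX; rewrite in_setU negb_or => /andP[lX l4].
have := Ti XT (e3 l q lk l4 q4) => /set0Pn[i].
rewrite inE in_setU1 in_setD1 => /andP[iX /orP[/eqP il|/andP[iq i4]]];
  first by rewrite il (negbTE lX) in iX.
have : i \in X :&: seg N 4 by rewrite inE iX.
by rewrite Xq inE (negbTE iq).
Qed.

Lemma shifted_four e : e \in T -> m \in e -> z \notin e ->
  24 * lam x T <= 36 / 100 * wt x (seg N k.+1) ^+ 4.
Proof.
move=> eT me ze; have T2 := fun X => shifted_two eT me ze (X := X).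
have kN : (k < N)%N by rewrite -mk ltn_ord.
have N0 : (0 < N)%N by lia. have N1 : (1 < N)%N by lia.
have N2 : (2 < N)%N by lia. have N3 : (3 < N)%N by lia.
pose a := Ordinal N0; pose b := Ordinal N1; pose u := Ordinal N2; pose d := Ordinal N3.
have sE : seg N 4 = [set a; b; u; d].
  by apply/setP => i; rewrite !inE -!val_eqE /=; case: (val i) => [|[|[|[|]]]].
apply: (@cover4_lam R 'I_N x x0 _ T a b u d) => //.
- by rewrite -sE; apply/subsetP => i; rewrite !inE; lia.
by move=> X XT; rewrite -sE T2.
Qed.
End Four.

(** Outer induction on the uniformity for the link of the last colour, inner induction on the
    support for the edges avoiding it. *)
Lemma chain_bound r k T : (4 <= r)%N -> (k <= N)%N -> is_uniform r T ->
  (forall e, e \in T -> e \subset seg N k) -> intersecting T -> shifted T ->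
  (exists2 e, e \in T & forall i, i \in e -> (0 < i)%N) ->
  r`!%:R * lam x T <= c * wt x (seg N k) ^+ r.
Proof.
elim: r k T => [//|n IHr] k T n4; elim: k T => [|k IHk] T kN Tr Tk Ti Ts Te.
  apply: le_trans (_ : _ <= n.+1`!%:R * elsym x n.+1 (seg N 0)) _.
    by rewrite ler_wpM2l// lam_le_esym// => e eT; rewrite Tk ?Tr.
  by apply: elsym_small_support => //; rewrite card_seg.
have [small|big] := leqP k.+1 (2 * n.+1).-1.
  apply: le_trans (_ : _ <= n.+1`!%:R * elsym x n.+1 (seg N k.+1)) _.
    by rewrite ler_wpM2l// lam_le_esym// => e eT; rewrite Tk ?Tr.
  by apply: elsym_small_support => //; rewrite card_seg.
pose m := Ordinal kN; have mk : val m = k by [].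
have k2n : (2 * n < k)%N by lia.
have nk : (n.+1 < k)%N by lia.
have N0 : (0 < N)%N by lia.
pose z : 'I_N := Ordinal N0; have z0 : val z = 0%N by [].
have kN' : (k <= N)%N by apply: ltnW.
have Li := link_intersecting mk Tk Tr Ti Ts k2n kN'.
have Lr : is_uniform n (link m T) := is_uniform_link Tr.
have Lk := link_seg mk Tk.
have Ls := link_shifted mk Tk Ts.
have [e eT0 e0] := T0_avoid0 mk Tr Ts nk kN Te.
have h0 : n.+1`!%:R * lam x [set e in T | m \notin e] <= c * wt x (seg N k) ^+ n.+1.
  apply: IHk => //.
  - by move=> f; rewrite inE => /andP[/Tr].
  - by move=> f /(T0_seg mk Tk).
  - by move=> f g; rewrite !inE => /andP[fT _] /andP[gT _]; apply: Ti.
  - exact: T0_shifted mk Tk Ts.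
  by exists e.
have s0 := wt_ge0 x0 (seg N k).
have sm : 0 <= x m by [].
have c0 : 0 <= c by apply: expR_ge0.
(* A bound with the same constant on the link suffices: the two bounds add up to the tangent of c
   t^(n+1) at the weight of the first k colours. *)
have fin : n`!%:R * lam x (link m T) <= c * wt x (seg N k) ^+ n ->
   n.+1`!%:R * lam x T <= c * wt x (seg N k.+1) ^+ n.+1.
  move=> h1; rewrite (lam_split x m) mulrDr (wt_segS x mk).
  have := bernoulli n s0 (addr_ge0 sm s0); rewrite addrK => /(ler_wpM2l c0); apply: le_trans.
  rewrite mulrDr; apply: lerD => //.
  rewrite factS natrM; have := ler_wpM2l (mulr_ge0 (ler0n R n.+1) sm) h1.
  by move: (wt x _ ^+ n) (lam x _) => *; lra.
have [Lz|] := boolP [forall f in link m T, z \in f].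
  have k0 : (0 < k)%N by apply: leq_ltn_trans nk.
  apply: fin; apply: (@star_link_lam R N x x0 k n _ z e) => //.
  - by move=> f fL; move/forall_inP: Lz; apply.
  - exact: T0_seg mk Tk _ eT0.
  - by move: eT0; rewrite inE => /andP[/Tr].
  - by apply/negP => /e0.
  move=> f; rewrite inE => /andP[mf mfT]; move: eT0; rewrite inE => /andP[eT me].
  have := Ti _ _ mfT eT => /set0Pn[i]; rewrite !inE => /andP[/orP[/eqP->|fi] ei].
    by rewrite ei in me.
  by apply/set0Pn; exists i; rewrite inE fi.
rewrite negb_forall_in => /exists_inP[f fL zf].
(* A 3-uniform link is outside the induction. Then r = 4, and the edge m |: f avoids 0, so {0, 1, 2,
   3} meets every edge twice and T itself is bounded. *)
have [n4'|n3] := leqP 4 n.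
  apply: fin; apply: IHr => //; exists f => // i fi.
  by rewrite lt0n; apply: contraNneq zf => i0; rewrite (_ : z = i)//; apply: val_inj.
have n3' : n = 3%N by apply/eqP; rewrite eqn_leq -ltnS n3.
move: fL; rewrite inE => /andP[mf mfT].
move: n3' Tr big => -> Tr big.
have h := shifted_four mk z0 big Tk Tr Ti Ts mfT.
have zm : z != m by apply: contraTneq nk => /(congr1 val) /= E; rewrite -E.
have {}h := h (setU11 _ _) _; rewrite !inE negb_or zm zf in h; have {}h := h isT.
apply: le_trans (_ : 24 * lam x T <= _); first by rewrite (_ : 4`! = 24%N).
apply: le_trans h _; rewrite ler_wpM2r ?exprn_ge0 ?wt_ge0//; exact: expRN1_ge.
Qed.
End Chain.

(** * Intersecting families that are not stars *)

(* A crude lower bound for the loss in two_cover_real, where no effort is made on constants. *)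
Definition cover_gap (R : realFieldType) (r : nat) : R :=
  (4 * r%:R ^+ 2)^-1 ^+ r / (8 * r%:R).

(** The third binomial coefficient is lowered to 1; the term b^2 z^n is what yields a gap in
    [two_cover_real]. *)
Lemma binomial3 (R : realFieldType) (n : nat) (b z : R) : 0 <= b -> 0 <= z ->
  z ^+ n.+2 + n.+2%:R * b * z ^+ n.+1 + b ^+ 2 * z ^+ n <= (z + b) ^+ n.+2.
Proof.
move=> b0 z0; elim: n => [|n IH]; first by rewrite expr0 expr1 le_eqVlt; apply/orP; left;
  apply/eqP; ring.
rewrite [leRHS]exprS; apply: le_trans (ler_wpM2l (addr_ge0 z0 b0) IH).
have zn : 0 <= z ^+ n by rewrite exprn_ge0.
have h : 0 <= (n.+2%:R * z + b) * (b ^+ 2 * z ^+ n).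
  apply: mulr_ge0; last by rewrite mulr_ge0 ?sqr_ge0.
  by apply: addr_ge0 => //; apply: mulr_ge0.
rewrite -subr_ge0; apply: le_trans h _; rewrite le_eqVlt; apply/orP; left; apply/eqP.
by rewrite -[n.+3%:R]natr1 !exprS; ring.
Qed.

(** Here a, b are the weights of the two covering colours and z that of the rest. Merging b into the
    rest and applying [star_amgm] gives the star density minus two losses, a b^2 z^(n-2) and (a - b)
    z^n / (2n). They cannot both be negligible unless a or z is, and then F is at most 1/4. *)
Lemma two_cover_real (R : realType) (n : nat) (a b z F : R) : (3 <= n)%N ->
  0 <= b -> b <= a -> 0 <= z -> a + b + z = 1 ->
  F <= n.+1%:R * (n%:R * a * b * z ^+ n.-1 + a * z ^+ n - (2 * n%:R)^-1 * (a - b) * z ^+ n) ->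
  F <= (1 - n.+1%:R^-1) ^+ n - cover_gap R n.+1.
Proof.
case: n => [|[|n]]//; rewrite [_.+2.-1]/= => n3 b0 ba z0 s1 Fle.
have a0 : 0 <= a by apply: le_trans ba.
(* With r the uniformity, F <= r^2 a z, and r^2 t = 1/4. So F <= 1/4 < 36/100 as soon as a or z is
   at most t. *)
set t : R := (4 * n.+3%:R ^+ 2)^-1.
have gE : cover_gap R n.+3 = t ^+ n.+3 / (8 * n.+3%:R) by [].
have r0 : 4 <= n.+3%:R :> R by rewrite ler_nat.
have rr : 16 <= n.+3%:R ^+ 2 :> R.
  by apply: le_trans (_ : 4 ^+ 2 <= _); [lra|apply: sqr_le].
have tr : t * (4 * n.+3%:R ^+ 2) = 1 by rewrite mulVf// gt_eqF//; lra.
have t0 : 0 < t by rewrite invr_gt0; lra.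
have t1 : t <= 1 / 64.
  by rewrite /t -[leRHS]invrK lef_pV2 ?posrE; lra.
have tn : 0 < t ^+ n.+3 by rewrite exprn_gt0.
have tn1 : t ^+ n.+3 <= 1 by rewrite exprn_ile1//; lra.
have g1 : cover_gap R n.+3 <= 1 / 10.
  rewrite gE ler_pdivrMr; last lra.
  by apply: le_trans tn1 _; lra.
have q36 : 36 / 100 < (1 - n.+3%:R^-1) ^+ n.+2 :> R.
  by apply: le_lt_trans (expRN1_ge R) (star_density_gt R (isT : 2 <= n.+3)%N).
have zn : 0 <= z ^+ n.+2 by rewrite exprn_ge0.
have zn1 : 0 <= z ^+ n.+1 by rewrite exprn_ge0.
have zn0 : 0 <= z ^+ n by rewrite exprn_ge0.
have z1 : z <= 1 by lra.
have d0 : 0 < (2 * n.+2%:R)^-1 :> R by rewrite invr_gt0 mulr_gt0.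
have small : F <= n.+3%:R * (n.+3%:R * a * z) -> (a <= t) || (z <= t) -> F <= 1 / 4.
  move=> h az; apply: le_trans h _.
  have : a * z <= t by case/orP: az => az; apply: le_trans az; rewrite ?ler_piMr ?ler_piMl//; lra.
  move=> /(ler_wpM2l (_ : 0 <= 4 * n.+3%:R ^+ 2)) h.
  have {}h := h (ltac:(lra)); rewrite [leRHS]mulrC tr in h.
  by move: h; rewrite expr2; lra.
have F1 : F <= n.+3%:R * (n.+3%:R * a * z).
  apply: le_trans Fle _; rewrite ler_wpM2l// -[n.+3%:R]natr1.
  have z2 : z ^+ n.+1 <= z by rewrite exprS ler_piMr// exprn_ile1.
  have z3 : z ^+ n.+2 <= z by rewrite exprS ler_piMr// exprn_ile1.
  have h1 : n.+2%:R * a * b * z ^+ n.+1 <= n.+2%:R * a * z.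
    rewrite -!mulrA !ler_wpM2l//; apply: le_trans z2; rewrite ler_piMl//; lra.
  have h2 : a * z ^+ n.+2 <= a * z by rewrite ler_wpM2l.
  have h3 : 0 <= (2 * n.+2%:R)^-1 * (a - b) * z ^+ n.+2.
    by apply: mulr_ge0 => //; apply: mulr_ge0; [exact: ltW|rewrite subr_ge0].
  move: h1 h2 h3; move: ((2 * n.+2%:R)^-1 : R) (n.+2%:R : R) (z ^+ n.+2) (z ^+ n.+1) => ? ? ? ?
    *; lra.
have [/(small F1)|] := boolP ((a <= t) || (z <= t)); first lra.
rewrite negb_or -!ltNge => /andP[ta tz].
have main : F <= (1 - n.+3%:R^-1) ^+ n.+2 - (a * b ^+ 2 * z ^+ n + (2 * n.+2%:R)^-1 * (a - b) * z
  ^+ n.+2).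
  have h1 := star_amgm (isT : (0 < n.+2)%N) a0 (addr_ge0 z0 b0).
  rewrite (_ : a + (z + b) = 1) in h1; last by lra.
  rewrite expr1n mulr1 in h1.
  have h2 := binomial3 n b0 z0.
  have ra : 0 <= n.+3%:R * a by rewrite mulr_ge0.
  have h3 := ler_wpM2l ra h2.
  have h4 : 0 <= a * b ^+ 2 * z ^+ n by rewrite !mulr_ge0 ?sqr_ge0.
  have h5 : 0 <= (2 * n.+2%:R)^-1 * (a - b) * z ^+ n.+2.
    by apply: mulr_ge0 => //; apply: mulr_ge0; [exact: ltW|rewrite subr_ge0].
  have h6 : a * b ^+ 2 * z ^+ n <= n.+3%:R * (a * b ^+ 2 * z ^+ n) by rewrite ler_peMl//; lra.
  have h7 : (2 * n.+2%:R)^-1 * (a - b) * z ^+ n.+2 <= n.+3%:R * ((2 * n.+2%:R)^-1 * (a - b) * z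
    ^+ n.+2) by rewrite ler_peMl//; lra.
  move: h1 h2 h3 h6 h7 Fle; move: ((2 * n.+2%:R)^-1 : R) => d.
  move: (z ^+ n.+2) (z ^+ n.+1) (z ^+ n) ((z + b) ^+ n.+2) (_ ^+ n.+2) => Z2 Z1 Z0 S q.
  move: (n.+3%:R : R) (n.+2%:R : R) (b ^+ 2) => N3 N2 B h1 h2 h3 h6 h7 Fl.
  move: (_ ^+ n.+2) h1 => P h1; clear -h1 h3 h6 h7 Fl; lra.
apply: le_trans main _; rewrite lerD2l lerN2 gE.
have tzn k : t ^+ k <= z ^+ k by rewrite lerXn2r ?nnegrE// ltW.
have h4 : 0 <= a * b ^+ 2 * z ^+ n by rewrite !mulr_ge0 ?sqr_ge0.
have h5 : 0 <= (2 * n.+2%:R)^-1 * (a - b) * z ^+ n.+2.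
  by apply: mulr_ge0 => //; apply: mulr_ge0; [exact: ltW|rewrite subr_ge0].
(* If a - b is below t/2, then b > t/2 because a > t; so one of the two losses is bounded below. *)
have [h|h] := leP (t / 2) (a - b).
  apply: le_trans (_ : (2 * n.+2%:R)^-1 * (a - b) * z ^+ n.+2 <= _); last by rewrite lerDr.
  apply: le_trans (_ : (2 * n.+3%:R)^-1 * (t / 2) * t ^+ n.+2 <= _).
    have E (u N V : R) : 4 <= N -> u * V / (8 * N) = (2 * N)^-1 * (u / 2) * V / 2 by move=> ?;
      field; lra.
    rewrite exprS (E _ _ _ r0).
    have : 0 <= (2 * n.+3%:R)^-1 * (t / 2) * t ^+ n.+2.
      by apply: mulr_ge0; [apply: mulr_ge0; [rewrite invr_ge0; lra|lra]|rewrite exprn_ge0// ltW].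
    by move=> X0; rewrite ler_piMr// invf_le1 ?ler1n//.
  apply: ler_pM => //.
  - by apply: mulr_ge0; [rewrite invr_ge0; lra|lra].
  - by rewrite exprn_ge0// ltW.
  apply: ler_pM => //; [by rewrite invr_ge0; lra|lra|].
  by rewrite lef_pV2 ?posrE ?mulr_gt0// ler_pM2l// ler_nat.
apply: le_trans (_ : a * b ^+ 2 * z ^+ n <= _); last by rewrite lerDl.
apply: le_trans (_ : t * (t / 2) ^+ 2 * t ^+ n <= _); last first.
  have b2 : t / 2 <= b by lra.
  apply: ler_pM => //; [|by rewrite exprn_ge0// ltW|].
    by apply: mulr_ge0; rewrite ?sqr_ge0// ltW.
  apply: ler_pM; rewrite ?sqr_ge0//; [exact: ltW|exact: ltW|].
  by apply: sqr_le => //; lra.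
rewrite ler_pdivrMr; last by lra.
have E (u N : R) : u * (u / 2) ^+ 2 * u ^+ n * (8 * N) = u ^+ n.+3 * (2 * N) by rewrite !exprS;
  field.
by rewrite E ler_peMr//; [exact: ltW|lra].
Qed.

Section TwoCover.
Variables (R : realType) (C : finType) (x : C -> R).
Hypothesis x0 : forall i, 0 <= x i.
Implicit Types (T : {set {set C}}) (e f g : {set C}) (i j : C).

(** The analogue of [hit_loss] for a hitting set of size n; it turns [hit_bound] into the factor 1 -
    1/(2n). *)
Lemma hit_loss2 (n : nat) (w v : R) : (2 <= n)%N -> 0 <= w -> 0 <= v ->
  n%:R * (w + v) * v ^+ n.-1 - (2 * n%:R - 1) * v ^+ n <= (w + v) ^+ n / 2.
Proof.
case: n => [|[|n]]// _ w0 v0; rewrite [_.-1]/=.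
have z0 : 0 <= w + v by rewrite addr_ge0.
have v20 : 0 <= 2 * v by rewrite mulr_ge0.
have := bernoulli n.+1 v20 z0; rewrite !exprMn => h.
have V0 : 0 <= v ^+ n.+2 by rewrite exprn_ge0.
have P0 : 1 <= 2 ^+ n :> R by rewrite exprn_ege1// ler1n.
have {}h : 2 ^+ n * (2 * (n.+2%:R * (w + v) * v ^+ n.+1 - (2 * n.+2%:R - 2) * v ^+ n.+2)) <= (w +
  v) ^+ n.+2.
  apply: le_trans h; rewrite le_eqVlt; apply/orP; left; apply/eqP; rewrite !exprS; ring.
have Z0 : 0 <= (w + v) ^+ n.+2 by rewrite exprn_ge0.
move: h P0 V0 Z0; move: (2 ^+ n) (v ^+ n.+2) ((w + v) ^+ n.+2) (n.+2%:R : R) => p V Z N h p1 V0 Z0.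
move: (N * (w + v) * v ^+ n.+1) h => X h.
rewrite (_ : X - (2 * N - 1) * V = X - (2 * N - 2) * V - V); last by ring.
move: h; move: (X - _) => Y h; clear -h p1 V0 Z0.
have [h2|h2] := leP (2 * Y) 0; first by lra.
have : 2 * Y <= p * (2 * Y) by rewrite ler_peMl// ltW.
lra.
Qed.

(** Let F and G be the links of i without j and of j without i. Then x_i F + x_j G = (x_i - x_j) F +
    x_j (F + G) for the Lagrangians. F and G are disjoint because no replacement of j by i stays in
    T, so F + G is bounded as one family. F alone loses 1/(2n), since all its members meet e0 minus
    j. *)
Lemma two_cover n T i j : (3 <= n)%N -> i != j -> x j <= x i -> wt x setT = 1 ->
  is_uniform n.+1 T -> intersecting T ->
  (forall e, e \in T -> (i \in e) || (j \in e)) ->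
  (forall e, e \in T -> j \in e -> i \notin e -> i |: (e :\ j) \notin T) ->
  (exists2 e, e \in T & i \notin e) ->
  n.+1`!%:R * lam x T <= (1 - n.+1%:R^-1) ^+ n - cover_gap R n.+1.
Proof.
move=> n3 ij xij w1 Tr Ti Tc Tm [e0 e0T ie0].
pose Q := j |: (i |: set0).
have jQ : j \notin i |: set0 by rewrite !inE orbF eq_sym.
have iQ : i \notin (set0 : {set C}) by rewrite inE.
set Z := ~: Q.
set B := fiber Q Q T; set F := fiber Q (i |: set0) T; set G := fiber Q (j |: set0) T.
have lamE : lam x T = x i * lam x F + x j * lam x G + x i * x j * lam x B.
  rewrite -{1}(fiber0 T) (lam_fiber x _ _ iQ) !(lam_fiber x _ _ jQ) -/Q -/B -/F -/G.
  rewrite (_ : fiber Q set0 T = set0) ?lam0; first by ring.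
  apply/setP => g; rewrite in_set set0U in_set0; apply/negbTE/negP => /andP[].
  by rewrite !disjoint_setU1r => /and3P[jg ig _] /Tc; rewrite (negbTE jg) (negbTE ig).
have sum1 : x i + x j + wt x Z = 1.
  rewrite -w1 (_ : setT = i |: (j |: Z)).
    rewrite !wtU1 ?addrA // /Z !inE ?eqxx// (negbTE ij) ?eqxx//.
  by apply/setP => l; rewrite /Z !inE orbF; case: (l == i); case: (l == j).
have z0 := wt_ge0 x0 Z; set z := wt x Z in sum1 z0.
have dis (S g : {set C}) : S \subset Q -> [disjoint g & Q] -> #|S :|: g| = (#|S| + #|g|)%N.
  move=> SQ gQ; rewrite cardsU (_ : S :&: g = set0) ?cards0 ?subn0//; apply/eqP; rewrite setI_eq0.
  by apply: disjointWl SQ _; rewrite disjoint_sym.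
have FZ g : g \in F -> g \subset Z /\ #|g| = n.
  rewrite in_set => /andP[gQ gT]; split; first by rewrite /Z -disjoints_subset.
  have := Tr _ gT; rewrite (dis _ _ _ gQ) ?cardsU1 ?cards0 ?inE; last by rewrite /Q subsetUr.
  by rewrite addn0 add1n => -[].
have GZ g : g \in G -> g \subset Z /\ #|g| = n.
  rewrite in_set => /andP[gQ gT]; split; first by rewrite /Z -disjoints_subset.
  have := Tr _ gT; rewrite (dis _ _ _ gQ) ?cardsU1 ?cards0 ?inE;
    last by rewrite /Q !subUset !sub1set !inE eqxx sub0set.
  by rewrite addn0 add1n => -[].
have BZ g : g \in B -> g \subset Z /\ #|g| = n.-1.
  rewrite in_set => /andP[gQ gT]; split; first by rewrite /Z -disjoints_subset.
  have := Tr _ gT; rewrite (dis _ _ _ gQ)// /Q !cardsU1 jQ cards0 iQ addn0 => -[].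
  by rewrite add1n => <-.
have hB : n.-1`!%:R * lam x B <= z ^+ n.-1.
  by apply: le_trans (elsym_le x0 _ _); rewrite ler_wpM2l// lam_le_esym.
have FG0 : [disjoint F & G].
  rewrite -setI_eq0; apply/eqP/setP => g; rewrite in_setI !in_set; apply/negbTE/negP.
  move=> /andP[/andP[gQ iT] /andP[_ jT]]; move: gQ; rewrite !disjoint_setU1r => /and3P[jg ig _].
  have := Tm _ jT; rewrite !inE eqxx (negbTE ig) (negbTE ij) => /(_ isT isT).
  rewrite setU0 setU1K// => /negP; apply.
  by move: iT; rewrite setU0.
have hFG : n`!%:R * (lam x F + lam x G) <= z ^+ n.
  have -> : lam x F + lam x G = lam x (F :|: G) by rewrite /lam -bigU//; apply: eq_bigl => e;
    rewrite [in RHS]in_setU.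
  apply: le_trans (elsym_le x0 _ _); rewrite ler_wpM2l// lam_le_esym// => g.
  by rewrite inE => /orP[/FZ|/GZ].
have je0 : j \in e0 by have := Tc _ e0T; rewrite (negbTE ie0).
pose g0 := e0 :\ j.
have g0c : #|g0| = n by have := cardsD1 j e0; rewrite je0 (Tr _ e0T) add1n => -[].
have g0Z : g0 \subset Z.
  by apply/subsetP => l; rewrite !inE orbF => /andP[/negbTE -> l0]; apply: contraNneq ie0 => <-.
have hit f : f \in F -> f :&: g0 != set0.
  rewrite in_set => /andP[fQ fT]; have /set0Pn[l] := Ti _ _ fT e0T.
  rewrite !inE orbF => /andP[/orP[/eqP ->|lf] l0]; first by rewrite (negbTE ie0) in l0.
  apply/set0Pn; exists l; rewrite !inE lf l0 andbT.
  by apply/eqP => E; move: fQ; rewrite disjoint_setU1r -E lf.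
have gE : g0 :|: (Z :\: g0) = Z by rewrite -{1}(setIidPr g0Z) setID.
have dg : [disjoint g0 & Z :\: g0] by rewrite disjoint_sym -setI_eq0 setDE -setIA (setIC (~: g0))
  setICr setI0.
have zE : z = wt x g0 + wt x (Z :\: g0).
  by rewrite /z -{1}gE /wt -bigU//=; apply: eq_bigl => l; rewrite inE.
case: n n3 Tr g0c hB hFG FZ GZ BZ => [|[|n]]// n3 Tr g0c hB hFG FZ GZ BZ.
have hF : n.+2`!%:R * lam x F <= (1 - (2 * n.+2%:R)^-1) * z ^+ n.+2.
  have := hit_bound x0 dg g0c (T := F) (n := n.+1).
  rewrite gE => /(_ (fun e eF => And3 (proj1 (FZ e eF)) (proj2 (FZ e eF)) (hit e eF))).
  have w0 := wt_ge0 x0 g0; have v0 := wt_ge0 x0 (Z :\: g0).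
  have := hit_loss2 (ltnW n3) w0 v0; rewrite -zE [_.-1]/=.
  rewrite -[n.+2%:R]natr1; move: zE (ler0n R n.+1); move: (wt x g0) (wt x (Z :\: g0)) (n.+1%:R :
    R) => w v N zE N0.
  rewrite [v ^+ n.+2]exprS; move: (n.+2`!%:R) (z ^+ _) (v ^+ _) (lam x F) => f Z' V l h1 h2.
  have {}h2 : (N + 1) * (f * l) <= (N + 1) * ((1 - (2 * (N + 1))^-1) * Z').
    have -> : (N + 1) * ((1 - (2 * (N + 1))^-1) * Z') = (N + 1 / 2) * Z' by field; lra.
    move: h1 h2; rewrite zE; clear; lra.
  by rewrite ler_pM2l in h2 => //; lra.
apply: (@two_cover_real R n.+2 (x i) (x j) z) => //.
rewrite lamE factS natrM -[leLHS]mulrA; apply: ler_wpM2l => //; rewrite [_.-1]/= in hB *.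
have h1 : n.+2`!%:R * lam x B <= n.+2%:R * z ^+ n.+1 by rewrite factS natrM -mulrA ler_wpM2l.
have h2 := ler_wpM2l (mulr_ge0 (x0 i) (x0 j)) h1.
have h3 : (x i - x j) * (n.+2`!%:R * lam x F) <= (x i - x j) * ((1 - (2 * n.+2%:R)^-1) * z ^+ n.+2).
  by apply: ler_wpM2l hF; rewrite subr_ge0.
have h4 := ler_wpM2l (x0 j) hFG.
move: h2 h3 h4; move: ((2 * n.+2%:R)^-1 : R) (lam x _) (lam x _) (lam x _) (z ^+ _) (z ^+ _) (x
  i) (x j) (n.+2`!%:R : R) (n.+2%:R : R).
by clear; move=> *; lra.
Qed.
End TwoCover.

(** * Compressions of families with decreasing weights *)

Section Shift.
Variables (R : realType) (N : nat) (x : 'I_N -> R).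
Hypothesis x0 : forall i, 0 <= x i.
Implicit Types (T : {set {set 'I_N}}) (e f g : {set 'I_N}) (i j l : 'I_N).

(** The Erdos-Ko-Rado compression: an edge moves only if its image is new, which makes the map
    injective on T. *)
Definition shift1 T i j e :=
  if [&& j \in e, i \notin e & i |: (e :\ j) \notin T] then i |: (e :\ j) else e.

Definition shift T i j : {set {set 'I_N}} := [set shift1 T i j e | e in T].

Lemma swapK i j e : j \in e -> i \notin e -> j |: ((i |: (e :\ j)) :\ i) = e.
Proof. by move=> je ie; rewrite setU1K ?setD1K// !inE (negbTE ie) andbF. Qed.

Lemma shift1_inj T i j : {in T &, injective (shift1 T i j)}.
Proof.
move=> e f eT fT; rewrite /shift1.
case: ifP => [/and3P[je ie eS]|_]; case: ifP => [/and3P[jf if_ fS]|_] //.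
- by move=> E; rewrite -(swapK je ie) E swapK.
- by move=> E; rewrite E fT in eS.
by move=> E; rewrite -E eT in fS.
Qed.

Lemma shift_uniform r T i j : is_uniform r T -> is_uniform r (shift T i j).
Proof.
move=> Tr _ /imsetP[e eT ->]; rewrite /shift1; case: ifP => [/and3P[je ie _]|_]; last exact: Tr.
by rewrite card_swap ?Tr.
Qed.

Lemma shift_intersecting T i j : intersecting T -> intersecting (shift T i j).
Proof.
move=> Ti; have key e f : e \in T -> f \in T -> j \in e -> i \notin e ->
    ~~ [&& j \in f, i \notin f & i |: (f :\ j) \notin T] -> (i |: (e :\ j)) :&: f != set0.
  move=> eT fT je ie nf; have [iF|nif] := boolP (i \in f).
    by apply/set0Pn; exists i; rewrite !inE eqxx.
  have [jf|njf] := boolP (j \in f).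
    move: nf; rewrite jf nif negbK => /(Ti _ _ eT)/set0Pn[l];
      rewrite !inE => /andP[le /orP[/eqP E|/andP[lj lf]]].
      by rewrite -E le in ie.
    by apply/set0Pn; exists l; rewrite !inE le lf lj orbT.
  have /set0Pn[l] := Ti _ _ eT fT; rewrite inE => /andP[le lf].
  apply/set0Pn; exists l; rewrite !inE le lf andbT.
  by apply/orP; right; rewrite andbT; apply: contraNneq njf => <-.
move=> _ _ /imsetP[e eT ->] /imsetP[f fT ->]; rewrite /shift1.
case: ifP => [/and3P[je ie eS]|/negbT ne]; case: ifP => [/and3P[jf if_ fS]|/negbT nf].
- by apply/set0Pn; exists i; rewrite !inE eqxx.
- exact: key.
- by rewrite setIC; apply: key.
exact: Ti.
Qed.

Lemma lam_shift T i j : x j <= x i -> lam x T <= lam x (shift T i j).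
Proof.
move=> xij; rewrite /lam [leRHS]big_imset /=; last exact: shift1_inj.
apply: ler_sum => e _; rewrite /shift1; case: ifP => [/and3P[je ie _]|_]//.
rewrite (big_setD1 j je) big_setU1 /=; last by rewrite !inE (negbTE ie) andbF.
by rewrite ler_wpM2r// prodr_ge0.
Qed.

Definition height T := (\sum_(e in T) \sum_(l in e) val l)%N.

Lemma height_shift T i j e : e \in T -> (i < j)%N -> j \in e -> i \notin e ->
  i |: (e :\ j) \notin T ->
  (height (shift T i j) < height T)%N.
Proof.
move=> eT ij je ie eS; rewrite /height big_imset /=; last exact: shift1_inj.
have le f : f \in T -> (\sum_(l in shift1 T i j f) l <= \sum_(l in f) l)%N.
  move=> fT; rewrite /shift1; case: ifP => [/and3P[jf if_ _]|_]//.
  rewrite (big_setD1 j jf) big_setU1 /=; last by rewrite !inE (negbTE if_) andbF.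
  by rewrite leq_add2r ltnW.
rewrite (big_setD1 e eT) [X in (_ < X)%N](big_setD1 e eT) /= -addSn leq_add//; last first.
  by apply: leq_sum => f /setD1P[_ /le].
rewrite /shift1 je ie eS (big_setD1 j je) big_setU1 /= ?ltn_add2r//.
by rewrite !inE (negbTE ie) andbF.
Qed.

(** Induction on the sum of all colour indices. If a proper shift yields a star, its centre must be
    i, and every edge avoiding i must have moved, hence contains j: then T is covered by {i, j} and
    [two_cover] applies. *)
Lemma nonstar_bound_ord r T : (4 <= r)%N -> wt x setT = 1 -> (forall i j, (i <= j)%N ->
  x j <= x i) ->
  is_uniform r T -> intersecting T -> (forall i, exists2 e, e \in T & i \notin e) ->
  r`!%:R * lam x T <= Num.max (expR (-1)) ((1 - r%:R^-1) ^+ r.-1 - cover_gap R r).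
Proof.
move=> r4 w1 xd; have [n] := ubnP (height T); elim: n T => // n IH T; rewrite ltnS => Hn Tr Ti Tn.
have [N0|N0] := posnP N.
  rewrite (_ : T = set0) ?lam0 ?mulr0; first by rewrite le_max expR_ge0.
  apply/setP => e; rewrite in_set0; apply/negP => eT.
  have := max_card (mem e); rewrite card_ord (Tr _ eT) N0; lia.
have [/forallP sh|] := boolP [forall e in T, forall i : 'I_N, forall j : 'I_N,
  (i < j)%N ==> (j \in e) ==> (i \notin e) ==> (i |: (e :\ j) \in T)].
  rewrite le_max; apply/orP; left.
  have sE : seg N N = setT by apply/setP => i; rewrite !inE ltn_ord.
  have := @chain_bound R N x x0 r N T r4 (leqnn _) Tr; rewrite sE w1 expr1n mulr1; apply => //.
  - by move=> e i j eT ij je ie; move: (sh e) => /implyP/(_ eT)/forallP/(_ i)/forallP/(_ j);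
    rewrite ij je ie.
  have [e eT e0] := Tn (Ordinal N0); exists e => // i ie.
  by rewrite lt0n; apply: contraNneq e0 => i0; rewrite (_ : Ordinal N0 = i)//; apply: val_inj.
rewrite negb_forall => /existsP[e]; rewrite negb_imply => /andP[eT].
rewrite negb_forall => /existsP[i]; rewrite negb_forall => /existsP[j].
rewrite !negb_imply => /and4P[ij je ie eS].
have xij : x j <= x i by apply/xd/ltnW.
have [/forallP ns|] := boolP [forall z, [exists f in shift T i j, z \notin f]].
  apply: le_trans (_ : _ <= r`!%:R * lam x (shift T i j)) _; first by rewrite ler_wpM2l// lam_shift.
  apply: IH; first by apply: leq_trans (height_shift eT ij je ie eS) _.
  - exact: shift_uniform.
  - exact: shift_intersecting.
  by move=> z; have /exists_inP[f] := ns z; exists f.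
rewrite negb_forall => /existsP[z]; rewrite negb_exists => /forallP zs.
have {}zs f : f \in shift T i j -> z \in f by move=> fS; have := zs f; rewrite fS /= negbK.
have zi : z = i.
  have [f fT zf] := Tn z; have : z \in shift1 T i j f by apply: zs; apply/imsetP; exists f.
  rewrite /shift1; case: ifP => [_|_]; last by rewrite (negbTE zf).
  by rewrite !inE (negbTE zf) andbF orbF => /eqP.
rewrite le_max; apply/orP; right.
have mv f : f \in T -> i \notin f -> (j \in f) && (i |: (f :\ j) \notin T).
  move=> fT nif; have : z \in shift1 T i j f by apply: zs; apply/imsetP; exists f.
  by rewrite zi /shift1; case: ifP => [/and3P[-> _ ->]//|_]; rewrite (negbTE nif).
case: r r4 Tr {IH} => // n' r4 Tr.
apply: (two_cover x0 (i := i) (j := j)) => //.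
- by apply/eqP => E; rewrite E ltnn in ij.
- by move=> f fT; have [//|/(mv _ fT)/andP[->]] := boolP (i \in f).
by move=> f fT jf /(mv _ fT)/andP[].
Qed.
End Shift.

(** The colours are numbered by decreasing weight, so that shifting towards smaller indices never
    decreases the Lagrangian. *)
Lemma nonstar_bound (R : realType) (r : nat) : (4 <= r)%N -> exists2 eps : R, 0 < eps &
  forall (C : finType) (x : C -> R) (T : {set {set C}}), (forall i, 0 <= x i) -> wt x setT = 1 ->
    is_uniform r T -> intersecting T -> (forall i, exists2 e, e \in T & i \notin e) ->
    r`!%:R * lam x T <= (1 - r%:R^-1) ^+ r.-1 - eps.
Proof.
move=> r4; set q := (1 - r%:R^-1) ^+ r.-1.
have r2 : (2 <= r)%N by lia.
have qc : expR (-1) < q := star_density_gt R r2.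
have g0 : 0 < cover_gap R r.
  have r0 : 0 < r%:R :> R by rewrite ltr0n; lia.
  by rewrite divr_gt0 ?exprn_gt0 ?invr_gt0 ?mulr_gt0 ?exprn_gt0.
exists (Num.min (cover_gap R r) (q - expR (-1))); first by rewrite lt_min g0 subr_gt0.
move=> C x T x0 w1 Tr Ti Tn.
pose s := sort (fun a b => x b <= x a) (enum C).
have sC : size s = #|C| by rewrite size_sort -cardE.
pose d (i : 'I_#|C|) : C := enum_val i.
pose f (i : 'I_#|C|) : C := nth (d i) s i.
have fE y i : f i = nth y s i by apply: set_nth_default; rewrite sC.
have su : uniq s by rewrite sort_uniq enum_uniq.
have finj : injective f.
  move=> i j; rewrite (fE (d i)) [f j](fE (d i)) => /eqP; rewrite nth_uniq ?sC// => /eqP;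
    exact: val_inj.
have fbij : bijective f by apply: inj_card_bij finj _; rewrite card_ord.
have xd (i j : 'I_#|C|) : (i <= j)%N -> x (f j) <= x (f i).
  move=> ij; rewrite !(fE (d i)).
  have tot : total (fun a b : C => x b <= x a) by move=> a b; apply: le_total.
  have tr : transitive (fun a b : C => x b <= x a) by move=> a b c ab bc; apply: le_trans ab.
  by apply: (sorted_leq_nth tr _ _ (sort_sorted tot _)) => //; rewrite ?inE ?sC//.
case: fbij => g fK gK.
pose T' := [set e : {set 'I_#|C|} | f @: e \in T].
have imK (e : {set C}) : f @: (g @: e) = e.
  by rewrite -imset_comp (eq_imset _ gK) imset_id.
have lamE : lam x T = lam (x \o f) T'.
  rewrite /lam (reindex (fun e : {set 'I_#|C|} => f @: e)) /=; last first.
    exists (fun e : {set C} => g @: e) => e _; last exact: imK.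
    by rewrite -imset_comp (eq_imset _ fK) imset_id.
  apply: eq_big => [e|e _]; first by rewrite inE.
  by rewrite big_imset //=; apply: in2W.
have wE : wt (x \o f) setT = 1.
  rewrite -w1 /wt [RHS](reindex f) /=; last by exists g => i _.
  by apply: eq_bigl => i; rewrite !inE.
have := @nonstar_bound_ord R #|C| (x \o f) (fun i => x0 _) r T' r4 wE xd.
rewrite -lamE => h; have {}h : r`!%:R * lam x T <= Num.max (expR (-1)) (q - cover_gap R r).
  apply: h.
  - by move=> e; rewrite inE => /Tr; rewrite card_imset.
  - move=> e e'; rewrite !inE => eT eT'; have := Ti _ _ eT eT'.
    rewrite -imsetI; last exact: in2W.
    by apply: contraNneq => ->; rewrite imset0.
  move=> i; have [e eT fe] := Tn (f i); exists (g @: e); first by rewrite inE imK.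
  by apply: contra fe => ig; rewrite -(imK e) imset_f.
apply: le_trans h _; rewrite ge_max; apply/andP; split.
  by rewrite lerBrDr -lerBrDl ge_min lexx orbT.
by rewrite lerD2l lerN2 ge_min lexx.
Qed.

(** * Extending a semibipartite induced subgraph *)

Section Hypergraph.
Variable V : finType.
Implicit Types (H : {set {set V}}) (e f g S A B : {set V}) (u v w : V).

Definition cov H u v : bool := [exists e in H, (u \in e) && (v \in e)].

(* Equivalent to being free of the weak expansions of M2 (free_cfree, cfree_free). *)
Definition cfree H : Prop := forall e f, e \in H -> f \in H -> [disjoint e & f] ->
  exists u v, [/\ u \in e, v \in f & ~~ cov H u v].

(* The subgraph of H induced on S is semibipartite. *)
Definition semib H S : Prop := exists A : {set V}, forall e, e \in H -> e \subset S ->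
  #|A :&: e| = 1%N.

Lemma covP H u v : reflect (exists e, [/\ e \in H, u \in e & v \in e]) (cov H u v).
Proof.
apply: (iffP exists_inP) => [[e eH /andP[ue ve]]|[e [eH ue ve]]]; first by exists e.
by exists e => //; rewrite ue.
Qed.

Lemma cov_sym H u v : cov H u v = cov H v u.
Proof. by apply: eq_existsb => e; rewrite [(u \in e) && _]andbC. Qed.

Lemma bin_le_expn n k : ('C(n, k) <= n ^ k)%N.
Proof.
apply: leq_trans (_ : 'C(n, k) * k`! <= _)%N; first by rewrite leq_pmulr// fact_gt0.
by rewrite bin_ffact ffact_le_expn.
Qed.

Lemma card_meet (k : nat) (F : {set {set V}}) (Z : {set V}) : is_uniform k F ->
  (forall f, f \in F -> f :&: Z != set0) -> (#|F| <= #|Z| * #|V| ^ k.-1)%N.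
Proof.
move=> Fk FZ.
have -> : (#|Z| * #|V| ^ k.-1 = \sum_(z in Z) #|V| ^ k.-1)%N by rewrite sum_nat_const.
apply: leq_trans (_ : \sum_(z in Z) #|[set f in F | z \in f]| <= _)%N.
  rewrite -sum1_card (eq_bigr (fun z => \sum_(f in F | z \in f) 1))%N; last first.
    by move=> z _; rewrite -sum1_card; apply: eq_bigl => f; rewrite inE.
  rewrite (exchange_big_dep (mem F)) /=; last by move=> z f _ /andP[].
  apply: leq_sum => f fF; have /set0Pn[z] := FZ f fF; rewrite inE => /andP[zf zZ].
  by rewrite (bigD1 z) //= zZ fF.
apply: leq_sum => z _.
apply: leq_trans (bin_le_expn _ _); rewrite -card_draws.
have inj : {in [set f in F | z \in f] &, injective (fun f => f :\ z)}.
  move=> f g; rewrite !inE => /andP[_ zf] /andP[_ zg] E.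
  by rewrite -(setD1K zf) E setD1K.
rewrite -[X in (X <= _)%N](card_in_imset inj) {inj}; apply: subset_leq_card;
  apply/subsetP => _ /imsetP[f fz ->].
move: fz; rewrite !inE => /andP[fF zf]; have := cardsD1 z f; rewrite zf (Fk _ fF) add1n => ->.
by [].
Qed.

Lemma link_degree H v : #|link v H| = #|[set e in H | v \in e]|.
Proof.
have inj : {in link v H &, injective (fun f => v |: f)}.
  move=> f g; rewrite !inE => /andP[vf _] /andP[vg _] E.
  by rewrite -(setU1K vf) E setU1K.
rewrite -[LHS](card_in_imset inj); apply: eq_card => e; rewrite inE; apply/imsetP/andP.
  by case=> f; rewrite inE => /andP[vf eH] ->; rewrite eH setU11.
by case=> eH ve; exists (e :\ v); rewrite ?setD1K// inE setD11 setD1K.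
Qed.

Lemma link_loss r H v S : is_uniform r H ->
  (#|link v H| <= #|[set f in link v H | f \subset S]| + #|~: S| * #|V| ^ r.-2)%N.
Proof.
move=> Hr; rewrite -[X in (X <= _)%N](cardsID [set f : {set V} | f \subset S]); apply: leq_add.
  by apply: subset_leq_card; apply/subsetP => f; rewrite !inE.
apply: (@card_meet r.-1) => [f|f]; first by rewrite inE => /andP[_ /(is_uniform_link Hr)->].
by rewrite !inE => /andP[fS _]; rewrite setI_eq0 disjoints_subset setCK.
Qed.

Lemma semibS H S S' : S \subset S' -> semib H S' -> semib H S.
Proof. by move=> sS [A h]; exists A => e eH eS; apply: h => //; apply: subset_trans sS. Qed.

(** * Placing one vertex beside a nearly complete semibipartite graph *)

Section Extend.
Variables (r g : nat) (H : {set {set V}}) (S A : {set V}) (v : V).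
Let B := S :\: A.
Let N w := [set y in B | cov H w y].
Hypotheses (r3 : (3 <= r)%N) (Hr : is_uniform r H) (Hf : cfree H) (vS : v \notin S).
Hypotheses (AS : A \subset S) (HA : forall e, e \in H -> e \subset S -> #|A :&: e| = 1%N).
Hypotheses (g0 : (0 < g)%N) (Bg : (r.+1 * g <= #|B|)%N).
Hypothesis dense : forall a (X : {set V}), a \in A -> X \subset B -> (g <= #|X|)%N ->
  exists2 f : {set V}, f \subset X & a |: f \in H.
Hypothesis missB : forall w, w \in S -> (#|B :\: N w| < g)%N.
Hypothesis missA : forall b, b \in B -> (#|A :\: [set a in A | cov H b a]| < g)%N.

Let L := [set f in link v H | f \subset S].
Let L0 := [set f in L | f \subset B].
Let L1 := [set f in L | #|f :&: A| == 1%N].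

(* the vertices that cannot be used next to [f] *)
Let M (f : {set V}) := f :|: \bigcup_(x in f) (B :\: N x).

Lemma card_bad f : f \subset S -> (#|M f| <= #|f| * g)%N.
Proof.
move=> fS; rewrite /M; apply: leq_trans (leq_card_setU _ _) _.
have h : (#|\bigcup_(x in f) (B :\: N x)| <= \sum_(x in f) g.-1)%N.
  apply: leq_trans (_ : \sum_(x in f) #|B :\: N x| <= _)%N.
    elim/big_rec2: _ => [|x m U _ IH]; first by rewrite cards0.
    by apply: leq_trans (leq_card_setU _ _) _; rewrite leq_add2l.
  apply: leq_sum => x xf; have := missB (subsetP fS x xf); lia.
apply: leq_trans (leq_add (leqnn _) h) _; by rewrite sum_nat_const -mulnS prednK.
Qed.

Lemma splitg : (r.+1 * g = r.-1 * g + 2 * g)%N.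
Proof. by rewrite -mulnDl; congr (_ * _)%N; lia. Qed.

(** The budget is r + 1 = (r - 1) + 2: at most (r - 1) g vertices are bad for f, one g is conceded
    in the hypothesis on X, and g vertices must remain for [dense]. *)
Lemma edge_in (X f : {set V}) (a : V) : a \in A -> X \subset B -> f \subset S -> #|f| = r.-1 ->
  (r.+1 * g <= #|X| + g)%N ->
  exists f2 : {set V}, [/\ f2 \subset X, a |: f2 \in H, [disjoint f & f2] & forall x y : V,
    x \in f -> y \in f2 -> cov H x y].
Proof.
move=> aA XB fS fr Xg.
have [||f2 f2X f2H] := @dense a (X :\: M f) aA.
- by apply: subset_trans XB; apply: subsetDl.
- have := card_bad fS; have := cardsID (M f) X; have := subset_leq_card (subsetIr X (M f)).
  by rewrite fr; have := splitg; lia.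
exists f2; split=> //.
- by apply: subset_trans f2X _; apply: subsetDl.
- rewrite -setI_eq0 -subset0; apply/subsetP => x; rewrite inE => /andP[xf xf2].
  by move/subsetP: f2X => /(_ x xf2); rewrite !inE xf.
move=> x y xf yf2; move/subsetP: f2X => /(_ y yf2); rewrite in_setD => /andP[yM yX].
have yB := subsetP XB y yX; apply: contraR yM => ncov; rewrite inE; apply/orP; right.
by apply/bigcupP; exists x => //; rewrite in_setD yB andbT inE yB.
Qed.

Lemma no_pair e f : e \in H -> f \in H -> [disjoint e & f] ->
  (forall x y : V, x \in e -> y \in f -> cov H x y) -> False.
Proof. by move=> eH fH d h; have [x [y [xe yf /negP[]]]] := Hf eH fH d; apply: h. Qed.

Lemma N_cov w y : y \in N w -> cov H w y.
Proof. by rewrite inE => /andP[]. Qed.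

Lemma AB a : a \in A -> a \in S /\ a \notin B.
Proof. by move=> aA; rewrite inE aA (subsetP AS). Qed.

Lemma card_N w : w \in S -> (#|B| <= #|N w| + g)%N.
Proof.
move=> wS; have := missB wS; have := cardsID (N w) B.
have -> : B :&: N w = N w by apply/setIidPr/subsetP => y; rewrite inE => /andP[].
lia.
Qed.

Lemma N_big w : w \in S -> (r.+1 * g <= #|N w| + g)%N.
Proof. by move=> wS; apply: leq_trans Bg (card_N wS). Qed.

Lemma N_ge w : w \in S -> (g <= #|N w|)%N.
Proof.
move=> wS; rewrite -(leq_add2r g); apply: leq_trans (N_big wS).
by rewrite addnn -mul2n leq_mul2r; apply/orP; right; lia.
Qed.

(** If f contained a1 and a2 from A, this pair would be covered by v |: f. Disjoint edges a1 |: f1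
    and a2 |: f2 with all other cross pairs covered are then built inside S, contradicting
    [cfree]. *)
Lemma link_one f : f \in L -> (#|f :&: A| <= 1)%N.
Proof.
move=> fL; rewrite leqNgt; apply/negP => /card_gt1P[a1 [a2 [+ + a12]]].
rewrite !inE => /andP[a1f a1A] /andP[a2f a2A].
have [[a1S a1B] [a2S a2B]] := (AB a1A, AB a2A).
have c12 : cov H a1 a2.
  move: fL; rewrite !inE => /andP[/andP[_ fH] _]; apply/covP; exists (v |: f).
  by rewrite !inE a1f a2f !orbT.
have NB w : N w \subset B by apply/subsetP => y; rewrite inE => /andP[].
have [f1 f1N f1H] : exists2 f1 : {set V}, f1 \subset N a2 & a1 |: f1 \in H.
  by apply: dense => //; apply: N_ge.
have f1B := subset_trans f1N (NB _).
have f1S : f1 \subset S by apply: subset_trans f1B _; apply: subsetDl.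
have a1f1 : a1 \notin f1 by apply: contra a1B => /(subsetP f1B).
have f1r : #|f1| = r.-1 by have := Hr f1H; rewrite cardsU1 a1f1 => <-.
have [f2 [f2N f2H d12 c]] : exists f2 : {set V}, [/\ f2 \subset N a1, a2 |: f2 \in H,
  [disjoint f1 & f2] &
   forall x y : V, x \in f1 -> y \in f2 -> cov H x y].
  by apply: edge_in => //; apply: N_big.
have f2B := subset_trans f2N (NB _).
apply: (no_pair f1H f2H).
  rewrite disjoint_setU1 !disjoint_setU1r !inE negb_or a12 d12 !andbT.
  by apply/andP; split; [apply: contra a1B => /(subsetP f2B)|apply: contra a2B => /(subsetP f1B)].
move=> x y; rewrite !in_setU1 => /orP[/eqP->|xf1] /orP[/eqP->|yf2] //.
- by apply/N_cov/(subsetP f2N).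
- by rewrite cov_sym; apply/N_cov/(subsetP f1N).
exact: c.
Qed.

Lemma link_types f : f \in L -> (f \in L0) || (f \in L1).
Proof.
move=> fL; have := link_one fL; rewrite [f \in L1]inE fL /= leq_eqVlt ltnS leqn0 orbC =>
  /orP[|->]; last by rewrite orbT.
rewrite cards_eq0 setI_eq0 => d; rewrite inE fL /= subsetD d andbT.
by move: fL; rewrite inE => /andP[_ ->].
Qed.

Hypothesis many : 
  [/\ (r.+1 * g <= #|N v|)%N & forall Z : {set V}, (#|Z| < g)%N ->
    exists2 f : {set V}, f \in L0 & [disjoint f & Z]]
  \/ [/\ (r.+1 * g <= #|N v|)%N & (r.+1 * g <= #|[set a in A | cov H v a]|)%N].

(** The aim is an edge v |: f with f inside B, and a vertex a of A covered with v and with all of f;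
    [edge_in] then adds an edge at a that violates [cfree]. In the first alternative of [many], a is
    read off f1 and f is chosen to suit it; in the second, f is f0 and a is chosen to suit it. *)
Lemma link_mixed (f0 f1 : {set V}) : f0 \in L0 -> f1 \in L1 -> False.
Proof.
have NB w : N w \subset B by apply/subsetP => y; rewrite inE => /andP[].
move=> f0L f1L; case: many => [[Nv h]|[Nv Av]].
  move: f1L; rewrite 2!inE => /andP[/andP[f1H f1S] /cards1P[a1 f1a]].
  have : a1 \in f1 :&: A by rewrite f1a set11.
  rewrite inE => /andP[a1f a1A]; have [a1S a1B] := AB a1A.
  have [f0' f0'L d0] := h _ (missB a1S).
  move: f0'L; rewrite 2!inE => /andP[/andP[f0'H f0'S] f0'B].
  have f0'r := is_uniform_link Hr f0'H.
  have [f2 [f2N f2H d c]] := edge_in a1A (NB v) f0'S f0'r (leq_trans Nv (leq_addr _ _)).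
  move: f0'H; rewrite inE => /andP[vf0' f0'H].
  apply: (no_pair f0'H f2H).
    rewrite disjoint_setU1 !disjoint_setU1r d andbT !inE negb_or.
    have f2B := subset_trans f2N (NB _).
    have va : v != a1 by apply: contraNneq vS => ->.
    rewrite va /=; apply/andP; split.
      by apply: contra vS => /(subsetP f2B); rewrite inE => /andP[].
    by apply: contra a1B => /(subsetP f0'B).
  have cv : cov H v a1.
    move: f1H; rewrite inE => /andP[_ f1H]; apply/covP; exists (v |: f1).
    by rewrite f1H !inE eqxx a1f orbT.
  move=> x y; rewrite !in_setU1 => /orP[/eqP->|xf1] /orP[/eqP->|yf2] //.
  - by apply/N_cov/(subsetP f2N).
  - rewrite cov_sym; have xB := subsetP f0'B x xf1; apply: contraTT d0 => nc.
    by rewrite -setI_eq0; apply/set0Pn; exists x; rewrite in_setI xf1 in_setD xB inE xB andbT.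
  exact: c.
move: f0L; rewrite 2!inE => /andP[/andP[f0H f0S] f0B].
have f0r := is_uniform_link Hr f0H.
have [a aA ca] : exists2 a, a \in [set a in A | cov H v a] & a \notin \bigcup_(x in f0) (A :\:
  [set a in A | cov H x a]).
  apply: ex_notin; apply: leq_trans Av.
  apply: (@leq_ltn_trans (\sum_(x in f0) g)%N); last by rewrite sum_nat_const f0r splitg -{1}[(_
    * g)%N]addn0 ltn_add2l muln_gt0.
  apply: leq_trans (_ : \sum_(x in f0) #|A :\: [set a in A | cov H x a]| <= _)%N.
    elim/big_rec2: _ => [|x m U _ IH]; first by rewrite cards0.
    by apply: leq_trans (leq_card_setU _ _) _; rewrite leq_add2l.
  by apply: leq_sum => x xf; apply/ltnW/missA/(subsetP f0B).
move: aA; rewrite inE => /andP[aA cva]; have [aS aB] := AB aA.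
have [f2 [f2N f2H d c]] := edge_in aA (NB v) f0S f0r (leq_trans Nv (leq_addr _ _)).
have f2B := subset_trans f2N (NB _).
move: f0H; rewrite inE => /andP[vf0 f0H].
apply: (no_pair f0H f2H).
  rewrite disjoint_setU1 !disjoint_setU1r d andbT !inE negb_or.
  have va : v != a by apply: contraNneq vS => ->.
  rewrite va /=; apply/andP; split.
    by apply: contra vS => /(subsetP f2B); rewrite inE => /andP[].
  by apply: contra aB => /(subsetP f0B).
move=> x y; rewrite !in_setU1 => /orP[/eqP->|xf1] /orP[/eqP->|yf2] //.
- by apply/N_cov/(subsetP f2N).
- apply: contraR ca => nc; apply/bigcupP; exists x => //; by rewrite !inE aA (negbTE nc).
exact: c.
Qed.

(** By [link_types] and [link_mixed], link sets of v are of one kind only: v joins B if none lies in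
    B, and A otherwise. *)
Lemma extend_core : semib H (v |: S).
Proof.
have vA : v \notin A by apply: contra vS => /(subsetP AS).
have lk e : e \in H -> e \subset v |: S -> v \in e -> e :\ v \in L.
  move=> eH eS ve; rewrite inE [_ \in link _ _]inE setD11 setD1K// eH /=.
  by rewrite subDset.
have nv e : e \subset v |: S -> v \notin e -> e \subset S.
  by move=> eS ve; rewrite -(setU1K vS) subsetD1 eS.
have [L0e|[f0 f0L]] := set_0Vmem L0.
  exists A => e eH eS; have [ve|ve] := boolP (v \in e); last exact/HA/nv.
  have fL := lk e eH eS ve; have := link_types fL; rewrite L0e inE /= inE fL /= => /eqP <-.
  by congr #|pred_of_set _|; apply/setP => y; rewrite !inE; case: eqVneq => [->|_];
    rewrite ?(negbTE vA) // andbC.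
exists (v |: A) => e eH eS; have [ve|ve] := boolP (v \in e); last first.
  rewrite setIUl (_ : [set v] :&: e = set0) ?set0U ?HA ?nv//.
  by apply/eqP; rewrite setI_eq0 disjoints1.
have fL := lk e eH eS ve; have := link_types fL => /orP[f0'|f1]; last by case: (link_mixed f0L f1).
move: f0'; rewrite inE => /andP[_]; rewrite subsetD => /andP[_ d].
rewrite -(setD1K ve) -setUIr.
by rewrite (_ : A :&: _ = set0) ?setU0 ?cards1//; apply/eqP; rewrite setIC setI_eq0.
Qed.
End Extend.
End Hypergraph.

(** * Class sizes forced by nearly extremal degrees *)

Section Window.
Variables (R : realType) (m : nat).
Hypothesis m2 : (2 <= m)%N.
Variables (rr q : R).
Hypothesis rE : rr = m.+2%:R.
Hypothesis qE : q = 1 - rr^-1.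

Lemma rr_ge4 : 4 <= rr. Proof. by rewrite rE ler_nat. Qed.

Lemma q_bounds : [/\ 3 / 4 <= q, q < 1 & 36 / 100 < q ^+ m.+1].
Proof.
have r4 := rr_ge4; have r0 : 0 < rr by lra.
split.
- rewrite qE; have : rr^-1 <= 4^-1 by rewrite lef_pV2 ?posrE//.
  lra.
- by rewrite qE ltrBlDr ltrDl invr_gt0.
by rewrite qE rE; apply: le_lt_trans (expRN1_ge R) (star_density_gt R (isT : 2 <= m.+2)%N).
Qed.

Lemma q_pow_ge j : (j <= m.+1)%N -> 36 / 100 < q ^+ j.
Proof.
move=> jm; have [q1 q2 q3] := q_bounds; apply: lt_le_trans q3 _.
by apply: ler_wiXn2l => //; lra.
Qed.

Lemma pow_incr (y d : R) j : 0 <= y -> 0 <= d -> y + d <= 1 -> (y + d) ^+ j <= y ^+ j + j%:R * d.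
Proof.
move=> y0 d0 yd; case: j => [|j]; first by rewrite !expr0 mul0r addr0.
have := @bernoulli R (y + d) y j (addr_ge0 y0 d0) y0.
have : (y + d) ^+ j <= 1 by rewrite exprn_ile1// addr_ge0.
move=> /(ler_wpM2l (mulr_ge0 (ler0n R j.+1) d0)).
rewrite (_ : y - (y + d) = - d); last by ring.
move: (_ ^+ j) (_ ^+ j.+1) (_ ^+ j.+1) (_%:R) => *; lra.
Qed.

Lemma window_lower (be e : R) : 0 <= e -> e <= 1 / 100 / rr ^+ 2 -> 0 <= be ->
  q ^+ m.+1 - e <= be ^+ m.+1 -> q - 3 * rr * e <= be.
Proof.
move=> e0 e1 be0 h1.
have r4 := rr_ge4; have r0 : 0 < rr by lra.
have [q1 q2 q3] := q_bounds.
have qm := q_pow_ge (leqnSn m).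
rewrite leNgt; apply/negP => bq.
have re : 0 <= rr * e by rewrite mulr_ge0// ltW.
have bq' : be <= q by lra.
have : be ^+ m.+1 <= (q - 3 * rr * e) * q ^+ m.
  rewrite exprS; apply: ler_pM => //; [by rewrite exprn_ge0|exact: ltW|].
  by rewrite lerXn2r// nnegrE//; lra.
move=> h; have {}h : q ^+ m.+1 - e <= (q - 3 * rr * e) * q ^+ m by apply: le_trans h.
rewrite exprS in h; have : 3 * rr * e * q ^+ m <= e by lra.
have [e00|e00] := eqVneq e 0.
  have : (q - 3 * rr * e) = q by rewrite e00; ring.
  move=> E; rewrite E in bq; have : be ^+ m.+1 < q ^+ m.+1 by rewrite ltrXn2r// nnegrE//; lra.
  by move: h1; rewrite e00; lra.
have ep : 0 < e by rewrite lt_def e00.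
rewrite (_ : 3 * rr * e * q ^+ m = (3 * rr * q ^+ m) * e); last by ring.
rewrite -[leRHS]mul1r ler_pM2r// => h3.
have : 12 * (36 / 100) <= 3 * rr * q ^+ m by apply: ler_pM; lra.
by lra.
Qed.

(** al and be are the relative sizes of A and B; the two degree hypotheses come from a vertex of A
    and a vertex of B. The first bounds be from below. The second bounds it from above, since al <=
    1 - be and (1 - t) t^m is decreasing at q, its maximum being at m/(m+1) < q. *)
Lemma window (al be e : R) : 0 <= e -> e <= 1 / 100 / rr ^+ 2 -> 0 <= al -> 0 <= be ->
  al + be <= 1 ->
  q ^+ m.+1 - e <= be ^+ m.+1 -> q ^+ m / rr - e <= al * be ^+ m ->
  [/\ q - 3 * rr * e <= be, be <= q + 3 * rr * e & 3 / 10 / rr <= al * be ^+ m].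
Proof.
move=> e0 e1 al0 be0 ab h1 h2.
have r4 := rr_ge4; have r0 : 0 < rr by lra.
have [q1 q2 q3] := q_bounds.
have qm := q_pow_ge (leqnSn m).
have qm1 : 36 / 100 < q ^+ m.-1 by apply: q_pow_ge; apply: leq_trans (leq_pred _) (leqnSn _).
have er : e * rr <= 1 / 400.
  have : e * rr ^+ 2 <= 1 / 100 by rewrite -ler_pdivlMr ?exprn_gt0.
  by rewrite expr2 mulrA => h; have : (e * rr) * 4 <= 1 / 100; [apply: le_trans h;
    rewrite ler_wpM2l// mulr_ge0// ltW|lra].
split.
- exact: window_lower h1.
- have [//|t0] := leP be (q + 3 * rr * e).
  have re : 0 <= rr * e by rewrite mulr_ge0// ltW.
  set t := be - q; have t0' : 3 * rr * e < t by rewrite /t; lra.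
  have tp : 0 <= t by lra.
  have E : be ^+ m = be * be ^+ m.-1 by case: (m) m2 => // j _; rewrite exprS.
  have h3 : be ^+ m.-1 * (be - m%:R * t) <= q ^+ m.
    have q0 : 0 <= q by lra.
    have := @bernoulli R be q m.-1 be0 q0; rewrite prednK; last by apply: leq_trans m2.
    rewrite E /t; move: (be ^+ m.-1) (m%:R : R) => *; lra.
  have b0 : 0 <= be ^+ m.-1 by rewrite exprn_ge0.
  have h4 : al * be <= rr^-1 * (be - m%:R * t) - rr^-1 * t.
    apply: le_trans (_ : (1 - be) * be <= _); first by rewrite ler_wpM2r//; lra.
    have -> : (1 - be) * be = rr^-1 * be - t * be by rewrite /t qE; ring.
    have h : (1 - rr^-1) * t <= be * t by rewrite ler_wpM2r// -qE; lra.
    have -> : m%:R = rr - 2 :> R by rewrite rE -addn2 natrD; ring.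
    have -> : rr^-1 * (be - (rr - 2) * t) - rr^-1 * t = rr^-1 * be - t + rr^-1 * t by field; lra.
    lra.
  have h5 : al * be ^+ m <= rr^-1 * q ^+ m - rr^-1 * t * be ^+ m.-1.
    rewrite E mulrA; apply: le_trans (ler_wpM2r b0 h4) _.
    have ri : 0 <= rr^-1 by rewrite invr_ge0 ltW.
    have := ler_wpM2l ri h3; lra.
  have h6 : q ^+ m.-1 <= be ^+ m.-1 by rewrite lerXn2r// ?nnegrE//; lra.
  have h7 : rr^-1 * t * q ^+ m.-1 <= e.
    have : rr^-1 * t * q ^+ m.-1 <= rr^-1 * t * be ^+ m.-1 by rewrite ler_wpM2l// mulr_ge0//
      invr_ge0 ltW.
    by rewrite [q ^+ m / rr]mulrC in h2; lra.
  have h8 : t * q ^+ m.-1 <= e * rr by rewrite -ler_pdivrMr// mulrC mulrA.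
  have : t * (36 / 100) <= t * q ^+ m.-1 by rewrite ler_wpM2l// ltW.
  lra.
apply: le_trans h2.
rewrite lerBrDr -lerBrDl.
have -> : q ^+ m / rr - 3 / 10 / rr = (q ^+ m - 3 / 10) / rr by ring.
by rewrite ler_pdivlMr//; lra.
Qed.

Lemma window_upper (al be e : R) : 0 <= e -> e <= 1 / 100 / rr ^+ 2 -> 0 <= al -> 0 <= be ->
  al + be <= 1 ->
  q - 3 * rr * e <= be -> be <= q + 3 * rr * e ->
  be ^+ m.+1 <= q ^+ m.+1 + 3 * rr ^+ 2 * e /\ al * be ^+ m <= q ^+ m / rr + 3 * rr ^+ 2 * e.
Proof.
move=> e0 e1 al0 be0 ab b1 b2.
have r4 := rr_ge4; have r0 : 0 < rr by lra.
have [q1 q2 q3] := q_bounds.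
set d := 3 * rr * e in b1 b2.
have er : e * rr ^+ 2 <= 1 / 100 by rewrite -ler_pdivlMr ?exprn_gt0.
have re : 0 <= rr * e by rewrite mulr_ge0// ltW.
have d0 : 0 <= d by rewrite /d; lra.
have dr : d * rr <= 3 / 100 by rewrite (_ : d * rr = 3 * (e * rr ^+ 2)); [lra|rewrite /d; ring].
have rV : rr * rr^-1 = 1 by rewrite divff// gt_eqF.
have qd : q + d <= 1.
  have : (q + d) * rr <= 1 * rr by rewrite qE mulrDl mulrBl mulVf ?gt_eqF//; lra.
  by rewrite ler_pM2r.
have q0 : 0 <= q by lra.
have dE : 3 * rr ^+ 2 * e = rr * d by rewrite /d; ring.
clearbody d.
split.
  apply: le_trans (_ : (q + d) ^+ m.+1 <= _); first by rewrite lerXn2r// ?nnegrE//; lra.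
  apply: le_trans (pow_incr _ _ _ _) _ => //.
  by rewrite lerD2l dE ler_wpM2r// rE ler_nat.
apply: le_trans (_ : (rr^-1 + d) * (q ^+ m + m%:R * d) <= _).
  apply: ler_pM; rewrite ?exprn_ge0//; first by rewrite qE in b1; lra.
  apply: le_trans (_ : (q + d) ^+ m <= _); first by rewrite lerXn2r// ?nnegrE//; lra.
  exact: pow_incr.
have mE : m%:R = rr - 2 :> R by rewrite rE -addn2 natrD; ring.
rewrite mE dE mulrDl !mulrDr.
have qm : q ^+ m <= 1 by rewrite exprn_ile1// ltW.
have h1 : d * q ^+ m <= d by rewrite ler_piMr.
have h2 : rr^-1 * ((rr - 2) * d) <= d.
  have -> : rr^-1 * ((rr - 2) * d) = d - 2 * (rr^-1 * d) by field; lra.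
  by rewrite lerBlDr lerDl mulr_ge0// mulr_ge0// invr_ge0 ltW.
have h3 : d * ((rr - 2) * d) <= d.
  rewrite ler_piMr// mulrBl [rr * d]mulrC; lra.
have h4 : 4 * d <= rr * d by rewrite ler_wpM2r.
by rewrite [rr^-1 * q ^+ m]mulrC; lra.
Qed.

(** Shrinking be to be' lowers the product by at least (be - be') times 3/(10 r), while the degree
    slack only allows e + 3 r^2 e. *)
Lemma miss_right (al be be' e : R) : 0 <= e -> 0 <= al -> 0 <= be' -> be' <= be ->
  al * be ^+ m <= q ^+ m / rr + 3 * rr ^+ 2 * e -> 3 / 10 / rr <= al * be ^+ m -> be <= 1 ->
  q ^+ m / rr - e <= al * be' ^+ m -> be - be' <= 20 * rr ^+ 3 * e.
Proof.
move=> e0 al0 be'0 bb h1 h2 be1 h3.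
have r4 := rr_ge4; have r0 : 0 < rr by lra.
have be0 : 0 <= be by apply: le_trans bb.
have E (y : R) : y ^+ m = y * y ^+ m.-1 by case: (m) m2 => // j _; rewrite exprS.
have P0 : 0 <= be ^+ m.-1 by rewrite exprn_ge0.
have h4 : be' ^+ m <= be' * be ^+ m.-1 by rewrite E ler_wpM2l// lerXn2r// nnegrE.
have h5 : al * be ^+ m <= al * be ^+ m.-1 by rewrite ler_wpM2l// E ler_piMl.
have h6 : (be - be') * (3 / 10 / rr) <= (be - be') * (al * be ^+ m.-1).
  by rewrite ler_wpM2l ?subr_ge0//; apply: le_trans h5.
have h7 := ler_wpM2l al0 h4.
have h8 : (be - be') * (3 / 10 / rr) <= e + 3 * rr ^+ 2 * e.
  by rewrite E in h1; lra.
have h9 : (be - be') * (3 / 10) <= (e + 3 * rr ^+ 2 * e) * rr.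
  by move: h8; rewrite mulrA ler_pdivrMr.
have h10 : e * rr <= rr ^+ 3 * e.
  by rewrite [leRHS]mulrC; apply: ler_wpM2l => //; apply: ler_eXnr => //; lra.
have h11 : 0 <= rr ^+ 3 * e by rewrite mulr_ge0// exprn_ge0// ltW.
have -> : 20 * rr ^+ 3 * e = 20 * (rr ^+ 3 * e) by ring.
rewrite (_ : (e + 3 * rr ^+ 2 * e) * rr = e * rr + 3 * (rr ^+ 3 * e)) in h9; last by ring.
lra.
Qed.

Lemma miss_left (al al' be e : R) : 0 <= e -> 0 <= al' -> al' <= al -> al <= 1 -> 0 <= be ->
  al * be ^+ m <= q ^+ m / rr + 3 * rr ^+ 2 * e -> 3 / 10 / rr <= al * be ^+ m ->
  q ^+ m / rr - e <= al' * be ^+ m -> al - al' <= 20 * rr ^+ 3 * e.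
Proof.
move=> e0 al'0 aa al1 be0 h1 h2 h3.
have r4 := rr_ge4; have r0 : 0 < rr by lra.
have P0 : 0 <= be ^+ m by rewrite exprn_ge0.
have h5 : al * be ^+ m <= be ^+ m by rewrite ler_piMl.
have h6 : (al - al') * (3 / 10 / rr) <= (al - al') * be ^+ m.
  by rewrite ler_wpM2l ?subr_ge0//; apply: le_trans h5.
have h8 : (al - al') * (3 / 10 / rr) <= e + 3 * rr ^+ 2 * e by lra.
have h9 : (al - al') * (3 / 10) <= (e + 3 * rr ^+ 2 * e) * rr.
  by move: h8; rewrite mulrA ler_pdivrMr.
have h10 : e * rr <= rr ^+ 3 * e.
  by rewrite [leRHS]mulrC; apply: ler_wpM2l => //; apply: ler_eXnr => //; lra.
have h11 : 0 <= rr ^+ 3 * e by rewrite mulr_ge0// exprn_ge0// ltW.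
have -> : 20 * rr ^+ 3 * e = 20 * (rr ^+ 3 * e) by ring.
rewrite (_ : (e + 3 * rr ^+ 2 * e) * rr = e * rr + 3 * (rr ^+ 3 * e)) in h9; last by ring.
lra.
Qed.
End Window.

Lemma ffact_ge n k : ((n - k) ^ k <= n ^_ k)%N.
Proof.
elim: k n => [//|k IH] [|n]; first by rewrite sub0n exp0n.
rewrite ffactSS expnS subSS; apply: leq_mul; last exact: IH.
by apply: leq_trans (leq_subr _ _) _.
Qed.

Section Count.
Variable V : finType.
Implicit Types (H L : {set {set V}}) (e f g S A B P Q X : {set V}) (u v w : V).

Lemma card_subsets L X k : (forall f, f \in L -> f \subset X /\ #|f| = k) ->
  (#|L| <= 'C(#|X|, k))%N.
Proof.
move=> h; rewrite -cards_draws; apply: subset_leq_card; apply/subsetP => f /h[fX fk].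
by rewrite inE fX fk eqxx.
Qed.

Lemma card_split L A P Q m : (forall f, f \in L -> [/\ #|f :&: A| = 1%N, f :&: A \subset P,
  f :\: A \subset Q & #|f| = m.+1]) ->
  (#|L| <= #|P| * 'C(#|Q|, m))%N.
Proof.
move=> h; rewrite -[X in (X * _)%N]bin1 -!cards_draws -cardsX.
have inj : {in L &, injective (fun f => (f :&: A, f :\: A))}.
  by move=> f g _ _ [E1 E2]; rewrite -(setID f A) E1 E2 setID.
rewrite -[X in (X <= _)%N](card_in_imset inj) {inj}; apply: subset_leq_card;
  apply/subsetP => _ /imsetP[f fL ->].
have [f1 fP fQ fm] := h f fL; rewrite !inE /= fP fQ f1 /=.
by have := cardsID A f; rewrite f1 fm add1n => -[->].
Qed.

Lemma card_avoid L B X k : (forall f, f \in L -> f \subset B /\ #|f| = k) -> X \subset B ->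
  (forall f, f \in L -> ~~ (f \subset X)) -> (#|L| + 'C(#|X|, k) <= 'C(#|B|, k))%N.
Proof.
move=> h XB hX; rewrite -!cards_draws.
rewrite -cardsUI (_ : _ :&: _ = set0) ?cards0 ?addn0.
  apply: subset_leq_card; apply/subsetP => f; rewrite !inE => /orP[/h[-> ->]|/andP[fX ->]];
    rewrite ?eqxx ?andbT//.
  exact: subset_trans XB.
apply/setP => f; rewrite !inE; apply/negbTE/negP => /and3P[/hX fL fX].
by rewrite fX in fL.
Qed.
End Count.

(** * From degree bounds to the hypotheses of the extension *)

Section Ext.
Variables (R : realType) (m : nat).
Hypothesis m2 : (2 <= m)%N.
Let r := m.+2.
Let q : R := 1 - m.+2%:R^-1.
Variables (gam e : R) (V : finType) (H : {set {set V}}) (S A : {set V}) (v : V) (g : nat).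
Let N : R := #|V|%:R.
Let B := S :\: A.
Let Nb w := [set y in B | cov H w y].
Let Na w := [set y in A | cov H w y].
Let L w := [set f in link w H | f \subset S].
Hypotheses (e0 : 0 <= e) (e1 : e <= 1 / 100 / m.+2%:R ^+ 2).
Hypotheses (N0 : 0 < N) (gN : gam * N < g%:R) (gam0 : 0 < gam) (Ng : 2 * m.+1%:R <= gam * N).
Hypotheses (e2 : e + 3 * m.+2%:R ^+ 2 * e < (gam / 2) ^+ m.+1) (e3 : 20 * m.+2%:R ^+ 3 * e <= gam).
Hypotheses (Hr : is_uniform m.+2 H) (AS : A \subset S).
Hypothesis HA : forall e, e \in H -> e \subset S -> #|A :&: e| = 1%N.
Hypothesis Lbig : forall w, w \in v |: S -> (q ^+ m.+1 - e) * N ^+ m.+1 <= m.+1`!%:R * #|L w|%:R.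

Lemma link_a a f : a \in A -> f \in L a -> f \subset Nb a /\ #|f| = m.+1.
Proof.
move=> aA fL; have : f \in link a H by move: fL; rewrite inE => /andP[].
move=> /(is_uniform_link Hr) fr; split=> //; move: fL; rewrite 2!inE => /andP[/andP[af fH] fS].
have : #|A :&: (a |: f)| = 1%N by apply: HA => //; rewrite subUset sub1set (subsetP AS).
move=> /eqP/cards1P[a' E].
have aE : a' = a by apply/eqP; rewrite eq_sym -in_set1 -E !inE aA eqxx.
rewrite aE in E; apply/subsetP => y yf; rewrite !inE (subsetP fS)// andbT; apply/andP; split.
  apply/negP => yA; have : y \in [set a] by rewrite -E !inE yA yf orbT.
  by rewrite inE => /eqP ya; rewrite -ya yf in af.
by apply/covP; exists (a |: f); rewrite fH !inE eqxx yf orbT.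
Qed.

Lemma link_b b f : b \in B -> f \in L b ->
  [/\ #|f :&: A| = 1%N, f :&: A \subset Na b, f :\: A \subset Nb b & #|f| = m.+1].
Proof.
move=> bB fL; have : f \in link b H by move: fL; rewrite inE => /andP[].
move=> /(is_uniform_link Hr) fr; move: fL; rewrite 2!inE => /andP[/andP[bf fH] fS].
move: bB; rewrite inE => /andP[bA bS].
have : #|A :&: (b |: f)| = 1%N by apply: HA => //; rewrite subUset sub1set bS.
have -> : A :&: (b |: f) = f :&: A.
  by apply/setP => y; rewrite !inE andbC; case: eqVneq => // ->; rewrite (negbTE bA) !andbF.
have cv y : y \in f -> cov H b y.
  by move=> yf; apply/covP; exists (b |: f); rewrite fH !inE eqxx yf orbT.
move=> E; split=> //; apply/subsetP => y; rewrite !inE => /andP[h1 h2].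
  by rewrite h2 cv.
by rewrite h1 (subsetP fS)//= cv.
Qed.

Let bin_le x k : k`!%:R * 'C(x, k)%:R <= x%:R ^+ k :> R.
Proof. by rewrite -natrM mulnC bin_ffact -natrX ler_nat ffact_le_expn. Qed.

Let divX (y : nat) k : (y%:R / N) ^+ k * N ^+ k = y%:R ^+ k.
Proof. by rewrite -exprMn divfK// gt_eqF. Qed.

Let Nk0 k : 0 < N ^+ k. Proof. by rewrite exprn_gt0. Qed.

Lemma dens_a a : a \in A -> q ^+ m.+1 - e <= (#|Nb a|%:R / N) ^+ m.+1.
Proof.
move=> aA; rewrite -(ler_pM2r (Nk0 m.+1)) divX.
apply: le_trans (@Lbig a _) _; first by rewrite inE (subsetP AS) ?orbT.
by apply: le_trans (bin_le _ _); rewrite ler_wpM2l// ler_nat card_subsets// => f; apply: link_a.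
Qed.

Lemma dens_b b : b \in B -> q ^+ m / m.+2%:R - e <= (#|Na b|%:R / N) * (#|Nb b|%:R / N) ^+ m.
Proof.
move=> bB; have bS : b \in v |: S by apply/setU1P; right; move: bB; rewrite inE => /andP[].
have h := Lbig bS.
have h2 : #|L b|%:R <= #|Na b|%:R * 'C(#|Nb b|, m)%:R :> R.
  by rewrite -natrM ler_nat; apply: (@card_split _ _ A) => f; apply: link_b.
have h3 : (q ^+ m.+1 - e) * N ^+ m.+1 <= m.+1%:R * (#|Na b|%:R * #|Nb b|%:R ^+ m).
  apply: le_trans h _; rewrite factS natrM -mulrA; apply: ler_wpM2l => //.
  apply: le_trans (ler_wpM2l (ler0n _ _) h2) _.
  by rewrite mulrCA; apply: ler_wpM2l => //; apply: bin_le.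
rewrite -(ler_pM2r (Nk0 m.+1)) exprS mulrACA divfK ?gt_eqF// divX.
have k0 : 0 < m.+1%:R :> R by rewrite ltr0n.
rewrite -(ler_pM2l k0); apply: le_trans h3; rewrite mulrA -exprS; apply: ler_wpM2r => //;
  first exact: ltW.
have qq : q = m.+1%:R / m.+2%:R.
  by rewrite /q -[m.+1%:R in RHS](addrK 1) natr1 mulrBl divff ?pnatr_eq0// mul1r.
have -> : q ^+ m.+1 = m.+1%:R * (q ^+ m / m.+2%:R) by rewrite exprS {1}qq; ring.
by rewrite mulrBr lerB// ler_peMl// ler1n.
Qed.

Section Facts.
Variables (a0 b0 : V).
Hypotheses (a0A : a0 \in A) (b0B : b0 \in B).
Let al : R := #|A|%:R / N.
Let be : R := #|B|%:R / N.

Let mono (X Y : {set V}) : X \subset Y -> #|X|%:R / N <= #|Y|%:R / N.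
Proof. by move=> XY; rewrite ler_wpM2r ?ler_nat ?subset_leq_card// invr_ge0 ltW. Qed.
Let nn (X : {set V}) : 0 <= #|X|%:R / N.
Proof. by rewrite divr_ge0// ltW. Qed.
Let NbB w : Nb w \subset B. Proof. by apply/subsetP => y; rewrite inE => /andP[]. Qed.
Let NaA w : Na w \subset A. Proof. by apply/subsetP => y; rewrite inE => /andP[]. Qed.

Lemma al_be : al + be <= 1.
Proof.
rewrite /al /be -mulrDl ler_pdivrMr// mul1r -natrD ler_nat.
rewrite -cardsUI (_ : A :&: B = set0) ?cards0 ?addn0 ?max_card//.
by apply/setP => y; rewrite !inE; case: (y \in A).
Qed.

Lemma win : [/\ q - 3 * m.+2%:R * e <= be, be <= q + 3 * m.+2%:R * e & 3 / 10 / m.+2%:R <= al *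
  be ^+ m].
Proof.
apply: (window m2 (erefl _) (erefl _)) => //; [exact: nn|exact: nn|exact: al_be| |].
  by apply: le_trans (dens_a a0A) _; rewrite lerXn2r ?nnegrE ?nn ?mono.
apply: le_trans (dens_b b0B) _; apply: ler_pM; rewrite ?exprn_ge0 ?nn ?mono//.
by rewrite lerXn2r ?nnegrE ?nn ?mono.
Qed.

Lemma upp : be ^+ m.+1 <= q ^+ m.+1 + 3 * m.+2%:R ^+ 2 * e /\ al * be ^+ m <= q ^+ m / m.+2%:R +
  3 * m.+2%:R ^+ 2 * e.
Proof.
have [h1 h2 h3] := win.
by apply: (window_upper m2 (erefl _) (erefl _)) => //; [exact: nn|exact: nn|exact: al_be].
Qed.

(** Otherwise the link of a would omit every (r-1)-subset of X. There are more of these than the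
    slack between the degree of a and its maximum on B. *)
Lemma dense_a a (X : {set V}) : a \in A -> X \subset B -> (g <= #|X|)%N ->
  exists2 f : {set V}, f \subset X & a |: f \in H.
Proof.
move=> aA XB gX; have [/existsP[f /andP[fX fH]]|no] := boolP [exists f : {set V},
  (f \subset X) && (a |: f \in H)].
  by exists f.
exfalso; have h := @card_avoid V (L a) B X m.+1.
have {}h : (#|L a| + 'C(#|X|, m.+1) <= 'C(#|B|, m.+1))%N.
  apply: h => // f fL; first by have [fN fm] := link_a aA fL; split=> //;
    apply: subset_trans fN (NbB a).
  apply: contraNN no => fX; apply/existsP; exists f; rewrite fX.
  by move: fL; rewrite 2!inE => /andP[/andP[]].
have aS : a \in v |: S by rewrite inE (subsetP AS) ?orbT.
have {}h : m.+1`!%:R * #|L a|%:R + m.+1`!%:R * 'C(#|X|, m.+1)%:R <= #|B|%:R ^+ m.+1 :> R.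
  by apply: le_trans (bin_le _ _); rewrite -mulrDr -natrD ler_wpM2l// ler_nat.
have h1 := Lbig aS.
have h2 : (gam / 2) ^+ m.+1 * N ^+ m.+1 <= m.+1`!%:R * 'C(#|X|, m.+1)%:R.
  rewrite -natrM mulnC bin_ffact; apply: le_trans (_ : ((#|X| - m.+1) ^ m.+1)%:R <= _);
    last by rewrite ler_nat ffact_ge.
  rewrite natrX -exprMn.
  have gX' : g%:R <= #|X|%:R :> R by rewrite ler_nat.
  have mm : 0 <= m.+1%:R :> R by [].
  have [hm h3] : m.+1%:R <= #|X|%:R :> R /\ gam * N / 2 <= #|X|%:R - m.+1%:R.
    move: mm Ng gN gX'; move: (gam * N) (m.+1%:R : R) (#|X|%:R : R) (g%:R : R).
    by move=> *; split; lra.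
  have mX : (m.+1 <= #|X|)%N by rewrite -(ler_nat R).
  rewrite mulrAC in h3.
  have g2 : 0 <= gam / 2 * N.
    by apply: mulr_ge0; [apply: divr_ge0 => //; exact: ltW|exact: ltW].
  by rewrite natrB// lerXn2r ?nnegrE//; apply: le_trans h3.
have [h4 _] := upp.
have h5 : #|B|%:R ^+ m.+1 <= (q ^+ m.+1 + 3 * m.+2%:R ^+ 2 * e) * N ^+ m.+1.
  by rewrite -(divX #|B|) ler_wpM2r// ltW.
have : (q ^+ m.+1 - e + (gam / 2) ^+ m.+1) * N ^+ m.+1 <= (q ^+ m.+1 + 3 * m.+2%:R ^+ 2 * e) * N
  ^+ m.+1.
  by rewrite mulrDl; apply: le_trans h5; apply: le_trans h; apply: lerD.
by rewrite ler_pM2r//; move: e2; lra.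
Qed.

Let missR (X Y : {set V}) : X \subset Y -> #|Y|%:R / N - #|X|%:R / N <= 20 * m.+2%:R ^+ 3 * e ->
  (#|Y :\: X| < g)%N.
Proof.
move=> XY h; have := cardsID X Y; rewrite (setIidPr XY) => E.
rewrite -(ltr_nat R); apply: le_lt_trans gN.
have -> : #|Y :\: X|%:R = #|Y|%:R - #|X|%:R :> R by rewrite -E natrD [_ + #|_|%:R]addrC addrK.
by rewrite -ler_pdivrMr// mulrBl; apply: le_trans e3.
Qed.

Lemma missB_lt w : w \in S -> (#|B :\: Nb w| < g)%N.
Proof.
move=> wS; apply: missR; first exact: NbB.
have [w1 w2 w3] := win; have [u1 u2] := upp.
have be1 : be <= 1 by have := al_be; have := nn A; rewrite -/al; lra.
have [wA|wA] := boolP (w \in A); last first.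
  have wB : w \in B by rewrite inE wA wS.
  apply: (@miss_right R m m2 _ q (erefl _) al be (#|Nb w|%:R / N) e e0 (nn A) (nn _) (mono (NbB
    w)) u2 w3 be1).
  apply: le_trans (dens_b wB) _; apply: ler_wpM2r; first by rewrite exprn_ge0.
  exact: mono.
have h := dens_a wA; have hb : #|Nb w|%:R / N <= be by apply: mono.
have r4 : 4 <= m.+2%:R :> R by rewrite ler_nat.
have [q1 q2 q3] := q_bounds m2 (erefl (m.+2%:R : R)) (erefl _).
have lower : q - 3 * m.+2%:R * e <= #|Nb w|%:R / N.
  exact: (window_lower m2 (erefl _) (erefl _) e0 e1 (nn _) h).
rewrite -/be; apply: le_trans (_ : 6 * (m.+2%:R * e) <= _); first by lra.
have : m.+2%:R * e <= m.+2%:R ^+ 3 * e by apply: ler_wpM2r => //; apply: ler_eXnr => //; lra.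
have : 0 <= m.+2%:R * e by rewrite mulr_ge0.
rewrite -[20 * _ * _]mulrA; lra.
Qed.

Lemma missA_lt b : b \in B -> (#|A :\: Na b| < g)%N.
Proof.
move=> bB; apply: missR; first exact: NaA.
have [w1 w2 w3] := win; have [u1 u2] := upp.
have al1 : al <= 1 by have := al_be; have := nn B; rewrite -/be; lra.
apply: (@miss_left R m m2 _ q (erefl _) al (#|Na b|%:R / N) be e e0 (nn _) (mono (NaA b)) al1 (nn
  B) u2 w3).
apply: le_trans (dens_b bB) _; apply: ler_wpM2l; first exact: nn.
by rewrite lerXn2r ?nnegrE ?nn ?mono.
Qed.
End Facts.

Hypotheses (Hf : cfree H) (vS : v \notin S) (S0 : S != set0) (gN2 : g%:R <= 2 * gam * N).
Hypothesis gam1 : 2 * m.+3%:R * gam <= 3 / 20 / m.+1`!%:R.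

Let k0 : 0 < m.+1`!%:R :> R. Proof. by rewrite ltr0n fact_gt0. Qed.
Let r4 : 4 <= m.+2%:R :> R. Proof. by rewrite ler_nat. Qed.

Let q36 : 36 / 100 < q ^+ m.+1.
Proof. by have [] := q_bounds m2 (erefl (m.+2%:R : R)) (erefl _). Qed.

Let e6 : e <= 6 / 100.
Proof.
apply: le_trans e1 _; rewrite ler_pdivrMr ?exprn_gt0//.
have : 1 <= m.+2%:R ^+ 2 :> R by rewrite exprn_ege1// ler1n.
by move: (_ ^+ 2) => X X1; lra.
Qed.

Lemma many_links w : w \in v |: S -> 3 / 10 / m.+1`!%:R * N ^+ m.+1 <= #|L w|%:R.
Proof.
move=> wS; rewrite mulrAC ler_pdivrMr// mulrC [leRHS]mulrC; apply: le_trans (Lbig wS).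
by rewrite mulrC ler_wpM2r ?exprn_ge0 ?ltW//; move: q36 e6; lra.
Qed.

Lemma exists_edge : exists a b, a \in A /\ b \in B.
Proof.
have /set0Pn[w wS] := S0.
have : 0 < #|L w|%:R :> R.
  apply: lt_le_trans (many_links _); first by rewrite !mulr_gt0 ?exprn_gt0 ?invr_gt0.
  by rewrite inE wS orbT.
rewrite ltr0n card_gt0 => /set0Pn[f]; rewrite 2!inE => /andP[/andP[wf fH] fS].
have eS : w |: f \subset S by rewrite subUset sub1set wS.
have /eqP/cards1P[a E] := HA fH eS.
have : a \in A :&: (w |: f) by rewrite E set11.
rewrite inE => /andP[aA ae].
have [b be bA] : exists2 b, b \in w |: f & b \notin A :&: (w |: f).
  by apply: ex_notin; rewrite E cards1 (Hr fH).
exists a, b; split=> //; rewrite inE (subsetP eS)// andbT.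
by apply: contra bA => bA; rewrite inE bA.
Qed.

(** A cover Z of F accounts for at most #|Z| N^m members, so positive density forces Z to have
    linear size; gam is small enough for this to exceed (r + 1) g. *)
Lemma small_family (F : {set {set V}}) (Z : {set V}) : 3 / 20 / m.+1`!%:R * N ^+ m.+1 <= #|F|%:R ->
  is_uniform m.+1 F -> (forall f, f \in F -> f :&: Z != set0) -> (m.+3 * g <= #|Z|)%N.
Proof.
move=> F1 Fu FZ; have := card_meet Fu FZ; rewrite -(ler_nat R) natrM natrX -/N => h.
rewrite -(ler_nat R) natrM.
have {F1}h : 3 / 20 / m.+1`!%:R * N <= #|Z|%:R.
  have Nm : 0 < N ^+ m by rewrite exprn_gt0.
  by rewrite -(ler_pM2r Nm) -[leLHS]mulrA -exprS; apply: le_trans h.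
apply: le_trans h; apply: le_trans (ler_wpM2l (ler0n R m.+3) gN2) _.
rewrite (_ : m.+3%:R * (2 * gam * N) = 2 * m.+3%:R * gam * N); last by ring.
by rewrite ler_wpM2r// ltW.
Qed.

Lemma extend_step : semib H (v |: S).
Proof.
have [a0 [b0 [a0A b0B]]] := exists_edge.
have m3 : (2 < m.+2)%N by rewrite !ltnS ltnW.
have g0 : (0 < g)%N.
  by rewrite -(ltr_nat R); apply: le_lt_trans gN; rewrite mulr_ge0 ?ltW.
have [w1 w2 w3] := win a0A b0B.
have q1 : 3 / 4 <= q by have [] := q_bounds m2 (erefl (m.+2%:R : R)) (erefl _).
have er : 3 * m.+2%:R * e <= 1 / 4.
  have : e * m.+2%:R ^+ 2 <= 1 / 100 by rewrite -ler_pdivlMr ?exprn_gt0.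
  rewrite expr2 mulrA => h; have : e * m.+2%:R * 4 <= 1 / 100.
    by apply: le_trans h; rewrite ler_wpM2l// mulr_ge0.
  by move: (m.+2%:R : R) => M; lra.
have Bg : (m.+3 * g <= #|B|)%N.
  rewrite -(ler_nat R) natrM; apply: le_trans (ler_wpM2l (ler0n R m.+3) gN2) _.
  rewrite (_ : m.+3%:R * (2 * gam * N) = 2 * m.+3%:R * gam * N); last by ring.
  rewrite -ler_pdivlMr//; apply: le_trans gam1 _; apply: le_trans w1.
  apply: le_trans (_ : 3 / 20 <= _); last by lra.
  by rewrite ler_pdivrMr// ler_peMr ?ler1n ?fact_gt0//; lra.
have fu : is_uniform m.+1 (L v).
  by move=> f; rewrite inE => /andP[/(is_uniform_link Hr)].
have covL f y : f \in L v -> y \in f -> cov H v y.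
  rewrite 2!inE => /andP[/andP[_ fH] _] yf; apply/covP; exists (v |: f).
  by rewrite fH !inE eqxx yf orbT.
apply: (@extend_core V m.+2 g H S A v) => //.
- exact: dense_a a0A b0B.
- exact: missB_lt a0A b0B.
- exact: missA_lt a0A b0B.
set L0 := [set f in L v | f \subset B]; set L1 := [set f in L v | #|f :&: A| == 1%N].
have types : L v \subset L0 :|: L1.
  apply/subsetP => f fL; rewrite inE.
  apply: (@link_types V m.+2 g H S A v _ _ _ _ _ _ _ _ _ f) => //.
  - exact: dense_a a0A b0B.
  - exact: missB_lt a0A b0B.
have big := many_links (setU11 v S).
have : 3 / 10 / m.+1`!%:R * N ^+ m.+1 <= #|L0|%:R + #|L1|%:R :> R.
  apply: le_trans big _; rewrite -natrD ler_nat; apply: leq_trans (subset_leq_card types) _.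
  exact: leq_card_setU.
set X := _ * N ^+ m.+1 => hX.
have XE : 3 / 20 / m.+1`!%:R * N ^+ m.+1 = X / 2 by rewrite /X; field; rewrite gt_eqF.
have L0N f : f \in L0 -> f :&: Nb v = f.
  rewrite inE => /andP[fL fB]; apply/setIidPl/subsetP => y yf.
  by rewrite inE (subsetP fB)//= (covL f).
have L0u : is_uniform m.+1 L0 by move=> f; rewrite inE => /andP[/fu].
have L1u : is_uniform m.+1 L1 by move=> f; rewrite inE => /andP[/fu].
(* Whichever of L0 and L1 holds half of the link decides the alternative of [many]: a dense L0 has
   no small cover, and a dense L1 gives v many neighbours on both sides. *)
have [l0|l0] := leP (X / 2) #|L0|%:R; [left|right].
  split.
    apply: (small_family (F := L0)) => //; first by rewrite XE.
    by move=> f fL; rewrite L0N// -card_gt0 (L0u _ fL).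
  move=> Z Zg; have [/exists_inP[f fL fZ]|no] := boolP [exists f in L0, [disjoint f & Z]];
    first by exists f.
  have := small_family (F := L0) (Z := Z) _ L0u; rewrite XE => /(_ l0) h; exfalso.
  have {}h : (m.+3 * g <= #|Z|)%N.
    by apply: h => f fL; apply: contraNneq no => E; apply/exists_inP; exists f;
      rewrite // -setI_eq0 E.
  by have := leq_trans h (ltnW Zg); rewrite leqNgt ltn_Pmull.
have l1 : X / 2 <= #|L1|%:R by move: X hX l0 {XE} => X; move: (#|L0|%:R : R) (#|L1|%:R : R) => *;
  lra.
split; apply: (small_family (F := L1)) => //; rewrite ?XE// => f; rewrite inE => /andP[fL /eqP f1].
  have [y yf yA] : exists2 y, y \in f & y \notin f :&: A.
    by apply: ex_notin; rewrite f1 (fu _ fL).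
  apply/set0Pn; exists y; rewrite !inE yf (covL f)// andbT /=.
  move: yA; rewrite inE yf /= => -> /=; move: fL; rewrite inE => /andP[_ /subsetP]; exact.
have /card_gt0P[y] : (0 < #|f :&: A|)%N by rewrite f1.
rewrite inE => /andP[yf yA]; apply/set0Pn; exists y; by rewrite !inE yf yA (covL f).
Qed.
End Ext.

Lemma semib_extend (R : realType) r : (4 <= r)%N -> exists2 eta : R, 0 < eta & exists n0 : nat,
  forall (V : finType) (H : {set {set V}}) (S : {set V}) (v : V),
    (n0 <= #|V|)%N -> is_uniform r H -> cfree H -> semib H S -> v \notin S ->
    #|~: S|%:R <= eta * #|V|%:R ->
    (forall w, w \in v |: S ->
       ((1 - r%:R^-1) ^+ r.-1 / r.-1`!%:R - eta) * #|V|%:R ^+ r.-1 <= #|link w H|%:R) ->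
    semib H (v |: S).
Proof.
case: r => [|[|m]]// m4; have m2 : (2 <= m)%N by [].
have r4 : 4 <= m.+2%:R :> R by rewrite ler_nat.
have f0 : 0 < m.+1`!%:R :> R by rewrite ltr0n fact_gt0.
have f30 : 1 <= m.+3`!%:R :> R by rewrite ler1n fact_gt0.
(* Small enough for (r + 1) g, with g about gam N, to stay below the linear sizes forced by link
   density 3/20 / (r-1)!. *)
pose gam : R := (24 * m.+3`!%:R)^-1.
have gam0 : 0 < gam by rewrite invr_gt0 mulr_gt0// ltr0n fact_gt0.
have gamle : gam <= 1 / 24.
  rewrite /gam mul1r lef_pV2 ?posrE// ?mulr_gt0// ?ltr0n ?fact_gt0//.
  by rewrite ler_peMr.
have gam1 : 2 * m.+3%:R * gam <= 3 / 20 / m.+1`!%:R.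
  rewrite ler_pdivlMr// /gam (factS m.+2) (factS m.+1) 2!natrM; move: f0 r4.
  have : 0 < m.+3%:R :> R by rewrite ltr0n.
  move: (m.+3%:R : R) (m.+2%:R : R) (m.+1`!%:R : R) => a b f a0 f0' b4.
   rewrite (_ : 2 * a * (24 * (a * (b * f)))^-1 * f = (12 * b)^-1); last by field;
     rewrite !gt_eqF//; lra.
  apply: le_trans (_ : 48^-1 <= _); last by lra.
  by rewrite lef_pV2 ?posrE//; lra.
clearbody gam.
have [P PE] : exists P : R, P = (gam / 2) ^+ m.+1 by eexists.
have P0 : 0 < P by rewrite PE exprn_gt0// divr_gt0.
have Pg : P <= gam / 2.
  have [g2 g2'] : 0 <= gam / 2 /\ gam / 2 <= 1 by split; lra.
  by rewrite PE exprS ler_piMr// exprn_ile1.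
(* The slack e must be small against (gam/2)^(r-1), so that [dense_a] works, and r^3 e against gam,
   so that fewer than g neighbours are missing. *)
have [e eE] : exists e : R, e = P / (100 * m.+2%:R ^+ 3) by eexists.
have r3 : 0 < m.+2%:R ^+ 3 :> R by rewrite exprn_gt0.
have r2 : 0 < m.+2%:R ^+ 2 :> R by rewrite exprn_gt0.
have eP : m.+2%:R ^+ 3 * e = P / 100.
  by rewrite eE; move: r3; move: (m.+2%:R ^+ 3) => a a0; field; rewrite gt_eqF.
have e0 : 0 < e by rewrite eE divr_gt0// mulr_gt0.
have r23 : m.+2%:R ^+ 2 * 4 <= m.+2%:R ^+ 3 :> R by rewrite [leRHS]exprSr ler_wpM2l// ltW.
have eP2 : 4 * (m.+2%:R ^+ 2 * e) <= P / 100.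
  by rewrite -eP mulrA ler_wpM2r ?(ltW e0)// mulrC.
have r2g : 1 <= m.+2%:R ^+ 2 :> R by rewrite exprn_ege1// ler1n.
have er2 : e <= m.+2%:R ^+ 2 * e by rewrite ler_peMl// ltW.
have e1 : e <= 1 / 100 / m.+2%:R ^+ 2.
  by rewrite ler_pdivlMr// mulrC; lra.
have e2 : e + 3 * m.+2%:R ^+ 2 * e < P by rewrite -mulrA; lra.
have e3 : 20 * m.+2%:R ^+ 3 * e <= gam by rewrite -mulrA eP; lra.
(* The factor 2 is there because eta is spent twice: on the degree hypothesis and on the link sets
   that leave S. *)
have [eta etaE'] : exists eta : R, eta = e / (2 * m.+1`!%:R) by eexists.
have f1 : 1 <= m.+1`!%:R :> R by rewrite ler1n fact_gt0.
have eta0 : 0 < eta by rewrite etaE' divr_gt0// mulr_gt0.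
have etaE : m.+1`!%:R * (2 * eta) = e.
  by rewrite etaE'; move: f0; move: (m.+1`!%:R : R) => f f0; field; rewrite gt_eqF.
have eta1 : eta < 1.
  have h : 2 * eta <= m.+1`!%:R * (2 * eta) by rewrite ler_peMl// mulr_ge0// ltW.
  by move: h; rewrite etaE; lra.
exists eta => //; exists (Num.truncn (2 * m.+1%:R / gam)).+1.
move=> V H S v nV Hr Hf [A0 HA0] vS Sb deg.
pose N : R := #|V|%:R.
have Ng : 2 * m.+1%:R <= gam * N.
  rewrite [gam * N]mulrC -ler_pdivrMr//; apply: ltW; apply: lt_le_trans (truncnS_gt _) _.
  by rewrite ler_nat.
have N0 : 0 < N.
  have : 0 < gam * N by apply: lt_le_trans Ng; rewrite mulr_gt0.
  by rewrite pmulr_rgt0.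
have gN1 : 1 <= gam * N.
  apply: le_trans Ng; apply: le_trans (_ : 2 * 1 <= _); first lra.
  by rewrite ler_wpM2l// ler1n.
pose g := (Num.truncn (gam * N)).+1.
have gN : gam * N < g%:R by apply: truncnS_gt.
have gN2 : g%:R <= 2 * gam * N.
  rewrite /g -natr1 -mulrA; have : (Num.truncn (gam * N))%:R <= gam * N by rewrite truncn_le; lra.
  lra.
have S0 : S != set0.
  apply/negP => /eqP E; move: Sb; rewrite E setC0 cardsT -[X in X <= _]mul1r ler_pM2r//; lra.
pose A := A0 :&: S.
apply: (@extend_step R m m2 gam e V H S A v g) => //.
- exact: ltW.
- by rewrite -PE.
- exact: subsetIr.
- move=> f fH fS; rewrite -(HA0 f fH fS); congr #|pred_of_set _|.
  by rewrite /A -setIA (setIidPr fS).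
move=> w /deg; rewrite [_.-1]/= => dw.
have := link_loss w S Hr; rewrite -(ler_nat R) natrD natrM natrX [_.-2]/= -/N => ll.
have hS : #|~: S|%:R * N ^+ m <= eta * N ^+ m.+1.
  by rewrite exprS mulrA ler_wpM2r// exprn_ge0// ltW.
set Q := (1 - m.+2%:R^-1) ^+ m.+1 in dw *.
have : (Q / m.+1`!%:R - 2 * eta) * N ^+ m.+1 <= #|[set f in link w H | f \subset S]|%:R.
  move: dw ll hS; rewrite -/N !mulrBl -mulrA; move: (N ^+ m.+1) (N ^+ m) (Q / m.+1`!%:R) => X Y Z.
  by move: (#|link w H|%:R : R) (#|~: S|%:R * Y : R) (#|[set f in link w H | f \subset S]|%:R :
    R) => *; lra.
move=> /(ler_wpM2l (ltW f0)); rewrite mulrA mulrBr etaE.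
by rewrite [_ * (Q / _)]mulrC divfK ?gt_eqF.
Qed.

(** * Symmetrization *)

Section Clone.
Variable V : finType.
Implicit Types (H : {set {set V}}) (e f g S A : {set V}) (a b u v w x y : V).

Lemma card_link_split H u : #|H| = (#|[set e in H | u \notin e]| + #|link u H|)%N.
Proof.
rewrite link_degree -(cardsID [set e : {set V} | u \in e]) addnC; congr (_ + _)%N;
  apply: eq_card => e; rewrite !inE.
  by rewrite andbC.
by [].
Qed.

Definition clone_map u v x := if x == u then v else x.

(* The vertex u is replaced by a copy of v. *)
Definition clone H u v : {set {set V}} :=
  [set e : {set V} | (clone_map u v @: e \in H) && ~~ ((u \in e) && (v \in e))].

Section Clone1.
Variables (H : {set {set V}}) (u v : V).
Hypothesis uv : u != v.
Let phi := clone_map u v.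
Let H' := clone H u v.

Lemma clone_map_eq x y : phi x = phi y -> x = y \/ [\/ x = u /\ y = v | x = v /\ y = u].
Proof.
rewrite /phi /clone_map; case: (eqVneq x u) => [->|xu]; case: (eqVneq y u) => [->|yu].
- by left.
- by move=> <-; right; left.
- by move=> ->; right; right.
by left.
Qed.

Lemma clone_inj e : ~~ ((u \in e) && (v \in e)) -> {in e &, injective phi}.
Proof.
move=> ne x y xe ye /clone_map_eq[//|[[xu yv]|[xv yu]]]; case/negP: ne.
  by rewrite -xu -yv xe ye.
by rewrite -xv -yu xe ye.
Qed.

Lemma clone_avoid e : u \notin e -> phi @: e = e.
Proof.
move=> ue; rewrite -[RHS]imset_id; apply: eq_in_imset => x xe; rewrite /phi /clone_map.
by case: eqVneq => // xu; rewrite xu (negbTE ue) in xe.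
Qed.

Lemma clone_old e : u \notin e -> (e \in H') = (e \in H).
Proof. by move=> ue; rewrite inE (clone_avoid ue) (negbTE ue) andbT. Qed.

Lemma clone_uniform r : is_uniform r H -> is_uniform r H'.
Proof. by move=> Hr e; rewrite inE => /andP[eH /clone_inj/card_in_imset <-]; apply: Hr. Qed.

Lemma clone_cov x y : cov H' x y -> cov H (phi x) (phi y).
Proof.
case/covP => e [+ xe ye]; rewrite inE => /andP[eH _].
by apply/covP; exists (phi @: e); rewrite eH !imset_f.
Qed.

Lemma clone_uncov : ~~ cov H' u v.
Proof. by apply/negP => /covP[e []]; rewrite inE => /andP[_ /negP h] ue ve; apply: h;
  rewrite ue ve. Qed.

(** If the images of e and f are disjoint, an uncovered pair of H pulls back. Otherwise one of e, f
    contains u and the other v, and the clone never covers this pair. *)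
Lemma clone_cfree : cfree H -> cfree H'.
Proof.
move=> Hf e f eH' fH' d.
have := eH'; rewrite inE => /andP[eH ne]; have := fH'; rewrite inE => /andP[fH nf].
have [dd|] := boolP [disjoint phi @: e & phi @: f].
  have [_ [_ [/imsetP[x xe ->] /imsetP[y yf ->] nc]]] := Hf _ _ eH fH dd.
  by exists x, y; split=> //; apply: contra nc; apply: clone_cov.
rewrite -setI_eq0 => /set0Pn[z]; rewrite inE => /andP[/imsetP[x xe ->] /imsetP[y yf E]].
have xy : x != y.
  by apply: contraTneq d => xy; rewrite -setI_eq0; apply/set0Pn; exists x; rewrite inE xe xy.
case: (clone_map_eq E) => [xy'|[[xu yv]|[xv yu]]]; first by rewrite xy' eqxx in xy.
  by exists x, y; split=> //; rewrite xu yv clone_uncov.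
by exists x, y; split=> //; rewrite xv yu cov_sym clone_uncov.
Qed.

Hypothesis nc : ~~ cov H u v.

Lemma uncov_link : u \in \bigcup_(f in link v H) f = false.
Proof.
apply/negbTE/negP => /bigcupP[f]; rewrite inE => /andP[vf fH] uf; case/negP: nc.
by apply/covP; exists (v |: f); rewrite fH !inE eqxx uf orbT.
Qed.

Lemma link_u_notin f : f \in link v H -> u \notin f.
Proof. by move=> fL; apply/negP => uf; have := uncov_link; rewrite (introT bigcupP)//;
  exists f. Qed.

Lemma clone_link_u : link u H' = link v H.
Proof.
apply/setP => f; rewrite [LHS]inE; have [uf|uf] /= := boolP (u \in f).
  by symmetry; apply/negP => /link_u_notin; rewrite uf.
rewrite inE imsetU1 -/phi (clone_avoid uf) {1}/phi /clone_map eqxx in_setU1 eqxx /= in_setU1 [v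
  == u]eq_sym (negbTE uv) /=.
by rewrite [RHS]inE andbC.
Qed.

Lemma clone_link_v : link v H' = link v H.
Proof.
apply/setP => f; rewrite [LHS]inE [RHS]inE; case: (boolP (v \in f)) => //= vf.
have [uf|uf] := boolP (u \in f); last by rewrite clone_old// !inE negb_or uv.
rewrite inE in_setU1 uf orbT setU11 andbF; symmetry; apply/negP => fH.
by have := @link_u_notin f; rewrite inE vf fH uf => /(_ isT).
Qed.

Lemma clone_card : (#|H'| + #|link u H| = #|H| + #|link v H|)%N.
Proof.
rewrite (card_link_split H u) (card_link_split H' u) clone_link_u addnAC; congr (_ + _ + _)%N.
by apply: eq_card => e; rewrite !inE; case: (boolP (u \in e)) => ue;
  rewrite ?andbF// (clone_avoid ue) !andbT.
Qed.
End Clone1.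

Lemma twin_uncov H a b : a != b -> link a H = link b H -> ~~ cov H a b.
Proof.
move=> ab E; apply/negP => /covP[e [eH ae be]].
have : e :\ a \in link a H by rewrite inE setD11 setD1K.
by rewrite E inE !inE eq_sym ab be.
Qed.

Lemma twin_clone_sub H u v a b : u != v -> a != u -> b != u -> link a H = link b H ->
  link a (clone H u v) \subset link b (clone H u v).
Proof.
move=> uv au bu E; have [->//|ab] := eqVneq a b.
have nab := twin_uncov ab E.
have ida : clone_map u v a = a by rewrite /clone_map (negbTE au).
have idb : clone_map u v b = b by rewrite /clone_map (negbTE bu).
apply/subsetP => f; rewrite inE => /andP[af afH]; have afH' := afH.
move: afH; rewrite inE imsetU1 ida => /andP[afH nuv].
have bf : b \notin f.
  apply/negP => bf; case/negP: (nab); rewrite -ida -idb; apply: (@clone_cov H u v).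
  by apply/covP; exists (a |: f); rewrite afH' !inE eqxx bf orbT.
have aphi : a \notin clone_map u v @: f.
  apply/negP => /imsetP[x xf]; rewrite /clone_map; case: eqVneq => [xu av|_ ax].
    by case/negP: nuv; rewrite !inE -av eqxx -xu xf orbT.
  by rewrite ax xf in af.
have : clone_map u v @: f \in link a H by rewrite inE aphi.
rewrite E inE => /andP[bphi bfH].
rewrite inE bf inE imsetU1 idb bfH /=.
apply: contra nuv; rewrite !inE [u == b]eq_sym (negbTE bu) [u == a]eq_sym (negbTE au) /= =>
  /andP[uf /orP[/eqP vb|->]].
  case/negP: bphi; apply/imsetP; exists u => //; by rewrite /clone_map eqxx vb.
by rewrite uf orbT.
Qed.

Lemma twin_clone H u v a b : u != v -> a != u -> b != u -> link a H = link b H ->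
  link a (clone H u v) = link b (clone H u v).
Proof. by move=> uv au bu E; apply/eqP; rewrite eqEsubset !twin_clone_sub. Qed.

Definition twins H := [set p : V * V | link p.1 H == link p.2 H].
Definition twin_class H u := [set w | link w H == link u H].

(** Twin pairs without u survive. The pairs with u number fewer than twice the class of u before, as
    (u, u) is counted on both sides, and at least twice the class of v after, when u joins that
    class. *)
Lemma twins_clone H u v : u != v -> ~~ cov H u v -> link u H != link v H ->
  (#|twin_class H u| <= #|twin_class H v|)%N -> (#|twins H| < #|twins (clone H u v)|)%N.
Proof.
move=> uv nc luv le; pose D := [set p : V * V | (p.1 != u) && (p.2 != u)].
pose H' := clone H u v.
rewrite -(cardsID D (twins H)) -(cardsID D (twins H')).
have hD : (#|twins H :&: D| <= #|twins H' :&: D|)%N.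
  apply: subset_leq_card; apply/subsetP => -[a b]; rewrite !inE /= => /andP[/eqP E /andP[au bu]].
  by rewrite au bu !andbT; apply/eqP/twin_clone.
have h1 : (#|twins H :\: D| < 2 * #|twin_class H u|)%N.
  have -> : (2 * #|twin_class H u| = #|setX [set u] (twin_class H u)| + #|setX (twin_class H u)
    [set u]|)%N.
    by rewrite !cardsX cards1 mul1n muln1 mul2n addnn.
  rewrite -cardsUI -[X in (X < _)%N]addn0 -addnS; apply: leq_add.
    apply: subset_leq_card; apply/subsetP => -[a b]; rewrite !inE /= negb_and !negbK =>
      /andP[/orP[/eqP->|/eqP->] /eqP E].
      by rewrite eqxx E eqxx.
    by rewrite E !eqxx orbT.
  by rewrite card_gt0; apply/set0Pn; exists (u, u); rewrite !inE !eqxx.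
have h2 : (2 * #|twin_class H v| <= #|twins H' :\: D|)%N.
  have vu : v != u by rewrite eq_sym.
  have tv w : w \in twin_class H v -> w != u /\ link w H' = link u H'.
    rewrite inE => /eqP E; have wu : w != u by apply: contraNneq luv => <-; rewrite E.
    by split=> //; rewrite /H' (twin_clone uv wu vu E) clone_link_v// clone_link_u.
  have -> : (2 * #|twin_class H v| = #|setX [set u] (twin_class H v)| + #|setX (twin_class H v)
    [set u]|)%N.
    by rewrite !cardsX cards1 mul1n muln1 mul2n addnn.
  rewrite -cardsUI [X in (_ + X)%N](_ : _ = 0%N) ?addn0.
    apply: subset_leq_card; apply/subsetP => -[a b]; rewrite in_setU !in_setX !in_set1 =>
      /orP[/andP[/eqP-> /tv[bu E]]|/andP[/tv[au E] /eqP->]].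
      by rewrite !inE /= eqxx E eqxx.
    by rewrite !inE /= eqxx E eqxx andbF.
  apply/eqP; rewrite cards_eq0; apply/eqP/setP => -[a b]; rewrite in_setI !in_setX !in_set1 in_set0.
  by apply/negbTE/negP => /andP[/andP[/eqP-> _] /andP[/tv[]]]; rewrite eqxx.
by rewrite -addnS; apply: leq_add => //; apply: leq_trans h1 _; apply: leq_trans h2;
  rewrite leq_mul2l.
Qed.

(* Cloning towards the larger degree gains edges; at equal degrees, cloning towards the larger
   twin class gains twin pairs. *)
Lemma sym_ind (R : numDomainType) (r : nat) (E : R) (P : {set {set V}} -> Prop) :
  (forall H, is_uniform r H -> cfree H -> E <= #|H|%:R ->
     (forall u v, u != v -> ~~ cov H u v -> link u H = link v H) -> P H) ->
  (forall H u v, is_uniform r H -> cfree H -> E <= #|H|%:R -> u != v ->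
     E <= #|clone H u v|%:R -> P (clone H u v) -> P H) ->
  forall H, is_uniform r H -> cfree H -> E <= #|H|%:R -> P H.
Proof.
move=> base step H.
pose big := #|{: {set V}}|; pose n2 := #|{: V * V}|.
(* A lexicographic measure: the twin deficit is below n2 + 1, so one more edge outweighs any loss of
   twin pairs. *)
pose mu H := ((big - #|H|) * n2.+1 + (n2 - #|twins H|))%N.
have [k] := ubnP (mu H); elim: k H => // k IH H; rewrite ltnS => Hk Hr Hf HE.
have [/existsP[u /existsP[v /and3P[uv nc luv]]]|no] :=
  boolP [exists u, [exists v, [&& u != v, ~~ cov H u v & link u H != link v H]]]; last first.
  apply: base => // u v uv nc; apply/eqP; apply: contraNT no => luv.
  by apply/existsP; exists u; apply/existsP; exists v; rewrite uv nc luv.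
have mx (G : {set {set V}}) : (#|G| <= big)%N by apply: max_card.
have mt (G : {set {set V}}) : (#|twins G| <= n2)%N by apply: max_card.
have [u' [v' [uv' nc' lt]]] : exists u' v', [/\ u' != v', ~~ cov H u' v' &
   (#|H| < #|clone H u' v'|)%N || ((#|H| == #|clone H u' v'|) && (#|twins H| < #|twins (clone H
     u' v')|)%N)].
  have vu : v != u by rewrite eq_sym.
  have ncv : ~~ cov H v u by rewrite cov_sym.
  have c1 := clone_card uv nc; have c2 := clone_card vu ncv.
  have [d|d|d] := ltngtP #|link u H| #|link v H|.
  - by exists u, v; split=> //; apply/orP; left; lia.
  - by exists v, u; split=> //; apply/orP; left; lia.
  have [c|c] := leqP #|twin_class H u| #|twin_class H v|.
    exists u, v; split=> //; apply/orP; right; rewrite twins_clone// andbT; apply/eqP; lia.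
  exists v, u; split=> //; apply/orP; right; rewrite twins_clone// 1?eq_sym//; last exact: ltnW.
  by rewrite andbT; apply/eqP; lia.
have HE' : E <= #|clone H u' v'|%:R.
  by apply: le_trans HE _; rewrite ler_nat; case/orP: lt => [/ltnW//|/andP[/eqP->//]].
apply: (step H u' v') => //; apply: IH => //.
- apply: leq_trans Hk; rewrite /mu; case/orP: lt => [lt|/andP[/eqP eq lt]].
    have h : (big - #|H| = (big - #|clone H u' v'| + (#|clone H u' v'| - #|H|)))%N.
      by have := mx (clone H u' v'); lia.
    rewrite h mulnDl -addnA ltn_add2l.
    apply: leq_trans (_ : n2.+1 <= _)%N; first by rewrite ltnS leq_subr.
    by apply: leq_trans (leq_addr _ _); rewrite leq_pmull// subn_gt0.
  rewrite eq ltn_add2l; have := mt (clone H u' v'); lia.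
- exact: clone_uniform.
- exact: clone_cfree.
Qed.
End Clone.

(** * Collapsing twin classes *)

Section Blowup.
Variables (V C : finType) (kap : V -> C).

Lemma card_transversals (t : {set C}) (F : {set {set V}}) :
  (forall e, e \in F -> kap @: e = t /\ {in e &, injective kap}) ->
  (#|F| <= \prod_(c in t) #|[set w | kap w == c]|)%N.
Proof.
move=> h; have [->|[e0 e0F]] := set_0Vmem F; first by rewrite cards0.
have [V0|[w0 _]] := set_0Vmem [set: V].
  have e00 : e0 = set0 by apply/setP => y; have := in_setT y; rewrite V0 !inE.
  have [<- _] := h _ e0F; rewrite e00 imset0 big_set0 -(cards1 (set0 : {set V}));
    apply: subset_leq_card.
  by apply/subsetP => e _; rewrite inE; apply/eqP/setP => y; have := in_setT y; rewrite V0 !inE.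
pose cls (c : C) := [set w | kap w == c].
rewrite (_ : (\prod_(c in t) _ = #|pfamily w0 (mem t) (fun c => mem (cls c))|)%N); last first.
  rewrite card_pfamily foldrE big_map big_enum /=; apply: eq_bigr => c _.
  by apply: eq_card => w; rewrite !inE.
apply: leq_trans (leq_imset_card (fun f : {ffun C -> V} => f @: t) _).
apply: subset_leq_card; apply/subsetP => e eF; have [et inj] := h e eF.
pose f := [ffun c => if c \in t then odflt w0 [pick w in e | kap w == c] else w0].
have fP c : c \in t -> f c \in e /\ kap (f c) = c.
  move=> ct; rewrite ffunE ct; case: pickP => [w /andP[we /eqP wc]//|no].
  by move: ct; rewrite -et => /imsetP[w we cw]; have := no w; rewrite /= we cw eqxx.
apply/imsetP; exists f.
  apply/pfamilyP; split=> [|c ct]; last by have [_ E] := fP c ct; rewrite !inE E.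
  by apply/supportP => c ct; rewrite ffunE (negbTE ct).
apply/setP => w; apply/idP/imsetP => [we|[c ct ->]]; last by have [] := fP c ct.
have kt : kap w \in t by rewrite -et imset_f.
by exists (kap w) => //; have [fe kf] := fP _ kt; apply: inj.
Qed.
End Blowup.

Lemma sym_base (R : realType) (r : nat) (eps : R)
  (nonstar : forall (C : finType) (x : C -> R) (T : {set {set C}}), (forall i, 0 <= x i) ->
    wt x setT = 1 ->
    is_uniform r T -> intersecting T -> (forall i, exists2 e, e \in T & i \notin e) ->
    r`!%:R * lam x T <= (1 - r%:R^-1) ^+ r.-1 - eps)
  (V : finType) (H : {set {set V}}) : (0 < #|V|)%N -> is_uniform r H -> cfree H ->
  (forall u v, u != v -> ~~ cov H u v -> link u H = link v H) ->
  ((1 - r%:R^-1) ^+ r.-1 - eps) * #|V|%:R ^+ r < r`!%:R * #|H|%:R -> semib H setT.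
Proof.
(* The colour of a vertex is its link: by [tw] uncovered vertices share a colour, while two vertices
   of one edge never do. *)
move=> V0 Hr Hf tw big; pose kap w := link w H.
have inj e : e \in H -> {in e &, injective kap}.
  move=> eH a b ae be E; apply/eqP/negPn/negP => ab.
  by have /negP := twin_uncov ab E; apply; apply/covP; exists e.
pose T : {set {set {set {set V}}}} := [set kap @: e | e : {set V} in H].
have n0 : 0 < #|V|%:R :> R by rewrite ltr0n.
pose cls (c : {set {set V}}) := [set w | kap w == c].
pose x (c : {set {set V}}) : R := #|cls c|%:R / #|V|%:R.
have [/existsP[c /forall_inP cT]|no] := boolP [exists c, [forall t in T, c \in t]].
  exists (cls c) => e eH _; have : c \in kap @: e by apply: cT; apply/imsetP; exists e.
  case/imsetP => w we cw; apply/eqP/cards1P; exists w; apply/setP => y; rewrite !inE.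
  apply/andP/eqP => [[/eqP yc ye]|->]; last by rewrite we -cw.
  by apply: (inj e eH) => //; rewrite yc.
exfalso; have x0 c : 0 <= x c by rewrite divr_ge0// ltW.
have w1 : wt x setT = 1.
  rewrite /wt -big_distrl /= -natr_sum.
  rewrite (_ : (\sum_(c in setT) #|cls c|)%N = #|V|) ?divff ?gt_eqF//.
  rewrite -[RHS]sum1_card (partition_big kap (mem setT)) //=; apply: eq_bigr => c _.
  by rewrite -sum1_card; apply: eq_bigl => w; rewrite inE.
have Tr : is_uniform r T.
  by move=> _ /imsetP[e eH ->]; rewrite card_in_imset ?(Hr e)//; apply: inj.
(* Disjoint colour sets would come from disjoint edges; [cfree] gives these an uncovered cross pair,
   which has a single colour. *)
have Ti : intersecting T.
  move=> _ _ /imsetP[e eH ->] /imsetP[f fH ->]; apply/negP => /eqP E.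
  have ne a b : a \in e -> b \in f -> kap a != kap b.
    move=> ae bf; apply/eqP => ab; have : kap a \in set0 by rewrite -E inE imset_f// ab imset_f.
    by rewrite inE.
  have d : [disjoint e & f].
    rewrite -setI_eq0; apply/eqP/setP => a; rewrite !inE; apply/negbTE/negP => /andP[ae af].
    by have := ne a a ae af; rewrite eqxx.
  have [a [b [ae bf nc]]] := Hf e f eH fH d.
  by have /eqP := ne a b ae bf; apply; apply: tw => //; apply: contraNneq (ne a b ae bf) => ->.
have Tn c : exists2 t, t \in T & c \notin t.
  have : ~~ [forall t in T, c \in t] by apply: contra no => h; apply/existsP; exists c.
  by rewrite negb_forall_in => /exists_inP[t tT ct]; exists t.
have hA := nonstar _ x T x0 w1 Tr Ti Tn.
have hN : (#|H| <= \sum_(t in T) \prod_(c in t) #|cls c|)%N.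
  rewrite -sum1_card (partition_big_imset (fun e : {set V} => kap @: e)) /=.
  apply: leq_sum => t _; rewrite sum1dep_card; apply: card_transversals => e.
  by rewrite inE => /andP[eH /eqP <-]; split=> //; apply: inj.
have hL : #|H|%:R <= lam x T * #|V|%:R ^+ r.
  apply: le_trans (_ : (\sum_(t in T) \prod_(c in t) #|cls c|)%N%:R <= _); first by rewrite ler_nat.
  rewrite /lam natr_sum big_distrl /=; apply: ler_sum => t tT.
  rewrite natr_prod -(Tr t tT) -prodr_const -big_split /= le_eqVlt; apply/orP; left; apply/eqP.
  by apply: eq_bigr => c _; rewrite /x divfK ?gt_eqF.
have f0 : 0 <= r`!%:R :> R by [].
have := ler_wpM2l f0 hL; rewrite mulrA => h.
have := lt_le_trans big h; rewrite ltr_pM2r ?exprn_gt0// ltNge hA.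
by [].
Qed.

(** * Few vertices of low degree *)

Lemma pow_upper (R : realFieldType) (w : R) j : 0 <= w -> w <= 1 ->
  (1 - w) ^+ j <= 1 - j%:R * w + j%:R ^+ 2 / 2 * w ^+ 2.
Proof.
move=> w0 w1; elim: j => [|j IH]; first by rewrite expr0 mul0r expr0n /= !mul0r subr0 addr0.
have w1' : 0 <= 1 - w by rewrite subr_ge0.
rewrite exprS; apply: le_trans (ler_wpM2l w1' IH) _.
rewrite -[j.+1%:R]natr1 -subr_ge0; have j0 : 0 <= j%:R :> R by [].
move: (j%:R : R) j0 => J J0.
rewrite (_ : _ - _ = w ^+ 2 / 2 + J ^+ 2 / 2 * w ^+ 3); last by field.
by apply: addr_ge0; [rewrite divr_ge0 ?exprn_ge0|rewrite mulr_ge0 ?exprn_ge0// divr_ge0 ?exprn_ge0].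
Qed.

Lemma subset_of_card (V : finType) (A : {set V}) k : (k <= #|A|)%N ->
  exists2 B : {set V}, B \subset A & #|B| = k.
Proof.
move=> kA; have : (0 < 'C(#|A|, k))%N by rewrite bin_gt0.
by rewrite -cards_draws card_gt0 => /set0Pn[B]; rewrite inE => /andP[BA /eqP Bk]; exists B.
Qed.

Lemma handshake (V : finType) (r : nat) (H : {set {set V}}) : is_uniform r H ->
  (\sum_v #|link v H| = r * #|H|)%N.
Proof.
move=> Hr; rewrite (eq_bigr (fun v => \sum_(e in H | v \in e) 1))%N; last first.
  by move=> v _; rewrite link_degree -sum1_card; apply: eq_bigl => e; rewrite inE.
rewrite (exchange_big_dep (mem H)) /=; last by move=> v e _ /andP[].
rewrite (eq_bigr (fun=> r)); first by rewrite sum_nat_const mulnC.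
by move=> e eH; rewrite -(Hr e eH) -sum1_card; apply: eq_bigl => v; rewrite eH.
Qed.

Lemma card_remove (V : finType) (H : {set {set V}}) (W : {set V}) :
  (#|H| <= #|[set e in H | e \subset ~: W]| + \sum_(w in W) #|link w H|)%N.
Proof.
rewrite -(cardsID [set e : {set V} | e \subset ~: W] H); apply: leq_add.
  by apply: subset_leq_card; apply/subsetP => e; rewrite !inE.
apply: leq_trans (_ : #|\bigcup_(w in W) [set e in H | w \in e]| <= _)%N.
  apply: subset_leq_card; apply/subsetP => e; rewrite !inE => /andP[/subsetPn[w we]].
  by rewrite inE negbK => wW eH; apply/bigcupP; exists w => //; rewrite inE eH.
elim/big_rec2: _ => [|w m U _ IH]; first by rewrite cards0.
by apply: leq_trans (leq_card_setU _ _) _; rewrite link_degree leq_add2l.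
Qed.

Lemma low_bounds (R : realFieldType) (h w : R) : 0 < h -> h <= 1 -> h / 8 < w -> w <= h / 4 ->
  [/\ 0 <= w, w <= 1 & 1 / 2 <= 1 - w].
Proof. by move=> *; split; lra. Qed.

(** To first order, removing a fraction w of the vertices costs exactly the extremal degrees, so the
    deficit w h must be absorbed by w^2 + 2 e2. But w h - w^2 >= (3/4) w h > 3 h^2/32 = 3 e2. *)
Lemma low_arith (R : realFieldType) (h w e2 A B Q p rr G : R) :
  0 < h -> h <= 1 -> h / 8 < w -> w <= h / 4 -> 0 <= e2 -> 32 * e2 = h ^+ 2 ->
  0 <= A -> A * G <= 1 -> Q <= B -> A * rr = B -> p <= 1 -> p <= 1 - rr * w + G * w ^+ 2 ->
  A - e2 <= (A + e2) * p + w * (Q - h) -> False.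
Proof.
move=> h0 h1 w1 w2 e0 eE A0 AG QB AB p1 pw main.
have [w0 _ _] := low_bounds h0 h1 w1 w2.
have t1 : e2 * p <= e2 by rewrite ler_piMr.
have t2 := ler_wpM2l A0 pw.
have t4 : w * Q <= w * B by rewrite ler_wpM2l.
have t6 : A * (G * w ^+ 2) <= w ^+ 2 by rewrite mulrA ler_piMl ?sqr_ge0.
have t7 : w ^+ 2 <= h / 4 * w by rewrite expr2 ler_wpM2r.
have t8 : h / 8 * h < w * h by rewrite ltr_pM2r.
rewrite expr2 in eE.
have t5 : A * (rr * w) = w * B by rewrite -AB; ring.
move: main t2 t7 t8; rewrite mulrDl mulrBr !mulrDr mulr1 mulrN t5 (mulrAC h _ w) (mulrAC h _ h)
  (mulrC h w).
move: t1 t4 t6 eE.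
move: (w ^+ 2) (A * (_ * _)) (w * Q) (w * B) (e2 * p) (w * h) (h * h) (A * p) => *; lra.
Qed.

Lemma sqr_le_fact r : (r ^ 2 <= 2 * r`!)%N.
Proof.
case: r => [|[|[|[|j]]]]//; rewrite expnS expn1 (factS j.+3) mulnCA leq_mul2l /= (factS j.+2) mulnA.
apply: leq_trans (_ : 2 * j.+3 * 1 <= _)%N; first by lia.
by rewrite leq_mul2l fact_gt0 orbT.
Qed.

Section Stability.
Variables (R : realType) (r : nat) (L h : R) (V : finType).
Hypotheses (r4 : (4 <= r)%N) (Lq : (1 - r%:R^-1) ^+ r.-1 <= L) (L1 : L <= 1).
Hypotheses (h0 : 0 < h) (h1 : h <= 1).
Let k := r.-1.
Let q : R := 1 - r%:R^-1.
Let N : R := #|V|%:R.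
Let low (H : {set {set V}}) := [set w | #|link w H|%:R < (q ^+ k / k`!%:R - h) * N ^+ k].
Let e2 : R := h ^+ 2 / 32.

(** Otherwise delete a set W of low vertices of relative size between h/8 and h/4; the condition 8
    <= h N absorbs the rounding. The rest would have more edges than its order allows. *)
Lemma low_small (H : {set {set V}}) : 8 <= h * N -> is_uniform r H ->
  (forall S : {set V}, N / 2 <= #|S|%:R ->
     #|[set e in H | e \subset S]|%:R <= (L / r`!%:R + e2) * #|S|%:R ^+ r) ->
  (L / r`!%:R - e2) * N ^+ r <= #|H|%:R -> #|low H|%:R <= h / 8 * N.
Proof.
move=> Nh Hr ex big; rewrite leNgt; apply/negP => lt.
have N0 : 0 < N by have : 0 < h * N by [lra]; rewrite pmulr_rgt0.
pose c := (Num.truncn (h / 8 * N)).+1.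
have c1 : h / 8 * N < c%:R by apply: truncnS_gt.
have c2 : c%:R <= h / 4 * N.
  have : (Num.truncn (h / 8 * N))%:R <= h / 8 * N by rewrite truncn_le !mulr_ge0 ?invr_ge0 ?ltW.
  move: Nh; rewrite /c -[X in _ -> _ -> X <= _]natr1 !(mulrAC h _ N).
  by move: (h * N) => y; move: (Num.truncn _) => u; move: (u%:R : R) => z *; lra.
have [W WL Wc] : exists2 W : {set V}, W \subset low H & #|W| = c.
  by apply: subset_of_card; rewrite truncn_lt_nat// !mulr_ge0 ?invr_ge0 ?ltW.
pose w : R := c%:R / N.
have wE : c%:R = w * N by rewrite /w divfK// gt_eqF.
clearbody w.
have w1 : h / 8 < w by rewrite -(ltr_pM2r N0) -wE.
have w2 : w <= h / 4 by rewrite -(ler_pM2r N0) -wE.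
have cS : #|~: W|%:R = (1 - w) * N.
  have := cardsC W; rewrite Wc => /(congr1 (fun j : nat => j%:R : R)); rewrite natrD wE -/N; lra.
have [ww wl1 w12] := low_bounds h0 h1 w1 w2.
have big1 : N / 2 <= #|~: W|%:R.
  by rewrite cS mulrC ler_wpM2r ?(ltW N0)// -[_^-1]mul1r.
have exW := ex _ big1; rewrite cS exprMn in exW.
have rem := card_remove H W.
have sumW : \sum_(w in W) #|link w H|%:R <= w * N * ((q ^+ k / k`!%:R - h) * N ^+ k).
  rewrite -wE -Wc mulr_natl -sumr_const; apply: ler_sum => y yW.
  by have := subsetP WL y yW; rewrite inE => /ltW.
have main : (L / r`!%:R - e2) * N ^+ r <= (L / r`!%:R + e2) * (1 - w) ^+ r * N ^+ r + w * (q ^+ k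
  / k`!%:R - h) * N ^+ r.
  apply: le_trans big _; apply: le_trans (_ : #|[set e in H | e \subset ~: W]|%:R + \sum_(w in W)
    #|link w H|%:R <= _).
    by rewrite -natr_sum -natrD ler_nat.
  apply: lerD; first by rewrite -mulrA.
  apply: le_trans sumW _; rewrite [N ^+ r](_ : _ = N * N ^+ k);
    last by rewrite -exprS prednK// (leq_trans _ r4).
  by rewrite le_eqVlt; apply/orP; left; apply/eqP; ring.
rewrite -mulrDl ler_pM2r ?exprn_gt0// in main.
have f0 : 0 < r`!%:R :> R by rewrite ltr0n fact_gt0.
have k0 : 0 < k`!%:R :> R by rewrite ltr0n fact_gt0.
have rk : r%:R / r`!%:R = k`!%:R^-1 :> R.
  rewrite /k -(prednK (leq_trans (isT : 0 < 4)%N r4)) [_.+1.-1]/= factS natrM invfM mulrA divff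
    ?mul1r//.
  by rewrite pnatr_eq0.
have e20 : 0 <= e2 by rewrite divr_ge0 ?exprn_ge0 ?ltW.
have pw := pow_upper r ww wl1.
have r0 : (0 < r)%N by apply: leq_trans r4.
have L0 : 0 <= L by apply: le_trans Lq; rewrite exprn_ge0// subr_ge0 invf_le1 ?ler1n ?ltr0n.
have A0 : 0 <= L / r`!%:R by rewrite divr_ge0// ltW.
have p1 : (1 - w) ^+ r <= 1 by rewrite exprn_ile1// ?subr_ge0// gerBl.
have t3 : L / r`!%:R * (r%:R ^+ 2 / 2) <= 1.
  have rr' : r%:R ^+ 2 / 2 <= r`!%:R :> R by rewrite ler_pdivrMr// mulrC -natrX -natrM ler_nat
    sqr_le_fact.
  apply: le_trans (ler_wpM2l A0 rr') _; by rewrite divfK ?gt_eqF.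
apply: (low_arith h0 h1 w1 w2 e20 _ A0 t3 _ _ p1 pw main).
- by rewrite /e2; field.
- by apply: ler_wpM2r; [rewrite invr_ge0 ltW|exact: Lq].
by rewrite -mulrA [_^-1 * _]mulrC rk.
Qed.
End Stability.

Lemma stability (R : realType) (r : nat) (L : R) : (4 <= r)%N -> (1 - r%:R^-1) ^+ r.-1 <= L ->
  L <= 1 ->
  (forall eps : R, 0 < eps -> exists n0 : nat, forall (V : finType) (H : {set {set V}}) (S : {set
    V}),
    (n0 <= #|S|)%N -> is_uniform r H -> cfree H -> (forall e, e \in H -> e \subset S) ->
    #|H|%:R <= (L / r`!%:R + eps) * #|S|%:R ^+ r) ->
  exists (eps : R) (n0 : nat), 0 < eps /\ forall (V : finType) (H : {set {set V}}),
    (n0 <= #|V|)%N -> is_uniform r H -> cfree H ->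
    (forall v, (L / r.-1`!%:R - eps) * #|V|%:R ^+ r.-1 <= #|link v H|%:R) -> semib H setT.
Proof.
move=> r4 Lq L1 exb.
have [epsA epsA0 nonstar] := @nonstar_bound R r r4.
have [eta eta0 [n1 ext]] := semib_extend R r4.
pose h : R := Num.min eta 1.
have h0 : 0 < h by rewrite lt_min eta0 ltr01.
have h1 : h <= 1 by rewrite ge_min lexx orbT.
have he : h <= eta by rewrite ge_min lexx.
clearbody h.
have e20 : 0 < h ^+ 2 / 32 by rewrite divr_gt0 ?exprn_gt0.
have [n2 ex] := exb _ e20.
have f0 : 0 < r`!%:R :> R by rewrite ltr0n fact_gt0.
have r0 : (0 < r)%N by apply: leq_trans r4.
have [eps eE] : exists eps : R, eps = Num.min (h ^+ 2 / 32) (epsA / (2 * r`!%:R)) by eexists.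
have eps0 : 0 < eps by rewrite eE lt_min e20 divr_gt0// mulr_gt0.
have eps1 : eps <= h ^+ 2 / 32 by rewrite eE ge_min lexx.
have eps2 : r`!%:R * eps < epsA.
  have : eps <= epsA / (2 * r`!%:R) by rewrite eE ge_min lexx orbT.
  rewrite ler_pdivlMr ?mulr_gt0// => hh; rewrite mulrC.
  have : 0 < eps * r`!%:R by rewrite mulr_gt0.
  by move: hh; rewrite mulrCA; move: (eps * _) => z *; lra.
have eph : eps <= h.
  apply: le_trans eps1 _; rewrite ler_pdivrMr// expr2 ler_wpM2l ?(ltW h0)//.
  by apply: le_trans h1 _; rewrite ler1n.
clear eE.
have [n3 n3P] : exists n3 : nat, forall n, (n3 <= n)%N -> 8 <= h * n%:R.
  exists (Num.truncn (8 / h)).+1 => n nn; rewrite mulrC -ler_pdivrMr//.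
  by apply: ltW; apply: lt_le_trans (truncnS_gt _) _; rewrite ler_nat.
exists eps, (maxn n1 (maxn (2 * n2) n3)); split=> // V H0;
  rewrite !geq_max => /and3P[nV1 nV2 nV3] Hr0 Hf0 deg.
pose N : R := #|V|%:R.
have hN : 8 <= h * N by apply: n3P.
have N0 : 0 < N by rewrite -(pmulr_rgt0 _ h0); apply: lt_le_trans hN.
pose low (H : {set {set V}}) := [set w | #|link w H|%:R < ((1 - r%:R^-1) ^+ r.-1 / r.-1`!%:R - h)
  * N ^+ r.-1].
have k0 : 0 < r.-1`!%:R :> R by rewrite ltr0n fact_gt0.
have lowP (H : {set {set V}}) : is_uniform r H -> cfree H ->
  (L / r`!%:R - eps) * N ^+ r <= #|H|%:R -> #|low H|%:R <= h / 8 * N.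
  move=> Hr Hf HE; apply: (low_small r4 Lq L1 h0 h1 hN Hr); last first.
    by apply: le_trans HE; rewrite ler_wpM2r ?exprn_ge0 ?(ltW N0)// lerD2l lerN2.
  move=> S SN; apply: ex.
  - rewrite -(leq_pmul2l (isT : 0 < 2)%N); apply: leq_trans nV2 _; rewrite -(ler_nat R) natrM -/N.
    by move: SN; rewrite ler_pdivrMr// mulrC.
  - by move=> e; rewrite inE => /andP[/Hr].
  - move=> e f; rewrite !inE => /andP[eH eS] /andP[fH fS] d.
    have [a [b [ae bf nc]]] := Hf e f eH fH d; exists a, b; split=> //.
    apply: contra nc => /covP[g [+ ag bg]]; rewrite inE => /andP[gH _].
    by apply/covP; exists g.
  by move=> e; rewrite inE => /andP[].
(* Intermediate graphs can have vertices of low degree, so the invariant concerns only the others.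
   For the original graph, [low] is empty. *)
have main : forall H : {set {set V}}, is_uniform r H -> cfree H ->
  (L / r`!%:R - eps) * N ^+ r <= #|H|%:R -> semib H (~: low H).
  apply: (sym_ind (r := r)) => [H Hr Hf HE tw|H u v Hr Hf HE uv HE' sH'].
    apply: (semibS (subsetT _)); apply: (sym_base nonstar _ Hr Hf tw); first by rewrite -(ltr0n R).
    apply: lt_le_trans (ler_wpM2l (ltW f0) HE); rewrite mulrA ltr_pM2r ?exprn_gt0//.
    rewrite mulrBr [_ / _]mulrC mulrA divff ?gt_eqF// mul1r.
    by move: Lq eps2; move: (_ ^+ _) (r`!%:R * eps) => *; lra.
  pose H' := clone H u v.
  (* H and its clone have the same edges inside S0, so H is semibipartite there. The other vertices
     outside [low H] return one at a time by [semib_extend]; at most h N / 4 + 1 vertices are ever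
     missing. *)
  pose S0 := ~: (low H' :|: (u |: low H)).
  have key : forall j (S : {set V}), #|~: low H :\: S| = j -> S0 \subset S ->
    S \subset ~: low H -> semib H S -> semib H (~: low H).
    elim=> [|j IH] S cS S0S SL sS.
      have -> : ~: low H = S => //; apply/eqP; rewrite eqEsubset SL andbT -setD_eq0 -cards_eq0 cS
        eqxx //.
    have /card_gt0P[v' ] : (0 < #|~: low H :\: S|)%N by rewrite cS.
    rewrite in_setD => /andP[vS vL].
    have sub : v' |: S \subset ~: low H by rewrite subUset sub1set vL.
    apply: (IH (v' |: S)) => //.
    - have := cardsD1 v' (~: low H :\: S); rewrite in_setD vS vL cS add1n => -[->].
      by apply: eq_card => y; rewrite !inE negb_or andbA.
    - by apply: subset_trans S0S (subsetU1 _ _).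
    apply: ext => //.
      apply: le_trans (_ : h * N <= _); last by rewrite ler_wpM2r// ltW.
      have c1 := lowP H Hr Hf HE; have c2 := lowP H' (clone_uniform Hr) (clone_cfree Hf) HE'.
      have cS0 : (#|~: S| <= #|low H'| + (1 + #|low H|))%N.
        apply: leq_trans (_ : #|low H' :|: (u |: low H)| <= _)%N.
          by apply: subset_leq_card; rewrite -setCS setCK.
        apply: leq_trans (leq_card_setU _ _) _; rewrite leq_add2l cardsU1 leq_add2r.
        exact: leq_b1.
      have : #|~: S|%:R <= #|low H'|%:R + (1 + #|low H|%:R) :> R.
        by rewrite -(natrD _ 1) -natrD ler_nat.
      move=> /le_trans; apply.
      move: c1 c2 hN; rewrite -/N (mulrAC h _ N).
      move: (h * N) (#|low H|%:R : R) (#|low H'|%:R : R) => x y z *; lra.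
    move=> w wS; have := subsetP sub w wS; rewrite !inE -leNgt => hw.
    apply: le_trans hw; rewrite ler_wpM2r ?exprn_ge0 ?(ltW N0)//.
    by rewrite lerD2l lerN2.
  apply: (key _ S0 erefl) => //.
    by rewrite /S0 setCS; apply: subset_trans (subsetUr _ _); apply: subsetUr.
  have [A hA] := sH'; exists A => e eH eS; apply: hA.
    rewrite clone_old//; apply/negP => ue; have := subsetP eS u ue.
    by rewrite !inE eqxx orbT.
  by apply: subset_trans eS _; rewrite /S0 setCS subsetUl.
have low0 : low H0 = set0.
  apply/setP => w; rewrite !inE; apply/negbTE; rewrite -leNgt; apply: le_trans (deg w).
  rewrite ler_wpM2r ?exprn_ge0 ?(ltW N0)//; apply: lerB => //.
  by apply: ler_wpM2r => //; rewrite invr_ge0 ltW.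
have := main H0 Hr0 Hf0; rewrite low0 setC0; apply.
have hs := handshake Hr0.
have r0' : 0 < r%:R :> R by rewrite ltr0n.
rewrite -(ler_pM2l r0') -natrM -hs natr_sum.
apply: le_trans (_ : \sum_(v : V) (L / r.-1`!%:R - eps) * N ^+ r.-1 <= _); last by apply: ler_sum.
rewrite sumr_const cardT -cardE -[X in _ <= X]mulr_natr -/N -mulrA -exprSr prednK// mulrA.
rewrite ler_wpM2r ?exprn_ge0 ?(ltW N0)// mulrBr; apply: lerB; last by rewrite ler_peMl ?ler1n ?ltW.
rewrite -[in X in X <= _](prednK r0) factS natrM (prednK r0) invfM mulrCA (mulrA r%:R) divff
  ?mul1r//.
by rewrite gt_eqF.
Qed.

(** * Turan numbers *)

Section Free.
Variable r : nat.
Hypothesis r0 : (0 < r)%N.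
Let F : hfamily := weak_expansions r (M2 r).

Lemma inl_edge : [set inl i | i : 'I_r] \in M2 r. Proof. by rewrite !inE eqxx. Qed.

Lemma inr_edge : [set inr i | i : 'I_r] \in M2 r. Proof. by rewrite !inE eqxx orbT. Qed.

Lemma cross_uncovered (i j : 'I_r) : [set inl i; inr j] \in uncovered_pairs (M2 r).
Proof.
rewrite inE cards2 /= negb_exists; apply/forallP => e; rewrite negb_and -implybE; apply/implyP.
rewrite !inE => /orP[] /eqP ->; rewrite subUset !sub1set negb_and.
  by apply/orP; right; apply/negP => /imsetP[].
by apply/orP; left; apply/negP => /imsetP[].
Qed.

Lemma uncovered_cross p : p \in uncovered_pairs (M2 r) -> exists i j, p = [set inl i; inr j].
Proof.
rewrite inE => /andP[/cards2P[a [b [ab ->]]]]; rewrite negb_exists_in => /forall_inP h.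
have hl := h _ inl_edge; have hr := h _ inr_edge; move: {h} ab hl hr.
rewrite !subUset !sub1set.
case: a => a; case: b => b ab.
- by rewrite !imset_f.
- by exists a, b.
- by exists b, a; rewrite setUC.
by rewrite !imset_f.
Qed.

Lemma free_cfree (V : finType) (H : {set {set V}}) : is_uniform r H -> is_free F H -> cfree H.
Proof.
move=> Hr Hf e1 e2 e1H e2H dis.
have c1 : #|e1| = r by apply: Hr. have c2 : #|e2| = r by apply: Hr.
have [/existsP[u /existsP[v /and3P[ue ve nc]]]|all] :=
  boolP [exists u, [exists v, [&& u \in e1, v \in e2 & ~~ cov H u v]]]; first by exists u, v.
exfalso.
have cvr u v : u \in e1 -> v \in e2 -> cov H u v.
  move=> ue ve; apply: contraNT all => nc; apply/existsP; exists u; apply/existsP; exists v.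
  by rewrite ue ve nc.
pose g (z : 'I_r + 'I_r) : V := match z with
  | inl i => enum_val (cast_ord (esym c1) i) | inr i => enum_val (cast_ord (esym c2) i) end.
have gl i : g (inl i) \in e1 by apply: enum_valP.
have gr i : g (inr i) \in e2 by apply: enum_valP.
have ginj : injective g.
  have ne x y : x \in e1 -> y \in e2 -> x <> y.
    by move=> xe ye xy; move/pred0P: dis => /(_ x); rewrite /= xe xy ye.
  move=> [i|i] [j|j] E.
  - by move: E => /enum_val_inj/cast_ord_inj ->.
  - by case: (ne _ _ (gl i) (gr j)).
  - by case: (ne _ _ (gl j) (gr i)).
  by move: E => /enum_val_inj/cast_ord_inj ->.
pose SV (p : {set 'I_r + 'I_r}) : {set V} := odflt set0 [pick e in H | g @: p \subset e].
have SVP p : p \in uncovered_pairs (M2 r) -> SV p \in H /\ g @: p \subset SV p.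
  move=> /uncovered_cross[i [j ->]]; rewrite /SV; case: pickP => [e /andP[]//|no].
  have /covP[e [eH ie je]] := cvr _ _ (gl i) (gr j).
  by have := no e; rewrite /= eH imsetU1 imset_set1 subUset !sub1set ie je.
pose W : {set V} := (g @: setT) :|: \bigcup_(p in uncovered_pairs (M2 r)) SV p.
(* A weak expansion has no spare vertices, so its vertex type must be cut down to those in use. *)
pose U : finType := {x : V | x \in W}.
have gW z : g z \in W by rewrite inE imset_f.
pose f (z : 'I_r + 'I_r) : U := Sub (g z) (gW z).
pose S (p : {set 'I_r + 'I_r}) : {set U} := [set x | val x \in SV p].
have valS p : p \in uncovered_pairs (M2 r) -> val @: S p = SV p.
  move=> pu; apply/setP => x; apply/imsetP/idP => [[y]|xS]; first by rewrite inE => ? ->.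
  have xW : x \in W by rewrite inE; apply/orP; right; apply/bigcupP; exists p.
  by exists (Sub x xW); rewrite ?inE ?SubK.
have finj : injective f by move=> a b /(congr1 val); rewrite !SubK => /ginj.
pose G : {set {set U}} := [set f @: (e : {set 'I_r + 'I_r}) | e in M2 r] :|: [set S p | p in
  uncovered_pairs (M2 r)].
apply: (Hf U G).
  exists f, S; split=> //.
    move=> p pu; have [SH gS] := SVP p pu; split.
      by rewrite -(card_imset _ val_inj) valS// Hr.
    by apply/subsetP => _ /imsetP[z zp ->]; rewrite inE SubK (subsetP gS)// imset_f.
  apply/setP => y; rewrite in_setT; apply/esym; have := valP y; rewrite [X in is_true X]in_setU.
  move=> /orP[/imsetP[z _ yz]|/bigcupP[p pu yp]]; rewrite in_setU; apply/orP; [left|right].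
    by apply/imsetP; exists z => //; apply: val_inj.
  by apply/bigcupP; exists p => //; rewrite inE.
exists val; split; first exact: val_inj.
move=> e; rewrite in_setU => /orP[/imsetP[e0 e0M ->]|/imsetP[p pu ->]]; last first.
  by rewrite valS//; have [] := SVP p pu.
have vf : val @: (f @: e0) = g @: e0 by rewrite -imset_comp; apply: eq_imset.
rewrite vf; move: e0M; rewrite !inE => /orP[] /eqP ->.
  rewrite (_ : _ @: _ = e1) //; apply/eqP; rewrite eqEcard; apply/andP; split.
    by apply/subsetP => _ /imsetP[_ /imsetP[i _ ->] ->].
  by rewrite card_imset// card_imset ?card_ord ?c1// => a b [].
rewrite (_ : _ @: _ = e2) //; apply/eqP; rewrite eqEcard; apply/andP; split.
  by apply/subsetP => _ /imsetP[_ /imsetP[i _ ->] ->].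
by rewrite card_imset// card_imset ?card_ord ?c2// => a b [].
Qed.

Lemma cfree_free (V : finType) (H : {set {set V}}) : cfree H -> is_free F H.
Proof.
move=> Hf U G [f [S [finj hS GE _]]] [h [hinj hG]].
pose e1 := h @: (f @: [set inl i | i : 'I_r]); pose e2 := h @: (f @: [set inr i | i : 'I_r]).
have inG (e : {set 'I_r + 'I_r}) : e \in M2 r -> f @: e \in G by move=> eM; rewrite GE inE imset_f.
have e1H : e1 \in H by apply: hG; apply/inG/inl_edge.
have e2H : e2 \in H by apply: hG; apply/inG/inr_edge.
have dis : [disjoint e1 & e2].
  apply/pred0P => x; apply/negbTE/negP => /andP[/imsetP[_ /imsetP[_ /imsetP[i _ ->] ->] ->]].
  by move=> /imsetP[_ /imsetP[_ /imsetP[j _ ->] ->] /hinj/finj].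
have [_ [_ [/imsetP[_ /imsetP[_ /imsetP[i _ ->] ->] ->] /imsetP[_ /imsetP[_ /imsetP[j _ ->] ->]
  ->] /negP]]] := Hf _ _ e1H e2H dis.
apply; have pu := cross_uncovered i j; have [_ sub] := hS _ pu.
apply/covP; exists (h @: S [set inl i; inr j]).
move: sub; rewrite imsetU1 imset_set1 subUset !sub1set => /andP[s1 s2].
split; [|exact: imset_f|exact: imset_f].
by apply: hG; rewrite GE inE; apply/orP; right; apply: imset_f.
Qed.

Lemma ex_bound (V : finType) (H : {set {set V}}) (S : {set V}) : is_uniform r H -> cfree H ->
  (forall e, e \in H -> e \subset S) -> (#|H| <= turan_number r #|S| F)%N.
Proof.
move=> Hr Hf HS.
have [e0|[v0 v0S]] := set_0Vmem S.
  have : (#|H| <= 0)%N; last by move=> /leq_trans; apply.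
  rewrite leqn0 cards_eq0; apply/eqP/setP => e; rewrite inE; apply/negbTE/negP => eH.
  by have := Hr e eH; have := HS e eH; rewrite e0 subset0 => /eqP ->; rewrite cards0 => rE;
    have := r0; rewrite -rE.
pose f : V -> 'I_#|S| := enum_rank_in v0S; pose g (i : 'I_#|S|) : V := enum_val i.
have fK : {in S, cancel f g} by move=> x xS; apply: enum_rankK_in.
have gK : cancel g f by apply: enum_valK_in.
have gS i : g i \in S by apply: enum_valP.
have imK (e : {set V}) : e \subset S -> g @: (f @: e) = e.
  move=> eS; rewrite -imset_comp -[RHS]imset_id; apply: eq_in_imset => x xe.
  by rewrite /= fK// (subsetP eS).
pose H' : {set {set 'I_#|S|}} := [set f @: (e : {set V}) | e in H].
have H'P e : e \in H' -> g @: e \in H by move=> /imsetP[e0 e0H ->]; rewrite imK ?HS.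
have ginj : injective g by apply: can_inj gK.
have -> : #|H| = #|H'|.
  rewrite card_in_imset// => e e' eH e'H E.
  by rewrite -(imK e (HS e eH)) E imK// HS.
apply: (@leq_bigmax_cond _ (fun G : {set {set 'I_#|S|}} => `[< is_uniform r G /\ is_free F G >])
  (fun G => #|G|) H').
apply/asboolP; split.
  by move=> e /H'P/Hr; rewrite card_imset.
apply: cfree_free => e e' eH e'H d.
have d' : [disjoint g @: e & g @: e'].
  by rewrite -setI_eq0 -imsetI; [rewrite imset_eq0 setI_eq0|move=> x y _ _; apply: ginj].
have [_ [_ [/imsetP[u ue ->] /imsetP[v ve ->] nc]]] := Hf _ _ (H'P e eH) (H'P e' e'H) d'.
exists u, v; split=> //; apply: contra nc => /covP[e2 [e2H ue2 ve2]].
by apply/covP; exists (g @: e2); rewrite H'P// !imset_f.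
Qed.

Lemma turan_le n : (turan_number r n F <= 'C(n, r))%N.
Proof.
apply/bigmax_leqP => H /asboolP[Hr _]; have := card_draws 'I_n r; rewrite card_ord => <-;
  apply: subset_leq_card.
by apply/subsetP => e /Hr er; rewrite inE er.
Qed.

Lemma turan_attained n : exists H : {set {set 'I_n}}, [/\ is_uniform r H,
  cfree H & #|H| = turan_number r n F].
Proof.
have [|H /asboolP[Hr Hf] HE] :=
    @eq_bigmax_cond _ (fun G : {set {set 'I_n}} => `[< is_uniform r G /\ is_free F G >]) (fun G
      => #|G|).
  apply/card_gt0P; exists set0; apply/asboolP; split=> [e|]; first by rewrite inE.
  by apply: cfree_free => e f; rewrite inE.
by exists H; split; [|exact: free_cfree|exact: (esym HE)].
Qed.

(** Double counting of edges and vertices outside them: this makes the densities nonincreasing. *)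
Lemma turan_step n : ((n.+1 - r) * turan_number r n.+1 F <= n.+1 * turan_number r n F)%N.
Proof.
have [H [Hr Hf <-]] := turan_attained n.+1.
have -> : ((n.+1 - r) * #|H| = \sum_(v : 'I_n.+1) #|[set e in H | v \notin e]|)%N.
  rewrite (eq_bigr (fun v => \sum_(e in H | v \notin e) 1))%N; last first.
    by move=> v _; rewrite -sum1_card; apply: eq_bigl => e; rewrite inE.
  rewrite (exchange_big_dep (mem H)) /=; last by move=> v e _ /andP[].
  rewrite (eq_bigr (fun=> n.+1 - r))%N; first by rewrite sum_nat_const mulnC.
  move=> e eH; have := cardsC e; rewrite card_ord (Hr e eH) => /(congr1 (subn^~ r));
    rewrite addKn => <-.
  rewrite -sum1_card.
  by apply: eq_bigl => v; rewrite inE eH.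
apply: (@leq_trans (\sum_(v : 'I_n.+1) turan_number r n F)%N);
  last by rewrite sum_nat_const card_ord.
apply: leq_sum => v _.
suff : (#|[set e in H | v \notin e]| <= turan_number r #|[set~ v]| F)%N by rewrite cardsC1 card_ord.
apply: ex_bound.
- by move=> e; rewrite inE => /andP[/Hr].
- move=> e f; rewrite !inE => /andP[eH ev] /andP[fH fv] d.
  have [a [b [ae bf nc]]] := Hf e f eH fH d; exists a, b; split=> //.
  apply: contra nc => /covP[g [+ ag bg]]; rewrite inE => /andP[gH _].
  by apply/covP; exists g.
by move=> e; rewrite inE => /andP[_ ve]; rewrite subsetC sub1set inE.
Qed.
End Free.

(** * Semibipartite graphs and the limit density *)

(** The uncovered pair consists of the two vertices in A: an edge covering both would meet A
    twice. *)
Lemma semib_cfree (V : finType) (H : {set {set V}}) (A : {set V}) :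
  (forall e, e \in H -> #|A :&: e| = 1%N) -> cfree H.
Proof.
move=> HA e f eH fH d.
have /eqP/cards1P[a Ea] := HA e eH; have /eqP/cards1P[b Eb] := HA f fH.
have : a \in A :&: e by rewrite Ea set11.
have : b \in A :&: f by rewrite Eb set11.
rewrite !inE => /andP[bA bf] /andP[aA ae].
exists a, b; split=> //; apply/negP => /covP[g [gH ag bg]].
have /eqP/cards1P[c Ec] := HA g gH.
have : a \in [set c] by rewrite -Ec inE aA ag.
have : b \in [set c] by rewrite -Ec inE bA bg.
rewrite !inE => /eqP bc /eqP ac; move/pred0P: d => /(_ a) /=; rewrite ae ac -bc bf.
by [].
Qed.

(** Factor by factor: (r-1)(rj - 1 - i) <= r((r-1)j - i) amounts to i <= r - 1. *)
Lemma ffact_ratio r j i : (i <= r.-1)%N -> (0 < r)%N -> (0 < j)%N ->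
  (r.-1 ^ i * ((r * j).-1 ^_ i) <= r ^ i * ((r.-1 * j) ^_ i))%N.
Proof.
move=> + r0 j0; elim: i => [//|i IH] ir.
rewrite !ffactnSr !expnSr mulnACA [leqRHS]mulnACA; apply: leq_mul; first exact/IH/ltnW.
case: r r0 ir {IH} => // s _; rewrite [_.-1]/= => ir.
rewrite -subn1 !mulnBr (mulnCA s s.+1 j) muln1 [(s.+1 * i)%N]mulSn.
by move: (s.+1 * (s * j))%N (s * i)%N => X Y; lia.
Qed.

Lemma star_count (V : finType) (A : {set V}) (m : nat) :
  (#|A| * 'C(#|~: A|, m) <= #|[set e : {set V} | (#|e| == m.+1) && (#|A :&: e| == 1%N)]|)%N.
Proof.
rewrite -cards_draws -cardsX.
have fact (a : V) (f : {set V}) : a \in A -> f \subset ~: A ->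
  A :&: (a |: f) = [set a] /\ (a |: f) :\: A = f.
  move=> aA fA; split; apply/setP => y; rewrite !inE.
    have [->|ya] /= := eqVneq y a; first by rewrite aA.
    by apply/negbTE/negP => /andP[yA yf]; have := subsetP fA y yf; rewrite inE yA.
  have [->|ya] /= := eqVneq y a.
    by rewrite aA /=; apply/esym/negbTE/negP => af; have := subsetP fA a af; rewrite inE aA.
  by case: (boolP (y \in f)) => [yf|]; rewrite ?andbF// andbT; have := subsetP fA y yf; rewrite inE.
have inj : {in setX A [set f : {set V} | f \subset ~: A & #|f| == m] &,
  injective (fun p => p.1 |: p.2)}.
  move=> [a f] [b g]; rewrite !inE /= => /andP[aA /andP[fA _]] /andP[bA /andP[gA _]] E.
  have [E1 E2] := fact a f aA fA; have [E3 E4] := fact b g bA gA.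
  by move: E1 E2; rewrite E E3 E4 => /setP/(_ b); rewrite !inE eqxx => /esym/eqP -> ->.
rewrite -[X in (X <= _)%N](card_in_imset inj) {inj}; apply: subset_leq_card.
apply/subsetP => _ /imsetP[[a f] + ->]; rewrite !inE /= => /andP[aA /andP[fA /eqP fm]].
have [-> _] := fact a f aA fA; rewrite cards1 eqxx andbT cardsU1 fm.
by case: (boolP (a \in f)) => // af; have := subsetP fA a af; rewrite inE aA.
Qed.

(** A takes the optimal proportion 1/r of the vertices, which is why the order is a multiple of
    r. *)
Lemma turan_lower r j : (0 < r)%N -> (0 < j)%N ->
  (r.-1 ^ r.-1 * 'C(r * j, r) <= r ^ r.-1 * turan_number r (r * j) (weak_expansions r (M2 r)))%N.
Proof.
move=> r0 j0; have jr : (j <= #|[set: 'I_(r * j)]|)%N by rewrite cardsT card_ord leq_pmull.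
have [A _ Aj] := subset_of_card jr.
pose H := [set e : {set 'I_(r * j)} | (#|e| == r) && (#|A :&: e| == 1%N)].
have HT : (#|H| <= turan_number r (r * j) (weak_expansions r (M2 r)))%N.
  have := @ex_bound r r0 _ H setT; rewrite cardsT card_ord; apply.
  - by move=> e; rewrite inE => /andP[/eqP].
  - by apply: (@semib_cfree _ _ A) => e; rewrite inE => /andP[_ /eqP].
  by move=> e _; apply: subsetT.
apply: leq_trans (leq_mul (leqnn _) HT).
have := star_count A r.-1; rewrite (prednK r0) Aj -/H.
have -> : #|~: A| = (r.-1 * j)%N.
  by apply/eqP; rewrite -(eqn_add2l j) -{1}Aj cardsC card_ord -{1}(prednK r0) mulSn.
move=> h; apply: leq_trans (leq_mul (leqnn _) h).
have cE : 'C(r * j, r) = (j * 'C((r * j).-1, r.-1))%N.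
  apply/eqP; rewrite -(eqn_pmul2l r0) mulnA; apply/eqP.
  by have := mul_bin_diag (r * j) r.-1; rewrite (prednK r0) => ->.
rewrite cE mulnCA [leqRHS]mulnCA leq_mul2l; apply/orP; right.
rewrite -(leq_pmul2r (fact_gt0 r.-1)) -!mulnA !bin_ffact.
exact: ffact_ratio.
Qed.

Section Limit.
Import all_classical all_reals all_analysis.
Import numFieldNormedType.Exports.

Lemma nonincreasing_limn (R : realType) (u : nat -> R) (r : nat) (lo : R) :
  (forall n, (r <= n)%N -> u n.+1 <= u n) -> (forall n, (r <= n)%N -> lo <= u n) ->
  [/\ lo <= limn u, limn u <= u r &
    forall eps, 0 < eps -> exists n0, forall n, (n0 <= n)%N -> u n <= limn u + eps].
Proof.
move=> ud ul; pose v n := u (n + r)%N.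
have vd : nonincreasing_seq v by apply/nonincreasing_seqP => n; apply: ud; apply: leq_addl.
have vl n : lo <= v n by apply: ul; apply: leq_addl.
have vc : cvgn v by apply: nonincreasing_is_cvgn => //; exists lo => _ [n _ <-].
have E : limn u = limn v.
  by apply: cvg_lim => //; rewrite -(cvg_shiftn r).
have lv := nonincreasing_cvgn_ge vd vc.
rewrite E; split; first by apply: limr_ge => //; apply: nearW.
  exact: (lv 0%N).
move=> eps e0; have [[n vn]|no] := pselect (exists n, v n <= limn v + eps).
  exists (n + r)%N => p np; rewrite -(subnK (leq_trans (leq_addl n r) np)).
  by apply: le_trans vn; apply: vd; rewrite leq_subRL ?(leq_trans (leq_addl n r) np)// addnC.
exfalso; have : limn v + eps <= limn v.
  by apply: limr_ge => //; apply: nearW => n; apply: ltW; rewrite ltNge; apply/negP => h;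
    apply: no; exists n.
by rewrite gerDl leNgt e0.
Qed.
End Limit.

Lemma turan_limit (R : realType) r : (0 < r)%N ->
  let L := turan_density R r (weak_expansions r (M2 r)) in
  [/\ (1 - r%:R^-1) ^+ r.-1 <= L, L <= 1 &
   forall eps : R, 0 < eps -> exists n0 : nat, forall (V : finType) (H : {set {set V}}) (S : {set
     V}),
    (n0 <= #|S|)%N -> is_uniform r H -> cfree H -> (forall e, e \in H -> e \subset S) ->
    #|H|%:R <= (L / r`!%:R + eps) * #|S|%:R ^+ r].
Proof.
move=> r0 L; pose ex n := turan_number r n (weak_expansions r (M2 r)).
pose t (n : nat) : R := (ex n)%:R / 'C(n, r)%:R.
have C0 n : (r <= n)%N -> 0 < 'C(n, r)%:R :> R by move=> rn; rewrite ltr0n bin_gt0.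
have td n : (r <= n)%N -> t n.+1 <= t n.
  move=> rn; rewrite /t ler_pdivrMr ?C0 ?leqW// mulrAC ler_pdivlMr ?C0// -!natrM ler_nat.
  have nr : (0 < n.+1 - r)%N by rewrite subn_gt0 ltnS.
  rewrite -(leq_pmul2l nr) !mulnA (mulnC (n.+1 - r)%N (ex n)) -[leqRHS]mulnA -mul_bin_down
    [_.+1.-1]/= mulnA (mulnC (ex n)).
  by rewrite leq_mul2r turan_step// orbT.
have td' n p : (r <= n)%N -> (n <= p)%N -> t p <= t n.
  move=> rn; elim: p => [|p IH]; first by rewrite leqn0 => /eqP ->.
  rewrite leq_eqVlt => /orP[/eqP ->//|np]; apply: le_trans (IH np); apply: td.
  exact: leq_trans rn np.
have lo n : (r <= n)%N -> (1 - r%:R^-1) ^+ r.-1 <= t n.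
  move=> rn; have n0 : (0 < n)%N by apply: leq_trans rn.
  (* By monotonicity each n is compared with its multiple r n, where the construction of
     [turan_lower] is available. *)
  apply: le_trans (td' n (r * n)%N rn (leq_pmull _ r0)).
  have rrn : (r <= r * n)%N by rewrite leq_pmulr.
  rewrite /t ler_pdivlMr ?C0//.
  have r0' : 0 < r%:R :> R by rewrite ltr0n.
  have -> : 1 - r%:R^-1 = r.-1%:R / r%:R :> R.
    by rewrite -[in X in _ = _ / X](prednK r0) -{1}(prednK r0) -[r.-1%:R](addrK 1) natr1 mulrBl
      divff ?mul1r// pnatr_eq0.
  rewrite exprMn exprVn mulrAC ler_pdivrMr ?exprn_gt0// mulrC [leRHS]mulrC -!natrX -!natrM
    ler_nat mulnC.
  exact: turan_lower.
have [l1 l2 l3] := nonincreasing_limn td lo.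
split; first exact: l1.
  apply: le_trans l2 _; rewrite /t binn divr1 -[leRHS]/(1%:R) ler_nat.
  by have := turan_le r r; rewrite binn.
move=> eps e0; have f0 : 0 < r`!%:R :> R by rewrite ltr0n fact_gt0.
have [n0 h] := l3 (eps * r`!%:R) (mulr_gt0 e0 f0).
exists n0 => V H S Sn Hr Hf HS; have := ex_bound r0 Hr Hf HS; rewrite -/(ex _) => exS.
apply: le_trans (_ : (ex #|S|)%:R <= _); first by rewrite ler_nat.
apply: le_trans (_ : t #|S| * 'C(#|S|, r)%:R <= _).
  (* The bound n0 does not force r <= #|S|; when the binomial coefficient is 0, so is the Turan
     number. *)
  rewrite /t; have [c|c] := posnP 'C(#|S|, r); last by rewrite divfK// pnatr_eq0 -lt0n.
  by have := turan_le r #|S|; rewrite -/(ex _) c leqn0 => /eqP ->; rewrite mulr0.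
apply: le_trans (ler_wpM2r (ler0n _ _) (h _ Sn)) _.
have -> : L / r`!%:R + eps = (L + eps * r`!%:R) / r`!%:R by rewrite mulrDl mulfK// gt_eqF.
have Le0 : 0 <= L + eps * r`!%:R.
  apply: addr_ge0; last by rewrite mulr_ge0 ?ltW.
  apply: le_trans l1; rewrite exprn_ge0// subr_ge0 invf_le1 ?ltr0n// ler1n //.
rewrite -mulrA; apply: ler_wpM2l => //.
by rewrite ler_pdivlMl// -natrM mulnC bin_ffact -natrX ler_nat ffact_le_expn.
Qed.

Lemma min_degree_le (V : finType) (H : {set {set V}}) v : (min_degree H <= #|link v H|)%N.
Proof.
rewrite link_degree -/(degree H v) /min_degree.
have : v \in index_enum V by apply: mem_index_enum.
elim: (index_enum V) => [//|w s IH]; rewrite big_cons inE => /orP[/eqP ->|/IH h].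
  by rewrite geq_min leqnn.
by rewrite geq_min h orbT.
Qed.

Theorem theorem1p14 (R : realType) (r : nat) (hr : (4 <= r)%N) :
  degree_stable R r (weak_expansions r (M2 r)) (complete_semibipartite r).
Proof.
have r0 : (0 < r)%N by apply: leq_trans hr.
split=> [T G [Gr [A [GA _]]]|].
  by split=> //; apply: cfree_free => //; apply: semib_cfree GA.
have [Lq L1 exb] := turan_limit R r0.
have [eps [n0 [e0 st]]] := stability hr Lq L1 exb.
exists eps, n0; split=> // T H Hr Hf nT deg.
have [|A HA] := st T H nT Hr (free_cfree Hr Hf).
  by move=> v; apply: le_trans deg _; rewrite ler_nat min_degree_le.
exists T, [set e : {set T} | (#|e| == r) && (#|A :&: e| == 1%N)]; split.
  split; first by move=> e; rewrite inE => /andP[/eqP].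
  exists A; split=> [e|e er eA]; first by rewrite inE => /andP[_ /eqP].
  by rewrite inE er eA !eqxx.
exists id; split=> // e eH; rewrite imset_id inE (Hr e eH) (HA e eH (subsetT _)) !eqxx.
by [].
Qed.
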